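(* Let $G=(V,E)$ be a weighted directed $n$-vertex graph, and let $1\le k\le n$. Then there is a deterministic parallel (PRAM) algorithm that computes all (exact) distances between any $u\in V$ and its $k$ nearest neighbors, that runs in parallel time $\log^{O(1)}n$, using work $\tilde{O}(k\cdot n^2)$. Furthermore, for each $i\in V$ and $j\in N_k(i)$, a shortest path can be reported in $O(\log k)$ parallel time and work proportional to the number of edges in it.
   Context: PRAM model: many processors share a single memory and operate in synchronous rounds; parallel time is the number of rounds and work is the number of processors times the number of rounds. For a vertex $v$, order all other vertices $z_1,z_2,\dots$ by non-decreasing directed distance $d_G(v,\cdot)$ (ties broken arbitrarily); the $k$ nearest neighbors of $v$ are $N_k(v)=\{z_1,\dots,z_k\}$. $\tilde O$ hides polylogarithmic factors in $n$.
   Formalization: Edge weights are assumed non-negative (with negative cycles distances are undefined), and a shortest path is reported only for those j in N_k(i) at finite distance from i, since an unreachable neighbor has no path. *)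

(* Defs.v *)
From HB Require Import structures.
From mathcomp Require Import all_boot all_order all_algebra.
From mathcomp Require Import constructive_ereal.

Set Implicit Arguments.
Unset Strict Implicit.
Unset Printing Implicit Defensive.

Import Order.TTheory GRing.Theory Num.Theory.

(** * Weighted directed graphs, distances and nearest neighbours *)

Record wdigraph (R : realDomainType) (n : nat) := WDigraph {
  edge : rel 'I_n;
  wt : 'I_n -> 'I_n -> R;
  wt_ge0 : forall u v, edge u v -> (0 <= wt u v)%R
}.

Section Graph.
Variables (R : realDomainType) (n : nat) (G : wdigraph R n).

(* As in [path], a path is given by its first vertex u and the sequence p of
   the vertices that follow it, so that it has [size p] edges. *)
Fixpoint plen (u : 'I_n) (p : seq 'I_n) : R :=
  if p is v :: q then (wt G u v + plen v q)%R else 0%R.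

Definition simple_path (u v : 'I_n) (p : seq 'I_n) : bool :=
  [&& path (edge G) u p, last u p == v & uniq (u :: p)].

(* A simple path has fewer than n edges; the distance is +oo if there is no
   path from u to v. *)
Definition dist (u v : 'I_n) : \bar R :=
  \big[Order.min/+oo%E]_(m < n)
    \big[Order.min/+oo%E]_(p : m.-tuple 'I_n | simple_path u v p) (plen u p)%:E.

Definition shortest_path (u v : 'I_n) (p : seq 'I_n) : Prop :=
  simple_path u v p /\ (plen u p)%:E = dist u v.

(* zs is a possible value of the list of the k nearest neighbours of u, for
   some way to break the ties.  There are only n - 1 vertices other than u, so
   that zs has size [minn k n.-1]. *)
Definition nearest (k : nat) (u : 'I_n) (zs : seq 'I_n) : Prop :=
  exists2 s : seq 'I_n,
    perm_eq s [seq z <- enum 'I_n | z != u] /\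
    sorted (fun x y => dist u x <= dist u y)%E s
  & zs = take k s.

End Graph.

(** * The PRAM *)

(* All processors run the same program, on natural numbers and on weights; the
   weights can only be moved, added and compared.  [r], [s], [t] and [a] are
   names of registers, and a memory access uses the address which is in
   register [a].  There are separate registers, and separate arrays in the
   shared memory, for the two types of data. *)
Inductive nop := Add | Sub | Mul | Div.

Inductive test :=
  | NLt of nat & nat
  | NEq of nat & nat
  | WLe of nat & nat.

Inductive stmt :=
  | NConst (r c : nat)
  | NOp (o : nop) (r s t : nat)
  | NLoad (r a : nat)
  | NStore (a r : nat)
  | WZero (r : nat)
  | WInf (r : nat)
  | WAdd (r s t : nat)
  | WLoad (r a : nat)
  | WStore (a r : nat)
  | If (b : test) (p q : seq stmt)
  | While (b : test) (p : seq stmt).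

Definition program := seq stmt.

Definition nop_eval (o : nop) : nat -> nat -> nat :=
  match o with Add => addn | Sub => subn | Mul => muln | Div => divn end.

Definition upd (V : Type) (f : nat -> V) (a : nat) (v : V) : nat -> V :=
  fun x => if x == a then v else f x.

Section Machine.
Variable R : realDomainType.

Record memory := Memory { nmem : nat -> nat; wmem : nat -> \bar R }.

(* [ctl] is what the processor still has to execute; it has halted when [ctl]
   is empty. *)
Record local := Local {
  ctl : program;
  nreg : nat -> nat;
  wreg : nat -> \bar R
}.

Record config (p : nat) := Config { procs : 'I_p -> local; shared : memory }.

Definition test_eval (s : local) (b : test) : bool :=
  match b with
  | NLt x y => nreg s x < nreg s y
  | NEq x y => nreg s x == nreg s y
  | WLe x y => (wreg s x <= wreg s y)%E
  end.

(* One round of one processor.  The stores have no effect here: they are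
   collected by [nwrite] and [wwrite], and done after all the loads. *)
Definition local_step (m : memory) (l : local) : local :=
  let N := nreg l in
  let W := wreg l in
  match ctl l with
  | [::] => l
  | NConst r c :: K => Local K (upd N r c) W
  | NOp o r s t :: K => Local K (upd N r (nop_eval o (N s) (N t))) W
  | NLoad r a :: K => Local K (upd N r (nmem m (N a))) W
  | NStore a r :: K => Local K N W
  | WZero r :: K => Local K N (upd W r 0%E)
  | WInf r :: K => Local K N (upd W r +oo%E)
  | WAdd r s t :: K => Local K N (upd W r (W s + W t)%E)
  | WLoad r a :: K => Local K N (upd W r (wmem m (N a)))
  | WStore a r :: K => Local K N W
  | If b p q :: K => Local ((if test_eval l b then p else q) ++ K) N W
  | While b p :: K =>
      Local (if test_eval l b then p ++ While b p :: K else K) N W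
  end.

Definition nwrite (l : local) : option (nat * nat) :=
  if ctl l is NStore a r :: _ then Some (nreg l a, nreg l r) else None.

Definition wwrite (l : local) : option (nat * \bar R) :=
  if ctl l is WStore a r :: _ then Some (nreg l a, wreg l r) else None.

Section Round.
Variable p : nat.

Definition commit (V : Type) (wr : 'I_p -> option (nat * V)) (f : nat -> V) :
    nat -> V := fun a =>
  if [pick i | omap fst (wr i) == Some a] is Some i
  then odflt (f a) (omap snd (wr i)) else f a.

Definition step (C : config p) : config p :=
  let m := shared C in
  Config (fun i => local_step m (procs C i))
    (Memory (commit (fun i => nwrite (procs C i)) (nmem m))
            (commit (fun i => wwrite (procs C i)) (wmem m))).

Definition halted (C : config p) : Prop := forall i, ctl (procs C i) = [::].

Definition exclusive (V : Type) (wr : 'I_p -> option (nat * V)) : Prop :=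
  forall i j a v w, wr i = Some (a, v) -> wr j = Some (a, w) -> i = j.

(* Concurrent reads are allowed and concurrent writes are not.  The natural
   numbers in the registers and in the memory, hence also the addresses, are
   at most B. *)
Definition legal (B : nat) (C : config p) : Prop :=
  [/\ exclusive (fun i => nwrite (procs C i)),
      exclusive (fun i => wwrite (procs C i)),
      forall i r, nreg (procs C i) r <= B
    & forall a, nmem (shared C) a <= B].

(* Register 0 holds the number of the processor, and registers 1, 2, ... hold
   the arguments. *)
Definition start (prog : program) (args : seq nat) (m : memory) : config p :=
  Config (fun i => Local prog (nth 0 (nat_of_ord i :: args)) (fun=> 0%E)) m.

End Round.

(* From memory m, p processors that run prog all halt within T rounds and
   leave memory m'. *)
Definition exec (B p T : nat) (prog : program) (args : seq nat)
    (m m' : memory) : Prop :=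
  let C t := iter t (@step p) (start p prog args m) in
  [/\ forall t, legal B (C t), halted (C T) & shared (C T) = m'].

(* The input is the weight matrix, in row-major order, with +oo for the pairs
   that are not edges. *)
Definition input (n : nat) (G : wdigraph R n) : memory :=
  Memory (fun=> 0) (fun a =>
    match insub (a %/ n), insub (a %% n) with
    | Some u, Some v => if edge G u v then (wt G u v)%:E else +oo%E
    | _, _ => +oo%E
    end).

(* The x-th nearest neighbour of u and its distance are at address
   n ^ 2 + u * k + x of the two arrays. *)
Definition stores_nearest (n k : nat) (G : wdigraph R n)
    (N : 'I_n -> seq 'I_n) (m : memory) : Prop :=
  forall (u : 'I_n) (x : nat), x < size (N u) ->
    let z := nth u (N u) x in
    nmem m (n ^ 2 + u * k + x) = z /\
    wmem m (n ^ 2 + u * k + x) = dist G u z.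

(* The number of edges, followed by the vertices, from address 0. *)
Definition stores_path (n : nat) (i : 'I_n) (q : seq 'I_n) (m : memory) :
    Prop :=
  nmem m 0 = size q /\
  forall x, x <= size q -> nmem m x.+1 = nth i (i :: q) x.

End Machine.

(* The logarithm, made positive so that O(log k) makes sense for k = 1. *)
Definition lg (n : nat) : nat := (trunc_log 2 n).+1.

(* Main.v *)
Require Import Defs.
From mathcomp Require Import all_boot all_order all_algebra.
From mathcomp Require Import constructive_ereal.
From mathcomp Require Import zify.
From Stdlib Require Import FunctionalExtensionality.

(** Order the vertices by (distance, number of edges, name), and let [E u w] be
    an upper bound for the key (distance, number of edges) of the pair [(u, w)].
    One round replaces [E u w] by the minimum of [E u v + E v w] over the [k + 1]
    vertices [v] that come first for [E u].  If [w] is among the [k] nearest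
    vertices of [u], then every vertex [v] of a best path from [u] to [w] is among
    the [k] nearest of [u], and [w] is among the [k] nearest of [v]; so after [t]
    rounds [E u w] is exact for all such pairs that are at most [2 ^ t] edges
    apart, and [lg n] rounds are enough.  A round costs [k n^2] operations for the
    products and [n^2] for sorting the rows, by merging with binary searches, up
    to logarithmic factors.  Taking an argmin once more gives predecessors, and
    pointer doubling then tabulates all the paths, which take [n^2 (k + 1)] cells;
    a path of [s] edges is reported by [s / lg k + 1] processors that copy blocks
    of [lg k] vertices. *)

Set Implicit Arguments.
Unset Strict Implicit.
Unset Printing Implicit Defensive.

Import Order.TTheory GRing.Theory Num.Theory.

(** * Lexicographic keys *)

Notation key R := (\bar R *l nat)%type.

Section Key.
Variable R : realDomainType.
Implicit Types x y z : key R.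

Definition key_add x y : key R := ((x.1 + y.1)%E, x.2 + y.2).

(* The hop counts are stored in the memory, hence have to be bounded. *)
Definition truncate_hops n x : key R := (x.1, minn x.2 n).

Lemma key_leE (a b : R) (i j : nat) :
  (((a%:E, i) : key R) <= (b%:E, j))%O = (a < b)%R || (a == b) && (i <= j).
Proof. by rewrite leEprodlexi /= !lee_fin leEnat; case: (ltgtP a b). Qed.

Lemma key_ltE (a b : R) (i j : nat) :
  (((a%:E, i) : key R) < (b%:E, j))%O = (a < b)%R || (a == b) && (i < j).
Proof. by rewrite ltEprodlexi /= !lee_fin ltEnat; case: (ltgtP a b). Qed.

Lemma key_le_fst x y : (x <= y)%O -> (x.1 <= y.1)%E.
Proof. by rewrite leEprodlexi => /andP[]. Qed.

Lemma key_addC x y : key_add x y = key_add y x.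
Proof. by rewrite /key_add addeC addnC. Qed.

Lemma key_add_le_lt x x' y y' :
  x.1 \is a fin_num -> y.1 \is a fin_num -> (x <= x')%O -> (y < y')%O ->
  (key_add x y < key_add x' y')%O.
Proof.
case: x x' y y' => [[a| |] i] [[a'| |] i'] [[b| |] j] [[b'| |] j'] //= _ _;
  rewrite /key_add; try by move=> _ _; rewrite ltEprodlexi /= leey.
rewrite key_leE !key_ltE => /orP[lt_a|/andP[/eqP-> le_i]].
  by case/orP=> [lt_b|/andP[/eqP-> _]]; [rewrite ltrD | rewrite ltrD2r lt_a].
case/orP=> [lt_b|/andP[/eqP-> lt_j]]; first by rewrite ltrD2l lt_b.
by rewrite eqxx -addnS leq_add ?orbT.
Qed.

Lemma key_add_le x x' y y' :
  x.1 \is a fin_num -> y.1 \is a fin_num -> (x <= x')%O -> (y <= y')%O ->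
  (key_add x y <= key_add x' y')%O.
Proof.
move=> fin_x fin_y; rewrite le_eqVlt => /predU1P[<-|lt_x].
  rewrite le_eqVlt => /predU1P[<- //|lt_y].
  by apply/ltW/key_add_le_lt.
move=> le_y; rewrite key_addC (key_addC x').
exact/ltW/key_add_le_lt.
Qed.

Lemma key_add_squeeze x x' y y' :
  x.1 \is a fin_num -> y.1 \is a fin_num -> (x <= x')%O -> (y <= y')%O ->
  (key_add x' y' <= key_add x y)%O -> x = x' /\ y = y'.
Proof.
move=> fin_x fin_y le_x le_y le_add; split; apply/eqP.
  move: le_x; rewrite le_eqVlt => /predU1P[-> //|lt_x].
  by move: le_add; rewrite key_addC (key_addC x) leNgt key_add_le_lt.
move: le_y; rewrite le_eqVlt => /predU1P[-> //|lt_y].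
by move: le_add; rewrite leNgt key_add_le_lt.
Qed.

Lemma truncate_hops_id n x : x.2 <= n -> truncate_hops n x = x.
Proof.
by case: x => a i /= le_in; rewrite /truncate_hops (minn_idPl le_in).
Qed.

Lemma le_truncate_hops n x y :
  x.2 <= n -> (x <= y)%O -> (x <= truncate_hops n y)%O.
Proof.
move=> le_xn; rewrite !leEprodlexi /= => /andP[-> /implyP le_hops].
apply/implyP => /le_hops; rewrite !leEnat => le_xy.
by rewrite leq_min le_xy.
Qed.

Lemma truncate_hops_le n x y :
  y.2 < n -> (truncate_hops n x <= y)%O -> (x <= y)%O.
Proof.
move=> lt_yn; rewrite !leEprodlexi /= => /andP[-> /implyP le_hops].
apply/implyP => /le_hops; rewrite !leEnat geq_min => /orP[//|].
by rewrite leqNgt lt_yn.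
Qed.

End Key.

(** * Shortest paths with the fewest edges *)

Section FewestEdges.
Variables (R : realDomainType) (n : nat) (G : wdigraph R n).
Implicit Types (u v w : 'I_n) (p q : seq 'I_n) (x y : key R).

Section MinSimplePath.
Variables (d : Order.disp_t) (T : orderType d) (top : T) (F : seq 'I_n -> T).

Definition min_simple_path u w : T :=
  \big[Order.min/top]_(m < n)
    \big[Order.min/top]_(p : m.-tuple 'I_n | simple_path G u w p) F p.

Lemma size_simple_path u w p : simple_path G u w p -> size p < n.
Proof.
case/and3P => _ _ /card_uniqP /= card_p.
by have := max_card [in u :: p]; rewrite card_ord card_p.
Qed.

Lemma min_simple_path_le u w p :
  simple_path G u w p -> (min_simple_path u w <= F p)%O.
Proof.
move=> simple_p; pose m := Ordinal (size_simple_path simple_p).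
apply: le_trans (bigmin_le _ m _) _.
exact: (@bigmin_le_cond _ _ _ top (in_tuple p)
          (fun t : m.-tuple 'I_n => simple_path G u w t) (fun t => F t)).
Qed.

Lemma min_simple_pathP u w : min_simple_path u w = top \/
  exists2 p, simple_path G u w p & min_simple_path u w = F p.
Proof.
pose attained z := z = top \/ exists2 p, simple_path G u w p & z = F p.
have min_attained z z' : attained z -> attained z' -> attained (Order.min z z').
  by rewrite /Order.min; case: ifP.
rewrite -/(attained _) /min_simple_path.
elim/big_ind: _ => [||m _]; [by left | exact: min_attained |].
elim/big_ind: _ => [||p simple_p]; [by left | exact: min_attained |].
by right; exists p.
Qed.

End MinSimplePath.

Lemma distE u w :
  dist G u w = min_simple_path +oo%E (fun p => (plen G u p)%:E) u w.
Proof. by []. Qed.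

Definition walk u w p := path (edge G) u p && (last u p == w).

Definition path_key u p : key R := ((plen G u p)%:E, size p).

Definition no_path_key : key R := (+oo%E, n).

Definition min_key u w : key R := min_simple_path no_path_key (path_key u) u w.

Lemma le_no_path_key x : x.2 <= n -> (x <= no_path_key)%O.
Proof.
by move=> le_xn; rewrite leEprodlexi /= leey; apply/implyP => _; rewrite leEnat.
Qed.

Definition reachable u w := (min_key u w).1 \is a fin_num.

Lemma plen_cat u p q :
  plen G u (p ++ q) = (plen G u p + plen G (last u p) q)%R.
Proof. by elim: p u => [|v p IHp] u /=; rewrite ?add0r // IHp addrA. Qed.

Lemma plen_ge0 u p : path (edge G) u p -> (0 <= plen G u p)%R.
Proof.
elim: p u => [|v p IHp] u //= /andP[uv path_p].
by rewrite addr_ge0 ?wt_ge0 ?IHp.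
Qed.

Lemma walk_cat u v w p q : walk u v p -> walk v w q -> walk u w (p ++ q).
Proof.
move=> /andP[path_p /eqP last_p] /andP[path_q /eqP last_q].
by rewrite /walk cat_path last_cat path_p last_p path_q last_q eqxx.
Qed.

Lemma path_key_cat u v p q : last u p = v ->
  path_key u (p ++ q) = key_add (path_key u p) (path_key v q).
Proof. by move=> <-; rewrite /path_key plen_cat size_cat. Qed.

Lemma simple_path_walk u w p : simple_path G u w p -> walk u w p.
Proof. by case/and3P => path_p last_p _; apply/andP. Qed.

Lemma non_simple_walk_shorten u w p : walk u w p -> ~~ uniq (u :: p) ->
  exists q, [/\ walk u w q, size q < size p & (plen G u q <= plen G u p)%R].
Proof.
elim: p u => [|v p IHp] u //.
have [u_in_p + _|u_notin_p] := boolP (u \in v :: p).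
  rewrite /walk; case/splitPr: u_in_p => p1 p2.
  rewrite cat_path last_cat /= => /andP[/and3P[path_p1 edge_u path_p2] last_p2].
  exists p2; split; first by rewrite /walk path_p2.
    by rewrite size_cat /= addnS ltnS leq_addl.
  by rewrite plen_cat /= addrA lerDr addr_ge0 ?plen_ge0 ?wt_ge0.
rewrite /walk /= u_notin_p /= -andbA => /and3P[uv path_p last_p] not_uniq.
have [|q [walk_q lt_qp le_qp]] := IHp v _ not_uniq; first exact/andP.
exists (v :: q); split=> //=; last by rewrite lerD2l.
by move: walk_q; rewrite /walk /= uv.
Qed.

Lemma walk_to_simple_path u w p : walk u w p ->
  exists2 q, simple_path G u w q & (path_key u q <= path_key u p)%O.
Proof.
have [m] := ubnP (size p); elim: m p => // m IHm p lt_pm walk_p.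
have [uniq_p|not_uniq] := boolP (uniq (u :: p)).
  by exists p => //; move: walk_p => /andP[? ?]; apply/and3P.
have [q [walk_q lt_qp le_qp]] := non_simple_walk_shorten walk_p not_uniq.
have [|r simple_r le_rq] := IHm q _ walk_q; first exact: leq_trans lt_qp _.
exists r => //; apply: (le_trans le_rq).
by rewrite key_leE (ltnW lt_qp) andbT orbC -le_eqVlt.
Qed.

Lemma min_keyP u w : min_key u w = no_path_key \/
  exists2 p, simple_path G u w p & min_key u w = path_key u p.
Proof. exact: min_simple_pathP. Qed.

Lemma min_key_le u w p : walk u w p -> (min_key u w <= path_key u p)%O.
Proof.
case/walk_to_simple_path=> q simple_q; apply: le_trans.
exact: min_simple_path_le.
Qed.

Lemma min_key_dist u w : (min_key u w).1 = dist G u w.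
Proof.
rewrite distE; apply/eqP; rewrite eq_le; apply/andP; split.
  have [->|[p simple_p ->]] :=
    min_simple_pathP +oo%E (fun p => (plen G u p)%:E) u w; first exact: leey.
  apply: (@key_le_fst _ _ (path_key u p)).
  exact/min_key_le/simple_path_walk.
have [->|[p simple_p ->]] := min_keyP u w; first exact: leey.
exact: (min_simple_path_le _ (fun q => (plen G u q)%:E)).
Qed.

Lemma reachableP u w : reachable u w ->
  exists2 p, simple_path G u w p & min_key u w = path_key u p.
Proof. by rewrite /reachable; case: (min_keyP u w) => [->|]. Qed.

Lemma walk_reachable u w p : walk u w p -> reachable u w.
Proof.
move=> /min_key_le; rewrite /reachable.
by case: (min_keyP u w) => [->|[q _ ->] //]; rewrite leEprodlexi.
Qed.

Lemma not_reachable u w : ~~ reachable u w -> min_key u w = no_path_key.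
Proof. by rewrite /reachable; case: (min_keyP u w) => [|[p _ ->]]. Qed.

Lemma min_key_ge0 u w : (0 <= (min_key u w).1)%E.
Proof.
case: (min_keyP u w) => [->|[p /and3P[path_p _ _] ->]]; first exact: leey.
exact: plen_ge0 path_p.
Qed.

Lemma reachable_lty u w : reachable u w = ((min_key u w).1 < +oo)%E.
Proof. by rewrite /reachable ge0_fin_numE ?min_key_ge0. Qed.

Lemma hops_le u w : (min_key u w).2 <= n.
Proof.
by case: (min_keyP u w) => [-> //|[p /size_simple_path/ltnW le_pn ->]].
Qed.

Lemma reachable_hops_lt u w : reachable u w -> (min_key u w).2 < n.
Proof. by case/reachableP => p /size_simple_path lt_pn ->. Qed.

Lemma min_key_refl u : min_key u u = (0%E, 0).
Proof.
have walk_nil : walk u u [::] by rewrite /walk /=.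
have [p /and3P[path_p _ _] min_p] := reachableP (walk_reachable walk_nil).
have := min_key_le walk_nil; rewrite min_p key_leE ltNge plen_ge0 //=.
by rewrite leqn0 size_eq0 => /andP[_ /eqP->].
Qed.

Lemma hops_eq0 u w : reachable u w -> (min_key u w).2 = 0 -> u = w.
Proof.
case/reachableP=> p /and3P[_ /eqP last_p _] -> /= /eqP.
by rewrite size_eq0 => /eqP p0; rewrite p0 in last_p.
Qed.

Lemma hops_gt0 u w : reachable u w -> u != w -> 0 < (min_key u w).2.
Proof.
by move=> uw; rewrite lt0n; apply: contra_neq => /(hops_eq0 uw).
Qed.

Lemma min_key_gt0 u w : reachable u w -> u != w ->
  (((0%E, 0) : key R) < min_key u w)%O.
Proof.
move=> uw neq_uw; rewrite ltEprodlexi /= min_key_ge0 /=.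
by apply/implyP => _; apply: hops_gt0.
Qed.

Lemma min_key_edge u w : edge G u w ->
  (min_key u w <= ((wt G u w)%:E, 1) :> key R)%O.
Proof.
move=> uw; have walk_w : walk u w [:: w] by rewrite /walk /= uw eqxx.
by have := min_key_le walk_w; rewrite /path_key /= addr0.
Qed.

Lemma hops_eq1 u w : reachable u w -> (min_key u w).2 = 1 ->
  edge G u w /\ min_key u w = ((wt G u w)%:E, 1).
Proof.
case/reachableP=> -[|v [|? ?]] // /and3P[+ /eqP/= last_v _] -> //= _.
by rewrite /= andbT last_v /path_key /= addr0.
Qed.

Lemma min_key_triangle u v w : reachable u v -> reachable v w ->
  (min_key u w <= key_add (min_key u v) (min_key v w))%O.
Proof.
case/reachableP=> p /simple_path_walk walk_p ->.
case/reachableP=> q /simple_path_walk walk_q ->.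
have /andP[_ /eqP last_p] := walk_p.
by rewrite -path_key_cat //; apply/min_key_le/(walk_cat walk_p).
Qed.

Definition between u v w :=
  [/\ reachable u v, reachable v w
    & min_key u w = key_add (min_key u v) (min_key v w)].

(* By the triangle inequality, both halves of a best path are best paths. *)
Lemma between_hops u w m : reachable u w -> m <= (min_key u w).2 ->
  exists2 v, between u v w & (min_key u v).2 = m.
Proof.
move=> /reachableP[p /simple_path_walk walk_p min_p]; rewrite min_p /= => le_mp.
set v := last u (take m p).
have [walk_l walk_r] : walk u v (take m p) /\ walk v w (drop m p).
  move: walk_p; rewrite /walk -{1 2}(cat_take_drop m p) cat_path last_cat.
  by case/andP=> /andP[-> ->] ->; rewrite eqxx.
have [uv vw] := (walk_reachable walk_l, walk_reachable walk_r).
have cat_p := path_key_cat (drop m p) (erefl v).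
rewrite cat_take_drop -min_p in cat_p.
have [eq_l _] : min_key u v = path_key u (take m p) /\
                min_key v w = path_key v (drop m p).
  apply: key_add_squeeze; rewrite ?min_key_le //.
  by rewrite -cat_p min_key_triangle.
exists v; last by rewrite eq_l /= size_takel.
split=> //; apply/eqP; rewrite eq_le min_key_triangle //= cat_p.
by apply: key_add_le => //; apply: min_key_le.
Qed.

Lemma walk_min_key_simple u w p :
  walk u w p -> path_key u p = min_key u w -> simple_path G u w p.
Proof.
move=> walk_p min_p; have [uniq_p|not_uniq] := boolP (uniq (u :: p)).
  by move: walk_p => /andP[? ?]; apply/and3P.
have [q [walk_q lt_qp le_qp]] := non_simple_walk_shorten walk_p not_uniq.
have := min_key_le walk_q.
by rewrite -min_p key_leE ltNge le_qp /= leqNgt lt_qp andbF.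
Qed.

End FewestEdges.

(** * Ranks *)

Section Rank.
Variables (d : Order.disp_t) (T : orderType d) (I : finType) (f : I -> T).
Hypothesis f_inj : injective f.
Implicit Types (A B : {set I}) (y w : I).

Definition rank A w := #|[set y in A | (f y < f w)%O]|.

Lemma rank_le_card A w : rank A w <= #|A|.
Proof. by apply/subset_leq_card/subsetP => y; rewrite inE => /andP[]. Qed.

Lemma rank_lt_card A w : w \in A -> rank A w < #|A|.
Proof.
move=> wA; apply/proper_card/properP; split.
  by apply/subsetP => y; rewrite inE => /andP[].
by exists w => //; rewrite inE ltxx andbF.
Qed.

Lemma rank_le A y w : (f y <= f w)%O -> rank A y <= rank A w.
Proof.
move=> le_yw; apply/subset_leq_card/subsetP => z.
by rewrite !inE => /andP[-> lt_zy]; apply: lt_le_trans le_yw.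
Qed.

Lemma rank_ltE A y w : y \in A -> (rank A y < rank A w) = (f y < f w)%O.
Proof.
move=> yA; case: (leP (f w) (f y)) => [le_wy|lt_yw].
  by apply/negbTE; rewrite -leqNgt; apply: rank_le.
apply/proper_card/properP; split; last first.
  by exists y; rewrite !inE ?ltxx ?andbF ?yA.
by apply/subsetP => z; rewrite !inE => /andP[-> lt_zy]; apply: lt_trans lt_yw.
Qed.

Lemma rank_inj A : {in A &, injective (rank A)}.
Proof.
move=> y w yA wA eq_rank; apply/f_inj/eqP.
by rewrite eq_le !leNgt -(rank_ltE y wA) -(rank_ltE w yA) eq_rank ltnn.
Qed.

Lemma rank_surj A r : r < #|A| -> exists2 w, w \in A & rank A w = r.
Proof.
case card_A: #|A| => [|m] // lt_rm.
pose ordinal_rank w : 'I_m.+1 := inord (rank A w).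
have val_rank w : w \in A -> ordinal_rank w = rank A w :> nat.
  by move=> wA; rewrite inordK // -card_A rank_lt_card.
have full : ordinal_rank @: A = setT.
  apply/eqP; rewrite eqEcard subsetT cardsT card_ord.
  rewrite card_in_imset ?card_A ?leqnn //=.
  move=> y w yA wA /(congr1 val) /=; rewrite !val_rank //; exact: rank_inj.
have /imsetP[w wA /(congr1 val) /= eq_r] : Ordinal lt_rm \in ordinal_rank @: A.
  by rewrite full.
by exists w; rewrite // -val_rank.
Qed.

Lemma rankU A B w : [disjoint A & B] -> rank (A :|: B) w = rank A w + rank B w.
Proof.
move=> disjointAB; rewrite /rank -cardsUI.
rewrite [X in _ = _ + X](_ : _ = 0) ?addn0.
  by apply: eq_card => y; rewrite !inE andb_orl.
apply/eqP; rewrite cards_eq0; apply/eqP/setP => y; rewrite !inE.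
by case yA: (y \in A) => //=; rewrite (disjointFr disjointAB yA) andbF.
Qed.

End Rank.

(** * Vertices ordered by their keys *)

Section VertexRank.
Variables (R : realDomainType) (n : nat).
Implicit Types (w y : 'I_n) (f g : 'I_n -> key R).

(* The name of the vertex is appended to the number of edges to break ties. *)
Definition named_key f w : key R := ((f w).1, (f w).2 * n + w).

Lemma named_key_ltE f g y w : (named_key f y < named_key g w)%O =
  (f y < g w)%O || (f y == g w) && (y < w).
Proof.
rewrite !ltEprodlexi /= !ltEnat /=.
have -> : ((f y).2 * n + y < (g w).2 * n + w) =
    ((f y).2 < (g w).2) || ((f y).2 == (g w).2) && (y < w).
  by have := ltn_ord y; have := ltn_ord w; nia.
have -> : (f y == g w) = ((f y).1 == (g w).1) && ((f y).2 == (g w).2).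
  by case: (f y) => ? ?; case: (g w).
by case: (ltgtP (f y).1 (g w).1).
Qed.

Lemma named_key_inj f : injective (named_key f).
Proof.
move=> y w /(congr1 (fun x => x.2 %% n)) /=.
by rewrite !modnMDl !modn_small // => /val_inj.
Qed.

Lemma named_key_le f g w :
  (f w <= g w)%O -> (named_key f w <= named_key g w)%O.
Proof.
rewrite !leNgt; apply: contra.
by rewrite named_key_ltE ltnn andbF orbF.
Qed.

Definition vrank f w := rank (named_key f) setT w.

Lemma vrank_lt f w : vrank f w < n.
Proof. by rewrite -[n in _ < n]card_ord -cardsT rank_lt_card ?in_setT. Qed.

Lemma vrank_ltE f y w :
  (vrank f y < vrank f w) = (named_key f y < named_key f w)%O.
Proof. by rewrite rank_ltE ?in_setT. Qed.

Lemma vrank_inj f : injective (vrank f).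
Proof.
by move=> y w; apply: (rank_inj (@named_key_inj f)); rewrite in_setT.
Qed.

Lemma vrank_surj f r : r < n -> exists w, vrank f w = r.
Proof.
rewrite -{1}[n]card_ord -cardsT => /(rank_surj (@named_key_inj f))[w _ <-].
by exists w.
Qed.

(* The vertex z is a junk value, for ranks that are too large. *)
Definition at_rank f z r : 'I_n := odflt z [pick w | vrank f w == r].

Lemma at_rankK f z r : r < n -> vrank f (at_rank f z r) = r.
Proof.
move=> /(vrank_surj f)[y rank_y]; rewrite /at_rank.
by case: pickP => [w /eqP //|/(_ y)]; rewrite rank_y eqxx.
Qed.

Lemma vrank_mono f y w : (f y < f w)%O -> vrank f y < vrank f w.
Proof. by move=> lt_yw; rewrite vrank_ltE named_key_ltE lt_yw. Qed.

Lemma vrank_le_upper_bound f g w :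
  (forall y, (f y <= g y)%O) -> g w = f w -> vrank g w <= vrank f w.
Proof.
move=> le_fg eq_w; apply/subset_leq_card/subsetP => y; rewrite !inE /=.
by rewrite /named_key eq_w; apply/le_lt_trans/named_key_le.
Qed.

Definition agree_up_to k f g :=
  (forall y, (f y <= g y)%O) /\ (forall y, vrank f y <= k -> g y = f y).

Lemma vrank_agree k f g w :
  agree_up_to k f g -> vrank f w <= k -> vrank g w = vrank f w.
Proof.
move=> [le_fg eq_fg] le_wk; apply/eqP.
rewrite eqn_leq vrank_le_upper_bound ?eq_fg //=.
apply/subset_leq_card/subsetP => y; rewrite !inE /= => lt_yw.
rewrite /named_key !eq_fg //; apply: leq_trans le_wk.
by rewrite ltnW ?vrank_ltE.
Qed.

Lemma at_rank_agree k f g z r :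
  agree_up_to k f g -> r <= k -> r < n -> at_rank g z r = at_rank f z r.
Proof.
move=> agree_fg le_rk lt_rn; apply: (@vrank_inj g).
by rewrite [RHS](vrank_agree agree_fg) !at_rankK.
Qed.

End VertexRank.

(** * Shortest paths by repeated squaring *)

Section Squaring.
Variables (R : realDomainType) (n : nat) (G : wdigraph R n).
Implicit Types (u v w y : 'I_n) (f g : 'I_n -> key R).
Implicit Types (x z : key R) (E : 'I_n -> 'I_n -> key R).
Local Notation K := (min_key G).

Definition join x z : key R := truncate_hops n (key_add x z).

Lemma join_hops_le x z : (join x z).2 <= n.
Proof. exact: geq_minr. Qed.

Lemma join_no_path x z :
  (no_path_key R n <= x)%O -> (0 <= z.1)%E -> join x z = no_path_key R n.
Proof.
case: x z => a i [b j] /=; rewrite leEprodlexi /= leye_eq.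
move=> /andP[/eqP-> /implyP/(_ (leey _)) le_ni] b0.
rewrite /join /truncate_hops /= addye ?gt_eqF ?(lt_le_trans _ b0) ?ltNy0 //.
by rewrite (minn_idPr (leq_trans le_ni _)) ?leq_addr.
Qed.

Lemma min_key_le_join u v w x z :
  (K u v <= x)%O -> (K v w <= z)%O -> (K u w <= join x z)%O.
Proof.
move=> le_x le_z.
have x0 : (0 <= x.1)%E := le_trans (min_key_ge0 G u v) (key_le_fst le_x).
have z0 : (0 <= z.1)%E := le_trans (min_key_ge0 G v w) (key_le_fst le_z).
have [uv|/not_reachable uv] := boolP (reachable G u v); last first.
  by rewrite uv in le_x; rewrite join_no_path ?le_no_path_key ?hops_le.
have [vw|/not_reachable vw] := boolP (reachable G v w); last first.
  rewrite vw in le_z; rewrite /join key_addC -/(join z x).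
  by rewrite join_no_path ?le_no_path_key ?hops_le.
apply: le_truncate_hops; first exact: hops_le.
exact: le_trans (min_key_triangle uv vw) (key_add_le uv vw le_x le_z).
Qed.

Lemma join_between u v w : between G u v w -> join (K u v) (K v w) = K u w.
Proof. by case=> _ _ eq_uw; rewrite /join -eq_uw truncate_hops_id ?hops_le. Qed.

Lemma vrank_between u v w : between G u v w ->
  vrank (K u) v <= vrank (K u) w /\ vrank (K v) w <= vrank (K u) w.
Proof.
case=> uv vw eq_uw; split.
  have [-> //|neq_vw] := eqVneq v w; apply/ltnW/vrank_mono; rewrite eq_uw.
  have {1}-> : K u v = key_add (K u v) (0%E, 0).
    by case: (K u v) => a i; rewrite /key_add adde0 addn0.
  by apply: key_add_le_lt => //; apply: min_key_gt0.
apply/subset_leq_card/subsetP => y; rewrite !inE /= !named_key_ltE => lt_yw.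
have le_yw : (K v y <= K v w)%O by case/orP: lt_yw => [/ltW|/andP[/eqP->]].
have vy : reachable G v y.
  move: vw; rewrite !reachable_lty; exact: le_lt_trans (key_le_fst le_yw).
have le_uy := min_key_triangle uv vy.
case/orP: lt_yw => [lt_yw|/andP[/eqP eq_yw lt_yw]].
  by rewrite (le_lt_trans le_uy) // eq_uw key_add_le_lt.
by move: le_uy; rewrite eq_yw -eq_uw le_eqVlt lt_yw andbT orbC.
Qed.

Lemma hops_le_vrank u w : reachable G u w -> (K u w).2 <= vrank (K u) w.
Proof.
move hops_w : (K u w).2 => h; elim: h w hops_w => // h IHh w hops_w uw.
have [|v between_v hops_v] := @between_hops _ _ _ _ _ h uw.
  by rewrite hops_w.
have [uv _ _] := between_v.
apply: leq_ltn_trans (IHh v hops_v uv) _.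
rewrite ltn_neqAle (vrank_between between_v).1 andbT.
apply/eqP => /vrank_inj eq_vw.
by move: hops_v; rewrite eq_vw hops_w => /esym/n_Sn.
Qed.

(* [best_middle k f g v]: no vertex of rank at most k for f is better than v in
   the middle of a path whose halves have the keys given by f and g. *)
Definition best_middle k f g v := forall y,
  vrank f y <= k -> (join (f v) (g v) <= join (f y) (g y))%O.

Definition approximates k h E :=
  [/\ forall u w, (K u w <= E u w)%O, forall u w, (E u w).2 <= n
    & forall u w, vrank (K u) w <= k -> (K u w).2 <= h -> E u w = K u w].

Lemma approximates_agree k h E u :
  n <= h -> approximates k h E -> agree_up_to k (K u) (E u).
Proof.
move=> le_nh [le_KE _ eq_KE]; split=> // w le_wk; apply: eq_KE => //.
exact: leq_trans (hops_le G u w) le_nh.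
Qed.

Lemma approximates_double k h E E' : approximates k h E ->
  (forall u w, exists2 v, best_middle k (E u) (E^~ w) v &
                          E' u w = join (E u v) (E v w)) ->
  approximates k (h + h) E'.
Proof.
move=> [le_KE hops_E eq_KE] E'P.
have le_KE' u w : (K u w <= E' u w)%O.
  by have [v _ ->] := E'P u w; apply: min_key_le_join.
have hops_E' u w : (E' u w).2 <= n.
  by have [v _ ->] := E'P u w; apply: join_hops_le.
split=> // u w le_wk le_hops; apply/eqP; rewrite eq_le le_KE' andbT.
have [uw|/not_reachable ->] := boolP (reachable G u w); last first.
  exact: le_no_path_key.
have [v between_v hops_v] := between_hops uw (geq_minr h (K u w).2).
have [le_v le_w] := vrank_between between_v.
have hops_w : (K u w).2 = (K u v).2 + (K v w).2 by case: between_v => _ _ ->.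
have E_uv : E u v = K u v.
  by apply: eq_KE; [apply: leq_trans le_wk | rewrite hops_v geq_minl].
have E_vw : E v w = K v w.
  by apply: eq_KE; [apply: leq_trans le_wk | lia].
rewrite -(join_between between_v) -E_uv -E_vw.
have [y best_y ->] := E'P u w; apply: best_y.
by apply: leq_trans le_wk; apply: leq_trans le_v; apply: vrank_le_upper_bound.
Qed.

Definition edge_key v w : key R :=
  (if edge G v w then (wt G v w)%:E else +oo%E, 1).

Definition init_key u w : key R :=
  if u == w then (0%E, 0) else
  if edge G u w then edge_key u w else no_path_key R n.

Lemma min_key_le_edge_key v w : edge G v w -> (K v w <= edge_key v w)%O.
Proof. by move=> vw; rewrite /edge_key vw; apply: min_key_edge. Qed.

Lemma approximates_init k : approximates k 1 init_key.
Proof.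
split=> [u w|u w|u w _ hops_w]; rewrite /init_key.
- case: eqP => [<-|_]; first by rewrite min_key_refl.
  case: ifP => [|_]; first exact: min_key_le_edge_key.
  exact/le_no_path_key/hops_le.
- by case: ifP => // _; case: ifP => //= _; apply: leq_trans (ltn_ord u).
case: eqVneq => [<-|neq_uw]; first by rewrite min_key_refl.
have [uw|not_uw] := boolP (reachable G u w); last first.
  rewrite (not_reachable not_uw); case: ifP => // edge_uw; case/negP: not_uw.
  by apply: (walk_reachable (p := [:: w])); rewrite /walk /= edge_uw eqxx.
have [|edge_uw ->] := hops_eq1 uw.
  by apply/eqP; rewrite eqn_leq hops_w (hops_gt0 uw).
by rewrite /edge_key edge_uw.
Qed.

Definition predecessor u v w :=
  [/\ between G u v w, edge G v w & K v w = edge_key v w].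

Lemma predecessor_exists u w :
  reachable G u w -> u != w -> exists v, predecessor u v w.
Proof.
move=> uw /(hops_gt0 uw) hops_w.
have [v between_v hops_v] := between_hops uw (leq_pred _).
exists v; have [_ vw eq_uw] := between_v.
have [|edge_vw eq_vw] := hops_eq1 vw.
  by rewrite eq_uw /= in hops_v hops_w *; lia.
by split=> //; rewrite /edge_key edge_vw.
Qed.

(* The key of the walk through v is at most that of a best path, so that all the
   inequalities in between are equalities. *)
Lemma best_middle_predecessor k u v w f : agree_up_to k (K u) f ->
  best_middle k f (edge_key^~ w) v ->
  vrank (K u) w <= k -> reachable G u w -> u != w -> predecessor u v w.
Proof.
move=> [le_Kf eq_f] best_v le_wk uw neq_uw.
have le_join : (join (f v) (edge_key v w) <= K u w)%O.
  have [y [between_y edge_yw eq_yw]] := predecessor_exists uw neq_uw.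
  have le_yk := leq_trans (vrank_between between_y).1 le_wk.
  rewrite -(join_between between_y) eq_yw -eq_f //; apply: best_v.
  exact: leq_trans (vrank_le_upper_bound le_Kf (eq_f _ le_yk)) le_yk.
have {le_join} le_sum := truncate_hops_le (reachable_hops_lt uw) le_join.
have [fin_fv edge_vw] : (f v).1 \is a fin_num /\ edge G v w.
  move: (uw); rewrite reachable_lty => /(le_lt_trans (key_le_fst le_sum)).
  have := le_trans (min_key_ge0 G u v) (key_le_fst (le_Kf v)).
  rewrite /key_add /edge_key.
  by case: (f v) => -[a| |] i //=; case: (edge G v w).
have uv : reachable G u v.
  rewrite reachable_lty; apply: le_lt_trans (key_le_fst (le_Kf v)) _.
  by rewrite ltey_eq fin_fv.
have vw : reachable G v w.
  by apply: (walk_reachable (p := [:: w])); rewrite /walk /= edge_vw eqxx.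
have le_edge := min_key_le_edge_key edge_vw.
have triangle := min_key_triangle uv vw.
have [Kf Ke] :=
  key_add_squeeze uv vw (le_Kf v) le_edge (le_trans le_sum triangle).
split=> //; split=> //; apply/eqP.
by rewrite eq_le triangle Kf Ke.
Qed.

End Squaring.

(** * Nearest neighbours *)

Section NearestNeighbours.
Variables (R : realDomainType) (n : nat) (G : wdigraph R n).
Implicit Types (u v w y : 'I_n).
Local Notation K := (min_key G).

Lemma vrank_self u : vrank (K u) u = 0.
Proof.
apply/eqP; rewrite cards_eq0; apply/eqP/setP => y; rewrite !inE /=.
apply/negbTE; rewrite named_key_ltE min_key_refl negb_or -leNgt.
have [->|neq_yu] := eqVneq y u; first by rewrite min_key_refl lexx ltnn andbF.
have [uy|/not_reachable ->] := boolP (reachable G u y); last first.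
  by rewrite leEprodlexi xpair_eqE /= leey.
have := min_key_gt0 uy; rewrite eq_sym => /(_ neq_yu) gt0.
by rewrite (ltW gt0) gt_eqF.
Qed.

Definition neighbours k u :=
  [seq at_rank (K u) u r | r <- iota 1 (minn k n.-1)].

Lemma size_neighbours k u : size (neighbours k u) = minn k n.-1.
Proof. by rewrite size_map size_iota. Qed.

Lemma nth_neighbours k u x w :
  x < minn k n.-1 -> nth w (neighbours k u) x = at_rank (K u) u x.+1.
Proof. by move=> lt_x; rewrite (nth_map 0) ?size_iota ?nth_iota. Qed.

Lemma mem_neighboursP k u w :
  reflect (0 < vrank (K u) w <= k) (w \in neighbours k u).
Proof.
have lt_wn := vrank_lt (K u) w.
apply: (iffP mapP) => [[r + ->]|rank_w].
  by rewrite mem_iota => lt_r; rewrite at_rankK; lia.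
exists (vrank (K u) w); first by rewrite mem_iota; lia.
by apply: (@vrank_inj _ _ (K u)); rewrite at_rankK.
Qed.

Lemma nearest_neighbours k u : nearest G k u (neighbours k u).
Proof.
exists (neighbours n.-1 u); last first.
  by rewrite /neighbours minnn -map_take take_iota.
split.
  apply: uniq_perm.
  - rewrite map_inj_in_uniq ?iota_uniq // => r s.
    rewrite !mem_iota => lt_r lt_s /(congr1 (vrank (K u))).
    by rewrite !at_rankK; lia.
  - by rewrite filter_uniq ?enum_uniq.
  move=> w; rewrite mem_filter mem_enum andbT -(inj_eq (@vrank_inj _ _ (K u))).
  rewrite vrank_self -lt0n; apply/mem_neighboursP/idP => [/andP[]//|->].
  by have := vrank_lt (K u) w; lia.
apply/(sortedP u) => i; rewrite size_neighbours minnn => lt_i.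
rewrite !nth_neighbours ?minnn; [|lia..].
rewrite -!min_key_dist; set y := at_rank _ _ _; set w := at_rank _ _ _.
have : vrank (K u) y < vrank (K u) w by rewrite !at_rankK; lia.
by rewrite vrank_ltE => /ltW/key_le_fst.
Qed.

(** * Paths that follow predecessor pointers *)

Definition predecessor_table k u (pred : 'I_n -> 'I_n) := forall w,
  vrank (K u) w <= k -> reachable G u w -> u != w -> predecessor G u (pred w) w.

Section Traceback.
Variables (k : nat) (u : 'I_n) (pred : 'I_n -> 'I_n).
Hypothesis predP : predecessor_table k u pred.

Definition traceback w := rev (traject pred w (K u w).2).

Lemma size_traceback w : size (traceback w) = (K u w).2.
Proof. by rewrite size_rev size_traject. Qed.

Lemma tracebackP w : vrank (K u) w <= k -> reachable G u w ->
  [/\ walk G u w (traceback w), path_key G u (traceback w) = K u w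
    & iter (K u w).2 pred w = u].
Proof.
rewrite /traceback; move hops_w : (K u w).2 => h.
elim: h w hops_w => [|h IHh] w hops_w le_wk uw.
  have eq_uw := hops_eq0 uw hops_w.
  by rewrite -eq_uw min_key_refl /walk /= eqxx.
have neq_uw : u != w.
  by apply: contra_eqN hops_w => /eqP<-; rewrite min_key_refl.
have [between_v edge_vw eq_vw] := predP le_wk uw neq_uw.
have [uv _ eq_uw] := between_v.
have hops_v : (K u (pred w)).2 = h.
  by move: hops_w; rewrite eq_uw eq_vw /= addn1 => -[].
have le_vk := leq_trans (vrank_between between_v).1 le_wk.
have [walk_v key_v iter_v] := IHh _ hops_v le_vk uv.
rewrite iterSr trajectS rev_cons; split=> //.
  rewrite -cats1; apply: walk_cat walk_v _.
  by rewrite /walk /= edge_vw eqxx.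
have /andP[_ /eqP last_v] := walk_v.
rewrite -cats1 (path_key_cat _ _ last_v) key_v eq_uw eq_vw /edge_key edge_vw.
by rewrite /path_key /= addr0.
Qed.

Lemma shortest_traceback w : vrank (K u) w <= k -> reachable G u w ->
  shortest_path G u w (traceback w).
Proof.
move=> le_wk uw; have [walk_w key_w _] := tracebackP le_wk uw; split.
  exact: walk_min_key_simple walk_w key_w.
by rewrite -min_key_dist -key_w.
Qed.

Lemma nth_traceback w s : vrank (K u) w <= k -> reachable G u w ->
  s <= (K u w).2 ->
  nth u (u :: traceback w) s = iter ((K u w).2 - s) pred w.
Proof.
move=> le_wk uw le_s; have [_ _ iter_w] := tracebackP le_wk uw.
have -> : u :: traceback w = rev (traject pred w (K u w).2.+1).
  by rewrite trajectSr rev_rcons iter_w.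
rewrite nth_rev size_traject // subSS.
by rewrite (set_nth_default w) ?nth_traject ?size_traject // ltnS leq_subr.
Qed.

End Traceback.
End NearestNeighbours.

(** * A language for synchronous programs *)

Inductive nexp :=
  | EReg of nat
  | ECst of nat
  | EOp of nop & nexp & nexp
  | ELoad of nexp
  | ELt of nexp & nexp
  | EWLe of nat & nat
  | EIf of nexp & nexp & nexp.

Inductive wexp :=
  | XZero
  | XInf
  | XLoad of nexp
  | XAdd of nat & nat
  | XIf of nexp & nat & nat.

(* All processors execute the same command at the same time.  The memory is cut
   into regions, and a store goes to the cell o of the region q if the value of
   c is positive.  The register r of a loop starts with the value of e and is
   halved, or decremented if the flag is false, after each iteration, until it
   is zero. *)
Inductive cmd :=
  | Skip
  | Seq of cmd & cmd
  | SetN (r : nat) (e : nexp)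
  | SetW (r : nat) (x : wexp)
  | PutN (c : nexp) (q : nat) (o v : nexp)
  | PutW (c : nexp) (q : nat) (o : nexp) (r : nat)
  | Loop (halve : bool) (r : nat) (e : nexp) (s : cmd).

Declare Scope nexp_scope.
Delimit Scope nexp_scope with nexp.
Bind Scope nexp_scope with nexp.
Notation "a + b" := (EOp Add a b) : nexp_scope.
Notation "a - b" := (EOp Defs.Sub a b) : nexp_scope.
Notation "a * b" := (EOp Mul a b) : nexp_scope.
Notation "a / b" := (EOp Div a b) : nexp_scope.
Notation "a < b" := (ELt a b) : nexp_scope.
Notation "# c" := (ECst c) (at level 5, format "# c") : nexp_scope.
Notation "$ r" := (EReg r) (at level 5, format "$ r") : nexp_scope.
Notation "s1 ;; s2" := (Seq s1 s2) (at level 81, right associativity).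

Notation r_n := 1 (only parsing).
Notation r_region := 7 (only parsing).
Notation r_zero := 99 (only parsing).
Notation r_tmp := 100 (only parsing).

Definition emin a b : nexp := (b - (b - a))%nexp.
Definition address q o : nexp := (#q * $r_region + o)%nexp.
Definition clamp v : nexp := emin v ($r_n)%nexp.
Arguments address : simpl never.
Arguments clamp : simpl never.

Definition shrink (halve : bool) r : nexp :=
  (if halve then $r / #2 else $r - #1)%nexp.

(* Both branches of a conditional take the same time, which keeps the processors
   synchronous.  The registers from r_tmp on hold intermediate values, and the
   commands only use the registers below r_zero. *)
Fixpoint compile_nexp (e : nexp) (t : nat) : program :=
  match e with
  | EReg r => [:: NOp Add t r r_zero]
  | ECst c => [:: NConst t c]
  | EOp o a b => compile_nexp a t ++ compile_nexp b t.+1 ++ [:: NOp o t t t.+1]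
  | ELoad a => compile_nexp a t ++ [:: NLoad t t]
  | ELt a b => compile_nexp a t ++ compile_nexp b t.+1 ++
      [:: If (NLt t t.+1) [:: NConst t 1] [:: NConst t 0]]
  | EWLe r s => [:: If (WLe r s) [:: NConst t 1] [:: NConst t 0]]
  | EIf c a b =>
      compile_nexp c t ++ compile_nexp a t.+1 ++ compile_nexp b t.+2 ++
      [:: If (NLt r_zero t) [:: NOp Add t t.+1 r_zero]
                              [:: NOp Add t t.+2 r_zero]]
  end.

Fixpoint nexp_time (e : nexp) : nat :=
  match e with
  | EReg _ | ECst _ => 1
  | EOp _ a b => nexp_time a + (nexp_time b + 1)
  | ELoad a => nexp_time a + 1
  | ELt a b => nexp_time a + (nexp_time b + 2)
  | EWLe _ _ => 2
  | EIf c a b => nexp_time c + (nexp_time a + (nexp_time b + 2))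
  end.

Definition assign r e : program :=
  compile_nexp e r_tmp ++ [:: NOp Add r r_tmp r_zero].

Definition compile_wexp r (x : wexp) : program :=
  match x with
  | XZero => [:: WZero r]
  | XInf => [:: WInf r]
  | XLoad a => compile_nexp a r_tmp ++ [:: WLoad r r_tmp]
  | XAdd s t => [:: WAdd r s t]
  | XIf c s t => compile_nexp c r_tmp ++
      [:: If (NLt r_zero r_tmp) [:: WAdd r s r_zero] [:: WAdd r t r_zero]]
  end.

Definition wexp_time (x : wexp) : nat :=
  match x with
  | XZero | XInf | XAdd _ _ => 1
  | XLoad a => nexp_time a + 1
  | XIf c _ _ => nexp_time c + 2
  end.

Definition guarded_store c a t (i : stmt) : program :=
  compile_nexp c t ++ compile_nexp a t.+1 ++
  [:: If (NLt r_zero t) [:: i] [:: NConst t 0]].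

Fixpoint compile (s : cmd) : program :=
  match s with
  | Skip => [::]
  | Seq a b => compile a ++ compile b
  | SetN r e => assign r e
  | SetW r x => compile_wexp r x
  | PutN c q o v => compile_nexp (clamp v) r_tmp ++
      guarded_store c (address q o) r_tmp.+1 (NStore r_tmp.+2 r_tmp)
  | PutW c q o r =>
      guarded_store c (address q o) r_tmp (WStore r_tmp.+1 r)
  | Loop halve r e b => assign r e ++
      [:: While (NLt r_zero r) (compile b ++ assign r (shrink halve r))]
  end.

Fixpoint cmd_time (s : cmd) : nat :=
  match s with
  | Skip => 0
  | Seq a b => cmd_time a + cmd_time b
  | SetN r e => nexp_time e + 1
  | SetW r x => wexp_time x
  | PutN c q o v =>
      nexp_time (clamp v) + (nexp_time c + (nexp_time (address q o) + 2))
  | PutW c q o r => nexp_time c + (nexp_time (address q o) + 2)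
  | Loop halve r e b => (nexp_time e + 2) + (cmd_time b + 5)
  end.

Fixpoint loop_depth (s : cmd) : nat :=
  match s with
  | Seq a b => maxn (loop_depth a) (loop_depth b)
  | Loop _ _ _ b => (loop_depth b).+1
  | _ => 0
  end.

(* The value of an expression is at most n + 2 to the power given by its degree.
   Values that are loaded are at most n, because of the clamp before stores. *)
Definition reg_degree r :=
  if r == 0 then 3 else if r <= 4 then 1 else if r < 30 then 12 else
  if r < 40 then 40 else 60.

Fixpoint degree (e : nexp) : nat :=
  match e with
  | EReg r => reg_degree r
  | ECst c => c
  | EOp Add a b => (maxn (degree a) (degree b)).+1
  | EOp Mul a b => degree a + degree b
  | EOp _ a b => degree a
  | ELoad a => 1
  | ELt _ _ | EWLe _ _ => 0
  | EIf _ a b => maxn (degree a) (degree b)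
  end.

Definition max_degree := 100.

Fixpoint nexp_ok (e : nexp) : bool :=
  (degree e <= max_degree) &&
  match e with
  | EReg r => r < r_zero
  | ECst c => true
  | EOp _ a b | ELt a b => nexp_ok a && nexp_ok b
  | ELoad a => nexp_ok a
  | EWLe r s => (r < r_zero) && (s < r_zero)
  | EIf c a b => [&& nexp_ok c, nexp_ok a & nexp_ok b]
  end.

Definition wexp_ok (x : wexp) : bool :=
  match x with
  | XZero | XInf => true
  | XLoad a => nexp_ok a
  | XAdd s t => (s < r_zero) && (t < r_zero)
  | XIf c s t => [&& nexp_ok c, s < r_zero & t < r_zero]
  end.

Fixpoint cmd_ok (s : cmd) : bool :=
  match s with
  | Skip => true
  | Seq a b => cmd_ok a && cmd_ok b
  | SetN r e => [&& r < r_zero, nexp_ok e & degree e <= reg_degree r]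
  | SetW r x => (r < r_zero) && wexp_ok x
  | PutN c q o v => [&& nexp_ok (clamp v), nexp_ok c & nexp_ok (address q o)]
  | PutW c q o r => [&& nexp_ok c, nexp_ok (address q o) & r < r_zero]
  | Loop halve r e b =>
      [&& r < r_zero, nexp_ok e, degree e <= reg_degree r,
          nexp_ok (shrink halve r) & cmd_ok b]
  end.

Section Evaluation.
Variable R : realDomainType.
Implicit Types (N : nat -> nat) (W : nat -> \bar R) (m : memory R).

Fixpoint neval N W m (e : nexp) : nat :=
  match e with
  | EReg r => N r
  | ECst c => c
  | EOp o a b => nop_eval o (neval N W m a) (neval N W m b)
  | ELoad a => nmem m (neval N W m a)
  | ELt a b => neval N W m a < neval N W m b
  | EWLe r s => (W r <= W s)%E
  | EIf c a b => if 0 < neval N W m c then neval N W m a else neval N W m b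
  end.

Definition weval N W m (x : wexp) : \bar R :=
  match x with
  | XZero => 0%E
  | XInf => +oo%E
  | XLoad a => wmem m (neval N W m a)
  | XAdd s t => (W s + W t)%E
  | XIf c s t => if 0 < neval N W m c then W s else W t
  end.

Lemma eq_neval N N' W W' m e :
  {in gtn r_zero, N =1 N'} -> {in gtn r_zero, W =1 W'} -> nexp_ok e ->
  neval N W m e = neval N' W' m e.
Proof.
move=> eqN eqW; elim: e => //=.
- by move=> r /andP[_ /eqN].
- by move=> o a IHa b IHb /andP[_ /andP[/IHa-> /IHb->]].
- by move=> a IHa /IHa->.
- by move=> a IHa b IHb /andP[/IHa-> /IHb->].
- by move=> r s /andP[/eqW-> /eqW->].
- by move=> c IHc a IHa b IHb /andP[_ /and3P[/IHc-> /IHa-> /IHb->]].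
Qed.

Lemma neval_degree b N W m e :
  1 < b -> {in gtn r_zero, forall r, N r <= b ^ reg_degree r} ->
  (forall a, nmem m a <= b) -> nexp_ok e -> neval N W m e <= b ^ degree e.
Proof.
move=> b_gt1 le_N le_m; have b_gt0 := ltnW b_gt1.
have le_pow i j x : i <= j -> x <= b ^ i -> x <= b ^ j.
  by move=> le_ij le_x; apply: leq_trans le_x _; rewrite leq_pexp2l.
elim: e => //=.
- by move=> r /andP[_ /le_N].
- by move=> c _; apply/ltnW/ltn_expl.
- move=> [] x IHx y IHy /andP[_ /andP[/IHx le_x /IHy le_y]] /=.
  + rewrite expnS; apply: (@leq_trans (2 * b ^ maxn (degree x) (degree y))).
      rewrite mul2n -addnn.
      by apply: leq_add; [apply: le_pow le_x | apply: le_pow le_y];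
        rewrite (leq_maxl, leq_maxr).
    by rewrite leq_mul2r b_gt1 orbT.
  + exact: leq_trans (leq_subr _ _) le_x.
  + by rewrite expnD leq_mul.
  + exact: leq_trans (leq_div _ _) le_x.
- by move=> x _ y _ _; apply: leq_b1.
- by move=> r s _; apply: leq_b1.
- move=> c _ x IHx y IHy /andP[_ /and3P[_ /IHx le_x /IHy le_y]].
  by case: ifP => _; [apply: le_pow le_x | apply: le_pow le_y];
    rewrite (leq_maxl, leq_maxr).
Qed.

End Evaluation.

Lemma upd_eq (V : Type) (f : nat -> V) a v : upd f a v a = v.
Proof. by rewrite /upd eqxx. Qed.

Lemma upd_neq (V : Type) (f : nat -> V) a v x : x != a -> upd f a v x = f x.
Proof. by rewrite /upd => /negPf->. Qed.

Lemma upd_bounded B (f : nat -> nat) a v :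
  (forall x, f x <= B) -> v <= B -> forall x, upd f a v x <= B.
Proof. by move=> le_f le_v x; rewrite /upd; case: ifP. Qed.

(** * Rounds without stores *)

Section LocalRun.
Variables (R : realDomainType) (n B : nat).
Hypothesis le_B : (n + 2) ^ max_degree <= B.
Implicit Types (N : nat -> nat) (W : nat -> \bar R) (m : memory R).
Implicit Types (l : local R) (P : local R -> Prop).

Fixpoint local_run m T P l : Prop :=
  if T is T'.+1 then
    [/\ nwrite l = None, wwrite l = None, forall r, nreg l r <= B
      & local_run m T' P (local_step m l)]
  else P l.

Definition typed_env N W :=
  [/\ {in gtn r_zero, forall r, N r <= (n + 2) ^ reg_degree r},
      N r_zero = 0 & W r_zero = 0%E].

Definition typed_regs N W := typed_env N W /\ forall r, N r <= B.

Definition typed_mem m := forall a, nmem m a <= n + 2.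

Lemma le_bool_B (x : bool) : x <= B.
Proof.
by apply: leq_trans (leq_b1 x) (leq_trans _ le_B); rewrite expn_gt0 addn2.
Qed.

Lemma neval_bounded N W m e :
  typed_regs N W -> typed_mem m -> nexp_ok e -> neval N W m e <= B.
Proof.
move=> [[le_N _ _] _] le_m e_ok; apply: leq_trans le_B.
apply: (leq_trans (neval_degree _ _ le_N le_m e_ok)); first by rewrite addn2.
apply: leq_pexp2l; first by rewrite addn2.
by case: e e_ok => > /andP[].
Qed.

Lemma typed_regs_above t N N' W : r_zero < t -> typed_regs N W ->
  {in gtn t, N' =1 N} -> (forall r, N' r <= B) -> typed_regs N' W.
Proof.
move=> lt_t [[le_N N0 W0] _] eqN bounded_N'; split=> //.
split=> //; last by rewrite eqN.
by move=> r lt_r; rewrite eqN ?le_N // inE (ltn_trans _ lt_t).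
Qed.

Lemma neval_above t N N' W m e : r_zero < t -> {in gtn t, N' =1 N} ->
  nexp_ok e -> neval N' W m e = neval N W m e.
Proof.
move=> lt_t eqN; apply: eq_neval => // r lt_r.
by rewrite eqN // inE (ltn_trans _ lt_t).
Qed.

Lemma typed_regs_upd t N W v : r_zero < t -> v <= B -> typed_regs N W ->
  typed_regs (upd N t v) W.
Proof.
move=> lt_t le_v typed_N; apply: (typed_regs_above lt_t typed_N) => [r|].
  by rewrite inE => lt_r; rewrite upd_neq ?ltn_eqF.
by case: typed_N => _ bounded_N; apply: upd_bounded.
Qed.

Lemma local_run_step m T P i K N W : typed_regs N W ->
  nwrite (Local (i :: K) N W) = None -> wwrite (Local (i :: K) N W) = None ->
  local_run m T P (local_step m (Local (i :: K) N W)) ->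
  local_run m T.+1 P (Local (i :: K) N W).
Proof. by case. Qed.

(* The continuation of a computation of v in the register t. *)
Definition continue m T P K N W t v := forall N',
  N' t = v -> {in gtn t, N' =1 N} -> typed_regs N' W ->
  local_run m T P (Local K N' W).

Lemma continue_upd m T P K N W t v N1 : r_zero < t -> typed_regs N1 W ->
  {in gtn t, N1 =1 N} -> v <= B -> continue m T P K N W t v ->
  local_run m T P (Local K (upd N1 t v) W).
Proof.
move=> lt_t typed_N1 eq_N1 le_v k; apply: k; first exact: upd_eq.
  by move=> r lt_r; rewrite upd_neq ?eq_N1 // ltn_eqF.
exact: typed_regs_upd.
Qed.

Lemma local_run_bool m T P K N W t (c : test) (x : bool) N1 :
  r_zero < t -> typed_regs N1 W -> {in gtn t, N1 =1 N} ->
  (forall K', test_eval (Local K' N1 W) c = x) ->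
  continue m T P K N W t x ->
  local_run m (2 + T) P
    (Local (If c [:: NConst t 1] [:: NConst t 0] :: K) N1 W).
Proof.
move=> lt_t typed_N1 eq_N1 eval_c k; apply: local_run_step => //.
rewrite /local_step /= eval_c.
by case: x {eval_c} k => k /=; apply: local_run_step => //;
  apply: continue_upd k; rewrite // (le_bool_B true, le_bool_B false).
Qed.

Definition computes m e := forall t K N W T P,
  r_zero < t -> nexp_ok e -> typed_regs N W ->
  continue m T P K N W t (neval N W m e) ->
  local_run m (nexp_time e + T) P (Local (compile_nexp e t ++ K) N W).

Lemma computes_pair m a b t K N W T P : computes m a -> computes m b ->
  r_zero < t -> nexp_ok a -> nexp_ok b -> typed_regs N W ->
  (forall N', N' t = neval N W m a -> N' t.+1 = neval N W m b ->
     {in gtn t, N' =1 N} -> typed_regs N' W ->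
     local_run m T P (Local K N' W)) ->
  local_run m (nexp_time a + (nexp_time b + T)) P
    (Local (compile_nexp a t ++ compile_nexp b t.+1 ++ K) N W).
Proof.
move=> comp_a comp_b lt_t a_ok b_ok typed_N k.
apply: comp_a => // N1 N1_t eq1 typed1.
apply: comp_b => // [|N2 N2_t eq2 typed2]; first exact: ltnW.
apply: k => //; first by rewrite eq2 ?inE.
  by rewrite N2_t (neval_above _ _ lt_t eq1).
by move=> r lt_r; rewrite eq2 ?eq1 // inE ltnW.
Qed.

Lemma nexp_computes m e : typed_mem m -> computes m e.
Proof.
move=> mem_m.
elim: e => [r|c|o a IHa b IHb|a IHa|a IHa b IHb|r s|c IHc a IHa b IHb];
  move=> t K N W T P lt_t e_ok typed_N k;
  have le_v := neval_bounded typed_N mem_m e_ok; rewrite /= -?addnA -?catA.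
- apply: local_run_step => //; rewrite /local_step /=.
  by case: (typed_N) => -[_ -> _] _; rewrite addn0; apply: continue_upd k.
- by apply: local_run_step => //; apply: continue_upd k.
- have /andP[_ /andP[a_ok b_ok]] := e_ok.
  apply: computes_pair => // N' N'_t N'_tS eqN typed_N'.
  apply: local_run_step => //; rewrite /local_step /= N'_t N'_tS.
  exact: continue_upd k.
- have /andP[_ a_ok] := e_ok.
  apply: IHa => // N' N'_t eqN typed_N'.
  apply: local_run_step => //; rewrite /local_step /= N'_t.
  exact: continue_upd k.
- have /andP[_ /andP[a_ok b_ok]] := e_ok.
  apply: computes_pair => // N' N'_t N'_tS eqN typed_N'.
  by apply: local_run_bool k => // K'; rewrite /= N'_t N'_tS.
- exact: local_run_bool k.
have /andP[_ /and3P[c_ok a_ok b_ok]] := e_ok.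
apply: computes_pair => // N1 N1_t N1_tS eq1 typed1.
apply: IHb => // [|N2 N2_t eq2 typed2]; first exact/ltnW/ltnW.
have [eqt eqtS] : N2 t = N1 t /\ N2 t.+1 = N1 t.+1 by rewrite !eq2 ?inE.
have [[_ N2_0 _] _] := typed2.
apply: local_run_step => //; rewrite /local_step /= N2_0 eqt N1_t.
rewrite /= in k le_v; rewrite (neval_above _ _ lt_t eq1 b_ok) in N2_t.
have eqN : {in gtn t, N2 =1 N}.
  by move=> r lt_r; rewrite eq2 ?eq1 // inE; do 2!apply: ltnW.
case: ifP k le_v => _ k le_v; apply: local_run_step => //;
  rewrite /local_step /= N2_0 addn0 ?eqtS ?N1_tS ?N2_t; exact: continue_upd k.
Qed.

Definition tracks K N W l :=
  [/\ ctl l = K, {in gtn r_tmp, nreg l =1 N}, {in gtn r_tmp, wreg l =1 W}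
    & forall r, nreg l r <= B].

Lemma tracks_typed K N W l :
  typed_env N W -> tracks K N W l -> typed_regs (nreg l) (wreg l).
Proof.
move=> [le_N N0 W0] [_ eqN eqW bounded_l]; split=> //.
split=> [r lt_r||]; rewrite ?eqN ?eqW ?le_N //.
exact: ltn_trans lt_r _.
Qed.

Lemma tracks_local K N W l :
  tracks K N W l -> l = Local K (nreg l) (wreg l).
Proof. by case: l => K' N' W' [/= <-]. Qed.

Lemma tracks_neval K N W l m e :
  tracks K N W l -> nexp_ok e -> neval (nreg l) (wreg l) m e = neval N W m e.
Proof.
by move=> [_ eqN eqW _]; apply: eq_neval => r lt_r; rewrite ?eqN ?eqW //;
  apply: ltn_trans lt_r _.
Qed.

Lemma tracks_nexp m e t K N W l T P :
  r_zero < t -> nexp_ok e -> typed_env N W -> typed_mem m ->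
  tracks (compile_nexp e t ++ K) N W l ->
  (forall l', tracks K N W l' -> nreg l' t = neval N W m e ->
     {in gtn t, nreg l' =1 nreg l} -> local_run m T P l') ->
  local_run m (nexp_time e + T) P l.
Proof.
move=> lt_t e_ok typed_NW mem_m tracks_l k.
have typed_l := tracks_typed typed_NW tracks_l.
rewrite (tracks_local tracks_l).
apply: nexp_computes => // N' N'_t eqN' [_ bounded_N'].
apply: k => //=; last by rewrite N'_t (tracks_neval _ tracks_l).
have [_ eqN eqW _] := tracks_l; split=> // r lt_r /=.
by rewrite eqN' ?eqN // inE (leq_trans lt_r).
Qed.

Lemma tracks_step m T P i K N W l : tracks (i :: K) N W l ->
  nwrite l = None -> wwrite l = None -> local_run m T P (local_step m l) ->
  local_run m T.+1 P l.
Proof. by case. Qed.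

Lemma tracks_assign m r e K N W l :
  r < r_zero -> nexp_ok e -> typed_env N W -> typed_mem m ->
  tracks (assign r e ++ K) N W l ->
  local_run m (nexp_time e + 1) (tracks K (upd N r (neval N W m e)) W) l.
Proof.
move=> lt_r e_ok typed_NW mem_m; rewrite -catA => tracks_l.
apply: tracks_nexp tracks_l _ => // l' tracks_l' l'_t _.
have [[_ l'_0 _] _] := tracks_typed typed_NW tracks_l'.
have [ctl_l' eqN eqW bounded_l'] := tracks_l'.
apply: (tracks_step tracks_l'); rewrite /nwrite /wwrite ?ctl_l' //.
rewrite /local_step ctl_l' /= l'_t l'_0 addn0 -l'_t; split=> //=.
  by move=> x lt_x; rewrite /upd; case: ifP => // _; apply: eqN.
exact: upd_bounded.
Qed.

Lemma tracks_if m t x y K N W l T P : typed_env N W ->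
  tracks (If (NLt r_zero t) [:: x] [:: y] :: K) N W l ->
  (forall l', tracks ((if 0 < nreg l t then x else y) :: K) N W l' ->
     nreg l' =1 nreg l -> local_run m T P l') ->
  local_run m T.+1 P l.
Proof.
move=> typed_NW tracks_l k; have [ctl_l eqN eqW bounded_l] := tracks_l.
have [[_ l_0 _] _] := tracks_typed typed_NW tracks_l.
apply: (tracks_step tracks_l); rewrite /nwrite /wwrite ?ctl_l //.
by apply: k; rewrite /local_step ctl_l //= l_0; split=> //=; case: ifP.
Qed.

Lemma tracks_setw m i K N W l r (f : \bar R) :
  tracks (i :: K) N W l -> nwrite l = None -> wwrite l = None ->
  local_step m l = Local K (nreg l) (upd (wreg l) r f) ->
  local_run m 1 (tracks K N (upd W r f)) l.
Proof.
move=> tracks_l no_n no_w step_l; apply: (tracks_step tracks_l) => //=.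
have [_ eqN eqW bounded_l] := tracks_l; rewrite step_l; split=> //= x lt_x.
by rewrite /upd; case: ifP => // _; apply: eqW.
Qed.

Lemma tracks_wexp m r x K N W l :
  wexp_ok x -> typed_env N W -> typed_mem m ->
  tracks (compile_wexp r x ++ K) N W l ->
  local_run m (wexp_time x) (tracks K N (upd W r (weval N W m x))) l.
Proof.
move=> x_ok typed_NW mem_m; case: x x_ok => [||a|s t|c s t] /= => [_|_|a_ok||].
- move=> tracks_l; have [ctl_l _ _ _] := tracks_l.
  by apply: (tracks_setw tracks_l); rewrite /nwrite /wwrite /local_step ctl_l.
- move=> tracks_l; have [ctl_l _ _ _] := tracks_l.
  by apply: (tracks_setw tracks_l); rewrite /nwrite /wwrite /local_step ctl_l.
- rewrite -catA => tracks_l.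
  apply: tracks_nexp tracks_l _ => // l' tracks_l' l'_t _.
  have [ctl_l' _ _ _] := tracks_l'; apply: (tracks_setw tracks_l');
    by rewrite /nwrite /wwrite /local_step ctl_l' //= l'_t.
- move=> /andP[lt_s lt_t] tracks_l; have [ctl_l _ eqW _] := tracks_l.
  apply: (tracks_setw tracks_l); rewrite /nwrite /wwrite /local_step ctl_l //=.
  by rewrite !eqW // inE ltnW.
move=> /and3P[c_ok lt_s lt_t]; rewrite -catA => tracks_l.
apply: tracks_nexp tracks_l _ => // l1 tracks_l1 l1_t _.
apply: tracks_if tracks_l1 _ => // l2 tracks_l2 _.
have [[_ _ l2_0] _] := tracks_typed typed_NW tracks_l2.
have [ctl_l2 _ eqW _] := tracks_l2; rewrite l1_t in ctl_l2.
apply: (tracks_setw tracks_l2); rewrite /nwrite /wwrite /local_step ctl_l2;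
  by case: ifP => //= _; rewrite l2_0 adde0 eqW // inE ltnW.
Qed.

Lemma tracks_guarded_store m c a t i K N W l T P :
  r_zero < t -> nexp_ok c -> nexp_ok a -> typed_env N W -> typed_mem m ->
  tracks (guarded_store c a t i ++ K) N W l ->
  (forall l',
     tracks ((if 0 < neval N W m c then i else NConst t 0) :: K) N W l' ->
     nreg l' t.+1 = neval N W m a -> {in gtn t, nreg l' =1 nreg l} ->
     local_run m T P l') ->
  local_run m (nexp_time c + (nexp_time a + T.+1)) P l.
Proof.
move=> lt_t c_ok a_ok typed_NW mem_m; rewrite /guarded_store -!catA.
move=> tracks_l k; apply: tracks_nexp tracks_l _ => // l1 tracks_l1 l1_t eq1.
apply: tracks_nexp tracks_l1 _ => // [|l2 tracks_l2 l2_t eq2].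
  exact: ltnW.
apply: tracks_if tracks_l2 _ => // l3 + eq3.
rewrite eq2 ?inE // l1_t => tracks_l3; apply: k => //; first by rewrite eq3.
by move=> x lt_x; rewrite eq3 eq2 ?eq1 // inE ltnW.
Qed.

Lemma tracks_putw m c a r K N W l :
  nexp_ok c -> nexp_ok a -> typed_env N W -> typed_mem m ->
  tracks (guarded_store c a r_tmp (WStore r_tmp.+1 r) ++ K) N W l ->
  local_run m (nexp_time c + (nexp_time a + 1)) (fun l' =>
    tracks ((if 0 < neval N W m c then WStore r_tmp.+1 r
             else NConst r_tmp 0) :: K) N W l' /\
    nreg l' r_tmp.+1 = neval N W m a) l.
Proof.
move=> c_ok a_ok typed_NW mem_m tracks_l.
by apply: tracks_guarded_store tracks_l _ => // l'.
Qed.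

Lemma tracks_putn m c a v K N W l :
  nexp_ok v -> nexp_ok c -> nexp_ok a -> typed_env N W -> typed_mem m ->
  tracks ((compile_nexp v r_tmp ++
           guarded_store c a r_tmp.+1 (NStore r_tmp.+2 r_tmp)) ++ K) N W l ->
  local_run m (nexp_time v + (nexp_time c + (nexp_time a + 1))) (fun l' =>
    [/\ tracks ((if 0 < neval N W m c then NStore r_tmp.+2 r_tmp
                 else NConst r_tmp.+1 0) :: K) N W l',
        nreg l' r_tmp.+2 = neval N W m a & nreg l' r_tmp = neval N W m v]) l.
Proof.
move=> v_ok c_ok a_ok typed_NW mem_m; rewrite -catA => tracks_l.
apply: tracks_nexp tracks_l _ => // l1 tracks_l1 l1_v _.
apply: tracks_guarded_store tracks_l1 _ => // l' tracks_l' l'_a eq_l'.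
by split=> //; rewrite eq_l' ?inE.
Qed.

End LocalRun.

(** * Weakest preconditions *)

Inductive location :=
  | NRegister of nat
  | WRegister of nat
  | NRegion of nat
  | WRegion of nat.

Fixpoint modifies (s : cmd) (x : location) : bool :=
  match s, x with
  | Seq a b, _ => modifies a x || modifies b x
  | SetN r _, NRegister r' => r == r'
  | SetW r _, WRegister r' => r == r'
  | PutN _ q _ _, NRegion q' => q == q'
  | PutW _ q _ _, WRegion q' => q == q'
  | Loop _ r _ b, NRegister r' => (r == r') || modifies b x
  | Loop _ _ _ b, _ => modifies b x
  | _, _ => false
  end.

Section Commit.
Variables (p : nat) (V : Type) (w : 'I_p -> option (nat * V)).

Lemma commit_hit f i a v :
  exclusive w -> w i = Some (a, v) -> commit w f a = v.
Proof.
move=> ex_w w_i; rewrite /commit; case: pickP => [j /eqP|/(_ i)]; last first.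
  by rewrite w_i eqxx.
case w_j: (w j) => [[a' v']|] //= [eq_a]; rewrite eq_a in w_j.
have eq_ij := ex_w _ _ _ _ _ w_i w_j.
by move: w_j; rewrite -eq_ij w_i => -[].
Qed.

Lemma commit_miss f a : (forall i v, w i <> Some (a, v)) -> commit w f a = f a.
Proof.
move=> miss; rewrite /commit; case: pickP => [j /eqP|//].
by case w_j: (w j) => [[a' v]|] //= [eq_a]; case: (miss j v); rewrite -eq_a.
Qed.

Lemma commit_none f : (forall i, w i = None) -> commit w f = f.
Proof.
move=> none; apply: functional_extensionality => a.
by apply: commit_miss => i v; rewrite none.
Qed.

End Commit.

(* Z is the size of a region, and L bounds the iterations of a loop. *)
Section WeakestPreconditions.
Variables (R : realDomainType) (p Z L : nat).

Record state := State {
  regn : 'I_p -> nat -> nat;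
  regw : 'I_p -> nat -> \bar R;
  ram : memory R
}.
Implicit Types (S : state) (Q : state -> Prop).

Definition evaln S i e := neval (regn S i) (regw S i) (ram S) e.

Definition evalw S i x := weval (regn S i) (regw S i) (ram S) x.

Definition setn S r (f : 'I_p -> nat) :=
  State (fun i => upd (regn S i) r (f i)) (regw S) (ram S).

Definition setw S r (f : 'I_p -> \bar R) :=
  State (regn S) (fun i => upd (regw S i) r (f i)) (ram S).

Definition store S (wn : 'I_p -> option (nat * nat))
    (ww : 'I_p -> option (nat * \bar R)) :=
  State (regn S) (regw S)
    (Memory (commit wn (nmem (ram S))) (commit ww (wmem (ram S)))).

Definition write (V : Type) S c q o (v : 'I_p -> V) (i : 'I_p) :=
  if 0 < evaln S i c then Some (evaln S i (address q o), v i) else None.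

Definition putn S c q o v :=
  store S (write S c q o (fun i => evaln S i (clamp v))) (fun=> None).

Definition putw S c q o r :=
  store S (fun=> None) (write S c q o (fun i => regw S i r)).

Definition put_ok (V : Type) S c q o (v : 'I_p -> V) :=
  exclusive (write S c q o v) /\
  forall i, 0 < evaln S i c -> regn S i r_region = Z /\ evaln S i o < Z.

Definition wp_iterate (body : (state -> Prop) -> state -> Prop) halve r Q :=
  fix loop T S := if T is T'.+1 then
      (forall i, 0 < regn S i r) /\
      body (fun S' =>
        loop T' (setn S' r (fun i => evaln S' i (shrink halve r)))) S
    else (forall i, regn S i r = 0) /\ Q S.

Fixpoint wp (s : cmd) Q S : Prop :=
  match s with
  | Skip => Q S
  | Seq a b => wp a (wp b Q) S
  | SetN r e => Q (setn S r (fun i => evaln S i e))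
  | SetW r x => Q (setw S r (fun i => evalw S i x))
  | PutN c q o v =>
      put_ok S c q o (fun i => evaln S i (clamp v)) /\ Q (putn S c q o v)
  | PutW c q o r =>
      put_ok S c q o (fun i => regw S i r) /\ Q (putw S c q o r)
  | Loop halve r e b => exists2 T, T <= L &
      wp_iterate (wp b) halve r Q T (setn S r (fun i => evaln S i e))
  end.

Lemma wp_mono s Q Q' S : (forall S', Q S' -> Q' S') -> wp s Q S -> wp s Q' S.
Proof.
elim: s Q Q' S => /=; try by move=> *; auto.
- by move=> a IHa b IHb Q Q' S sub; apply: IHa => S'; apply: IHb.
- by move=> c q o v Q Q' S sub [ok /sub].
- by move=> c q o r Q Q' S sub [ok /sub].
move=> halve r e b IHb Q Q' S sub [T le_TL loop_T]; exists T => //.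
elim: T {le_TL} (setn S r _) loop_T => [|T IHT] S1 [r_S1 next]; split=> //.
  exact: sub.
by apply: IHb next => S'; apply: IHT.
Qed.

Definition ncell S q o := nmem (ram S) (q * Z + o).

Definition wcell S q o := wmem (ram S) (q * Z + o).

Definition frame (A : location -> bool) S S' :=
  [/\ forall i r, ~~ A (NRegister r) -> regn S' i r = regn S i r,
      forall i r, ~~ A (WRegister r) -> regw S' i r = regw S i r,
      forall q o, ~~ A (NRegion q) -> o < Z -> ncell S' q o = ncell S q o
    & forall q o, ~~ A (WRegion q) -> o < Z -> wcell S' q o = wcell S q o].

Lemma frame_sub (A A' : location -> bool) S S' :
  (forall x, A x -> A' x) -> frame A S S' -> frame A' S S'.
Proof.
move=> sub [eqn eqw eqnc eqwc]; have sub' x : ~~ A' x -> ~~ A x.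
  exact/contra/sub.
by split=> *; [apply: eqn | apply: eqw | apply: eqnc | apply: eqwc];
  rewrite ?sub'.
Qed.

Lemma frame_trans A S1 S2 S3 : frame A S1 S2 -> frame A S2 S3 -> frame A S1 S3.
Proof.
move=> [eqn1 eqw1 eqnc1 eqwc1] [eqn2 eqw2 eqnc2 eqwc2].
by split=> *; rewrite ?(eqn2, eqw2, eqnc2, eqwc2) //
                      ?(eqn1, eqw1, eqnc1, eqwc1).
Qed.

Lemma frame_setn S r f : frame (modifies (SetN r (#0)%nexp)) S (setn S r f).
Proof. by split=> // i x /= neq_x; rewrite upd_neq // eq_sym. Qed.

Lemma address_neq q q' o o' :
  o < Z -> o' < Z -> q != q' -> q * Z + o <> q' * Z + o'.
Proof. nia. Qed.

Lemma write_miss (V : Type) S c q o (v : 'I_p -> V) q' o' i x :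
  put_ok S c q o v -> q != q' -> o' < Z ->
  write S c q o v i <> Some (q' * Z + o', x).
Proof.
rewrite /write => -[_ in_region] neq_q lt_o'; case: ifP => // /in_region.
rewrite /evaln /= => -[-> lt_o] [eq_a _].
exact: address_neq lt_o lt_o' neq_q eq_a.
Qed.

Lemma frame_putn S c q o v :
  put_ok S c q o (fun i => evaln S i (clamp v)) ->
  frame (modifies (PutN c q o v)) S (putn S c q o v).
Proof.
move=> ok; split=> // q' o' neq_q lt_o'.
  by apply: commit_miss => i x; apply: write_miss ok neq_q lt_o'.
by rewrite /wcell /= commit_none.
Qed.

Lemma frame_putw S c q o r :
  put_ok S c q o (fun i => regw S i r) ->
  frame (modifies (PutW c q o r)) S (putw S c q o r).
Proof.
move=> ok; split=> // q' o' neq_q lt_o'.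
  by rewrite /ncell /= commit_none.
by apply: commit_miss => i x; apply: write_miss ok neq_q lt_o'.
Qed.

Lemma wp_strengthen s Q S :
  wp s Q S -> wp s (fun S' => Q S' /\ frame (modifies s) S S') S.
Proof.
elim: s Q S => /=.
- by move=> Q S.
- move=> a IHa b IHb Q S /IHa; apply: wp_mono => S1 [/IHb wp_b frame_a].
  apply: wp_mono wp_b => S2 [Q_S2 frame_b]; split=> //.
  apply: (@frame_trans _ _ S1).
    by apply: frame_sub frame_a => x /= ->.
  by apply: frame_sub frame_b => x /= ->; rewrite orbT.
- by move=> r e Q S Q_S; split=> //; apply: frame_sub (frame_setn _ _ _).
- move=> r x Q S Q_S; split=> //; split=> // i r' /= neq_r.
  by rewrite upd_neq // eq_sym.
- by move=> c q o v Q S [ok Q_S]; split=> //; split=> //; apply: frame_putn.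
- by move=> c q o r Q S [ok Q_S]; split=> //; split=> //; apply: frame_putw.
move=> halve r e b IHb Q S [T le_TL loop_T]; exists T => //.
set A := modifies (Loop halve r e b).
have setn_ok S1 f : frame A S1 (setn S1 r f).
  apply: frame_sub (frame_setn S1 r f) => -[r'|r'|q|q] //= /eqP<-.
  by rewrite /A /= eqxx.
elim: T {le_TL} (setn S r _) (setn_ok S (fun i => evaln S i e)) loop_T.
  by move=> S1 frame_S1 [r_S1 Q_S1].
move=> T IHT S1 frame_S1 [r_S1 /IHb next]; split=> //.
apply: wp_mono next => S2 [next frame_b]; apply: IHT next.
apply: (frame_trans frame_S1); apply: frame_trans (setn_ok S2 _).
by apply: frame_sub frame_b => -[r'|r'|q|q] //= mod_b;
  rewrite /A /= mod_b ?orbT.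
Qed.

Lemma wp_frame s Q Q' S : wp s Q S ->
  (forall S', Q S' -> frame (modifies s) S S' -> Q' S') -> wp s Q' S.
Proof.
move=> wp_s sub; apply: wp_mono (wp_strengthen wp_s) => S1 [].
exact: sub.
Qed.

End WeakestPreconditions.

(** * Soundness of the compilation *)

Section Soundness.
Variables (R : realDomainType) (p n Z L B : nat).
Hypotheses (le_B : (n + 2) ^ max_degree <= B) (L_gt0 : 0 < L).
Implicit Types (S : state R p) (C : config R p) (Q : state R p -> Prop).
Implicit Types (P : config R p -> Prop) (s : cmd).

Fixpoint run T P C : Prop :=
  if T is T'.+1 then legal B C /\ run T' P (step C) else P C.

Definition run_within T P C := exists2 t, t <= T & run t P C.

Lemma run_within_bind T1 T2 P P' C : run_within T1 P C ->
  (forall C', P C' -> run_within T2 P' C') -> run_within (T1 + T2) P' C.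
Proof.
move=> [t1 le_t1 run1] next.
elim: t1 T1 C le_t1 run1 => [|t1 IHt1] T1 C le_t1 /=.
  move=> /next[t2 le_t2 run2]; exists t2 => //.
  exact: leq_trans le_t2 (leq_addl _ _).
case: T1 le_t1 => [//|T1] le_t1 [legal_C /(IHt1 T1 _ le_t1)[t le_t run_t]].
by exists t.+1.
Qed.

Lemma run_within_le T1 T2 P C :
  T1 <= T2 -> run_within T1 P C -> run_within T2 P C.
Proof.
by move=> le_T [t le_t run_t]; exists t => //; apply: leq_trans le_T.
Qed.

Lemma memory_eta (m : memory R) : Memory (nmem m) (wmem m) = m.
Proof. by case: m. Qed.

Lemma config_eta C l m :
  (forall i, procs C i = l i) -> shared C = m -> C = Config l m.
Proof.
case: C => procs_C shared_C /= eq_l ->; congr Config.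
exact: functional_extensionality.
Qed.

Definition bounded_mem (m : memory R) := forall a, nmem m a <= B.

Lemma run_local C T (P : 'I_p -> local R -> Prop) P' :
  bounded_mem (shared C) ->
  (forall i, local_run B (shared C) T (P i) (procs C i)) ->
  (forall C', shared C' = shared C -> (forall i, P i (procs C' i)) -> P' C') ->
  run T P' C.
Proof.
elim: T C => [|T IHT] C bounded_C run_C k /=; first exact: k.
have eq_shared : shared (step C) = shared C.
  by rewrite /= !commit_none ?memory_eta // => i; case: (run_C i).
split.
  split=> // [i j a v w|i j a v w|i r]; last by case: (run_C i).
    by case: (run_C i) => ->.
  by case: (run_C i) => _ ->.
apply: IHT; rewrite eq_shared // => i; by case: (run_C i).
Qed.

Definition typed S :=
  (forall i, typed_env n (regn S i) (regw S i)) /\ typed_mem n (ram S).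

Definition represents C K S :=
  [/\ typed S, shared C = ram S
    & forall i, tracks B K (regn S i) (regw S i) (procs C i)].

Lemma typed_mem_bounded m : typed_mem n m -> bounded_mem m.
Proof.
move=> mem_m a; apply: leq_trans (mem_m a) (leq_trans _ le_B).
by rewrite -{1}[n + 2]expn1 leq_pexp2l // addn2.
Qed.

Definition reaches K Q C := exists2 S, represents C K S & Q S.

Lemma run_quiet C K0 K S T S' Q :
  represents C K0 S ->
  (forall i, local_run B (ram S) T
     (tracks B K (regn S' i) (regw S' i)) (procs C i)) ->
  ram S' = ram S -> typed S' -> Q S' -> run_within T (reaches K Q) C.
Proof.
move=> [typed_S eq_ram _] run_C eq_S' typed_S' Q_S'; rewrite -eq_ram in run_C.
exists T => //; apply: (run_local _ run_C) => [|C' eq_C' tracks_C'].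
  by rewrite eq_ram; apply: typed_mem_bounded; case: typed_S.
by exists S' => //; split=> //; rewrite eq_C' eq_ram.
Qed.

Lemma typed_setn S r e :
  r < r_zero -> nexp_ok e -> degree e <= reg_degree r -> typed S ->
  typed (setn S r (fun i => evaln S i e)).
Proof.
move=> lt_r e_ok le_deg [env_S mem_S]; split=> // i /=.
have [le_N N0 W0] := env_S i; split=> //; last first.
  by rewrite upd_neq // gtn_eqF.
move=> x lt_x; rewrite /upd; case: eqP => [->|_]; last exact: le_N.
have n2_gt1 : 1 < n + 2 by rewrite addn2.
apply: leq_trans (neval_degree _ n2_gt1 le_N mem_S e_ok) _.
by rewrite leq_pexp2l // ltnW.
Qed.

Lemma typed_setw S r f : r < r_zero -> typed S -> typed (setw S r f).
Proof.
move=> lt_r [env_S mem_S]; split=> // i /=; have [le_N N0 W0] := env_S i.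
by split=> //; rewrite upd_neq // gtn_eqF.
Qed.

Lemma typed_putn S c q o v :
  nexp_ok (clamp v) -> typed S -> typed (putn S c q o v).
Proof.
move=> v_ok [env_S mem_S]; split=> // a /=.
rewrite /commit; case: pickP => [i|_] //.
rewrite /write; case: ifP => //= _ _; have [le_N _ _] := env_S i.
have n2_gt1 : 1 < n + 2 by rewrite addn2.
by have := neval_degree (regw S i) n2_gt1 le_N mem_S v_ok; rewrite expn1.
Qed.

Lemma typed_putw S c q o r : typed S -> typed (putw S c q o r).
Proof. by case=> env_S mem_S; split=> // a /=; rewrite commit_none. Qed.

Definition keeps_regs (i : stmt) : bool :=
  match i with
  | NStore _ _ | WStore _ _ => true
  | NConst t 0 => r_tmp <= t
  | _ => false
  end.

Lemma tracks_keeps_regs m i K N W (l : local R) : keeps_regs i ->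
  tracks B (i :: K) N W l -> tracks B K N W (local_step m l).
Proof.
move=> keeps_i [ctl_l eqN eqW bounded_l]; rewrite /local_step ctl_l.
case: i keeps_i {ctl_l} => //= t [|//] le_t; split=> //=.
  by move=> r lt_r; rewrite upd_neq ?eqN // ltn_eqF // (leq_trans lt_r).
exact: upd_bounded.
Qed.

Lemma run_store C K S Q (i : 'I_p -> stmt) wn ww :
  (forall j, keeps_regs (i j)) ->
  (forall j, tracks B (i j :: K) (regn S j) (regw S j) (procs C j)) ->
  shared C = ram S -> typed S ->
  (forall j, nwrite (procs C j) = wn j) -> exclusive wn ->
  (forall j, wwrite (procs C j) = ww j) -> exclusive ww ->
  typed (store S wn ww) -> Q (store S wn ww) -> run_within 1 (reaches K Q) C.
Proof.
move=> keeps_i tracks_C eq_ram typed_S eq_wn ex_wn eq_ww ex_ww typed_S' Q_S'.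
have eq_wn' := functional_extensionality _ _ eq_wn.
have eq_ww' := functional_extensionality _ _ eq_ww.
exists 1 => //; split.
  split; rewrite ?eq_wn' ?eq_ww' //.
    by move=> j r; case: (tracks_C j).
  by rewrite eq_ram; apply: typed_mem_bounded; case: typed_S.
exists (store S wn ww) => //; split=> //=.
  by rewrite eq_wn' eq_ww' eq_ram.
by move=> j; apply: tracks_keeps_regs (tracks_C j).
Qed.

Definition sound s := forall Q S C K,
  cmd_ok s -> wp Z L s Q S -> represents C (compile s ++ K) S ->
  run_within (cmd_time s * L ^ loop_depth s) (reaches K Q) C.

Lemma sound_skip : sound Skip.
Proof. by move=> Q S C K _ Q_S rep_C; exists 0 => //; exists S. Qed.

Lemma sound_seq s1 s2 : sound s1 -> sound s2 -> sound (Seq s1 s2).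
Proof.
move=> sound1 sound2 Q S C K /= /andP[ok1 ok2] wp1; rewrite -catA => rep_C.
apply: (@run_within_le (cmd_time s1 * L ^ loop_depth s1 +
                        cmd_time s2 * L ^ loop_depth s2)).
  by rewrite mulnDl leq_add // leq_mul2l leq_pexp2l ?(leq_maxl, leq_maxr) ?orbT.
apply: (run_within_bind (sound1 _ _ _ _ ok1 wp1 rep_C)) => C' [S' rep_C' wp2].
exact: sound2 ok2 wp2 rep_C'.
Qed.

Lemma sound_setn r e : sound (SetN r e).
Proof.
move=> Q S C K /= /and3P[lt_r e_ok le_deg] Q_S rep_C.
have [[env_S mem_S] _ tracks_C] := rep_C.
rewrite muln1; apply: (run_quiet rep_C _ _ _ Q_S) => // [i|].
  exact: (tracks_assign le_B lt_r e_ok (env_S i) mem_S (tracks_C i)).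

exact: typed_setn.
Qed.

Lemma sound_setw r x : sound (SetW r x).
Proof.
move=> Q S C K /= /andP[lt_r x_ok] Q_S rep_C.
have [[env_S mem_S] _ tracks_C] := rep_C.
rewrite muln1; apply: (run_quiet rep_C _ _ _ Q_S) => // [i|].
  exact: (tracks_wexp le_B x_ok (env_S i) mem_S (tracks_C i)).
exact: typed_setw.
Qed.

Lemma run_within_local C T (P : 'I_p -> local R -> Prop) S :
  shared C = ram S -> typed S ->
  (forall i, local_run B (ram S) T (P i) (procs C i)) ->
  run_within T (fun C' => shared C' = ram S /\ forall i, P i (procs C' i)) C.
Proof.
move=> eq_ram [_ mem_S]; rewrite -eq_ram => run_C; exists T => //.
by apply: run_local run_C _ => //; rewrite eq_ram; apply: typed_mem_bounded.
Qed.

Lemma sound_putw c q o r : sound (PutW c q o r).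
Proof.
move=> Q S C K /and3P[c_ok a_ok lt_r] [[ex_w _] Q_S] [typed_S eq_ram tracks_C].
have [env_S mem_S] := typed_S.
have run_C i :=
  tracks_putw le_B c_ok a_ok (env_S i) mem_S (tracks_C i).
rewrite muln1; have -> : cmd_time (PutW c q o r) =
    nexp_time c + (nexp_time (address q o) + 1) + 1 by rewrite /=; lia.
apply: (run_within_bind (run_within_local eq_ram typed_S run_C)).
move=> C' [eq_ram' C'P]; have tracks_C' i := (C'P i).1.
apply: (@run_store _ _ _ _ _ (fun=> None) _ _ tracks_C' eq_ram' typed_S _ _ _
          ex_w) => // [i|i|i|].
- by case: ifP.
- by rewrite /nwrite; case: (tracks_C' i) => -> _ _ _; case: ifP.
- have [ctl_C' _ eqW _] := tracks_C' i.
  rewrite /wwrite /write ctl_C' /evaln; case: ifP => // _.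
  by rewrite (C'P i).2 eqW // inE ltnW.
exact: typed_putw.
Qed.

Lemma sound_putn c q o v : sound (PutN c q o v).
Proof.
move=> Q S C K /and3P[v_ok c_ok a_ok] [[ex_w _] Q_S] [typed_S eq_ram tracks_C].
have [env_S mem_S] := typed_S.
have run_C i :=
  tracks_putn le_B v_ok c_ok a_ok (env_S i) mem_S (tracks_C i).
rewrite muln1; have -> : cmd_time (PutN c q o v) = nexp_time (clamp v) +
    (nexp_time c + (nexp_time (address q o) + 1)) + 1 by rewrite /=; lia.
apply: (run_within_bind (run_within_local eq_ram typed_S run_C)).
move=> C' [eq_ram' C'P].
have tracks_C' i := let: And3 tracks_i _ _ := C'P i in tracks_i.
apply: (@run_store _ _ _ _ _ _ (fun=> None) _ tracks_C' eq_ram' typed_S _ ex_w)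
  => // [i|i|i|].
- by case: ifP.
- have [ctl_C' _ _ _] := tracks_C' i; have [_ a_C' v_C'] := C'P i.
  rewrite /nwrite /write ctl_C' /evaln; case: ifP => // _.
  by rewrite a_C' v_C'.
- by rewrite /wwrite; case: (tracks_C' i) => -> _ _ _; case: ifP.
exact: typed_putn.
Qed.

Lemma represents_zero C K S i :
  represents C K S -> nreg (procs C i) r_zero = 0.
Proof.
move=> [[env_S _] _ tracks_C].
by case: (tracks_typed (env_S i) (tracks_C i)) => -[].
Qed.

Lemma run_while_test r b C K S Q (c : bool) : r < r_zero ->
  represents C (While (NLt r_zero r) b :: K) S ->
  (forall i, (0 < regn S i r) = c) -> Q S ->
  run_within 1
    (reaches (if c then b ++ While (NLt r_zero r) b :: K else K) Q) C.
Proof.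
move=> lt_r rep_C test_S Q_S; have [typed_S eq_ram tracks_C] := rep_C.
apply: (run_quiet rep_C _ _ _ Q_S) => // i.
have [ctl_C eqN eqW bounded_C] := tracks_C i.
apply: tracks_step (tracks_C i) _ _ _; rewrite /nwrite /wwrite ?ctl_C //=.
rewrite /local_step ctl_C /= (represents_zero i rep_C) eqN ?test_S //.
by rewrite inE ltnW.
Qed.

Lemma shrink_time halve r : nexp_time (shrink halve r) = 3.
Proof. by case: halve. Qed.

Lemma shrink_degree halve r : degree (shrink halve r) <= reg_degree r.
Proof. by case: halve. Qed.

Lemma sound_iterations halve r b : sound b -> cmd_ok b -> r < r_zero ->
  nexp_ok (shrink halve r) -> forall T Q S C K,
  wp_iterate (wp Z L b) halve r Q T S ->
  represents C (While (NLt r_zero r)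
                  (compile b ++ assign r (shrink halve r)) :: K) S ->
  run_within (T * (cmd_time b * L ^ loop_depth b + 5) + 1) (reaches K Q) C.
Proof.
move=> sound_b b_ok lt_r shrink_ok; elim=> [|T IHT] Q S C K /= [r_S].
  move=> Q_S rep_C; apply: (run_while_test (c := false)) rep_C _ Q_S => // i.
  by rewrite r_S.
move=> next rep_C.
apply: (@run_within_le (1 + (cmd_time b * L ^ loop_depth b +
    (4 + (T * (cmd_time b * L ^ loop_depth b + 5) + 1))))); first by lia.
have enter := run_while_test (c := true) lt_r rep_C r_S next.
apply: (run_within_bind enter) => C1 [S1 rep_C1 {}next].
rewrite -catA in rep_C1.
apply: (run_within_bind (sound_b _ _ _ _ b_ok next rep_C1)).
move=> C2 [S2 rep_C2 loop_T].
have := sound_setn (r := r) (e := shrink halve r) _ loop_T rep_C2.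
rewrite [cmd_time _]/= shrink_time muln1 => step.
apply: (run_within_bind (step _)) => [|C3 [S3 rep_C3 loop_S3]].
  by rewrite /= lt_r shrink_ok shrink_degree.
exact: IHT loop_S3 rep_C3.
Qed.

Lemma sound_loop halve r e b : sound b -> sound (Loop halve r e b).
Proof.
move=> sound_b Q S C K /= /and5P[lt_r e_ok le_deg shrink_ok b_ok].
move=> [T le_T loop_T]; rewrite -catA => rep_C.
have init := sound_setn (r := r) (e := e) _ loop_T rep_C.
apply: (@run_within_le (nexp_time e + 1 +
  (T * (cmd_time b * L ^ loop_depth b + 5) + 1))).
  have pow_gt0 : 0 < L ^ loop_depth b by rewrite expn_gt0 L_gt0.
  have := leq_mul le_T (leqnn (cmd_time b * L ^ loop_depth b + 5)).
  by rewrite expnS; nia.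
rewrite /= muln1 in init.
apply: (run_within_bind (init _)) => [|C1 [S1 rep_C1 loop_S1]].
  by rewrite lt_r e_ok.
exact: sound_iterations loop_S1 rep_C1.
Qed.

Theorem wp_sound s : sound s.
Proof.
elim: s => [|a IHa b IHb|r e|r x|c q o v|c q o r|halve r e b IHb].
- exact: sound_skip.
- exact: sound_seq.
- exact: sound_setn.
- exact: sound_setw.
- exact: sound_putn.
- exact: sound_putw.
exact: sound_loop.
Qed.

Lemma run_iter T P C : run T P C ->
  P (iter T (@step R p) C) /\ forall t, t < T -> legal B (iter t (@step R p) C).
Proof.
elim: T C => [|T IHT] C //= [legal_C /IHT[P_T legal_T]].
rewrite -iterSr in P_T; split=> // -[|t] lt_t //.
by rewrite iterSr; apply: legal_T.
Qed.

Lemma step_halted C : halted C -> step C = C.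
Proof.
move=> halt_C; rewrite /step !commit_none ?memory_eta;
  try by move=> i; rewrite /nwrite /wwrite halt_C.
by apply/esym/config_eta => // i; rewrite /local_step halt_C.
Qed.

Lemma represents_halted C S : represents C [::] S -> halted C /\ legal B C.
Proof.
move=> [[_ mem_S] eq_ram tracks_C].
have halt_C i : ctl (procs C i) = [::] by case: (tracks_C i).
split=> //; split=> [i j a v w|i j a v w|i|].
- by rewrite /nwrite halt_C.
- by rewrite /wwrite halt_C.
- by case: (tracks_C i).
by rewrite eq_ram; apply: typed_mem_bounded.
Qed.

Lemma run_exec T prog args m Q : run T (reaches [::] Q) (start p prog args m) ->
  exists2 S, exec B p T prog args m (ram S) & typed_mem n (ram S) /\ Q S.
Proof.
move=> /run_iter[[S rep_S Q_S] legal_T].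
have [[_ mem_S] eq_ram _] := rep_S; exists S => //.
have [halt_T legal_halted] := represents_halted rep_S.
split=> // t; have [|le_Tt] := ltnP t T; first exact: legal_T.
rewrite -(subnK le_Tt) iterD.
by elim: (t - T) => //= j; rewrite iter_fix ?step_halted.
Qed.

Definition initial_state args m : state R p :=
  State (fun i : 'I_p => nth 0 (nat_of_ord i :: args)) (fun _ _ => 0%E) m.

Lemma nth_args_le args r : size args <= 4 -> all (leq^~ (n + 2)) args ->
  nth 0 args r <= (n + 2) ^ reg_degree r.+1.
Proof.
move=> size_args /all_nthP le_args.
have [lt_r|le_r] := ltnP r (size args); last by rewrite nth_default.
have -> : reg_degree r.+1 = 1 by rewrite /reg_degree /= (leq_trans lt_r).
by rewrite expn1 le_args.
Qed.

Lemma represents_start s args m :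
  size args <= 4 -> all (leq^~ (n + 2)) args -> p <= (n + 2) ^ 3 ->
  typed_mem n m ->
  represents (start p (compile s) args m) (compile s ++ [::])
    (initial_state args m).
Proof.
move=> size_args le_args le_p mem_m; split=> // [|i].
  split=> // i; split=> //=; last first.
    by rewrite nth_default // (leq_trans size_args).
  move=> [|r] _ /=; last exact: nth_args_le.
  exact: leq_trans (ltnW (ltn_ord i)) le_p.
rewrite cats0; split=> // -[|r] /=.
  apply: leq_trans (ltnW (ltn_ord i)) (leq_trans le_p (leq_trans _ le_B)).
  by rewrite leq_pexp2l // addn2.
apply: leq_trans (nth_args_le _ size_args le_args) (leq_trans _ le_B).
rewrite leq_pexp2l ?addn2 //.
by rewrite /reg_degree; do ![case: ifP => _ //].
Qed.

Theorem wp_exec s Q args m :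
  cmd_ok s -> all (leq^~ (n + 2)) args -> size args <= 4 -> p <= (n + 2) ^ 3 ->
  typed_mem n m -> wp Z L s Q (initial_state args m) ->
  exists T S, [/\ T <= cmd_time s * L ^ loop_depth s,
    exec B p T (compile s) args m (ram S), typed_mem n (ram S) & Q S].
Proof.
move=> s_ok le_args size_args le_p mem_m wp_s.
have rep_start := represents_start s size_args le_args le_p mem_m.
have [T le_T run_T] := wp_sound s_ok wp_s rep_start.
have [S exec_S [mem_S Q_S]] := run_exec run_T.
by exists T, S.
Qed.

End Soundness.

(** * Proof rules *)

Section Rules.
Variables (R : realDomainType) (p Z L : nat).
Implicit Types (S : state R p) (Q : state R p -> Prop).
Local Notation wp := (@wp R p Z L).

Lemma wp_seq s1 s2 Q1 Q S : wp s1 Q1 S ->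
  (forall S', Q1 S' -> frame Z (modifies s1) S S' -> wp s2 Q S') ->
  wp (Seq s1 s2) Q S.
Proof. exact: wp_frame. Qed.

Lemma wp_setn r e s Q S (v : 'I_p -> nat) : (forall i, evaln S i e = v i) ->
  wp s Q (setn S r v) -> wp (Seq (SetN r e) s) Q S.
Proof. by move=> /functional_extensionality eq_v; rewrite /= eq_v. Qed.

Lemma wp_setw r x s Q S (v : 'I_p -> \bar R) :
  (forall i, evalw S i x = v i) ->
  wp s Q (setw S r v) -> wp (Seq (SetW r x) s) Q S.
Proof. by move=> /functional_extensionality eq_v; rewrite /= eq_v. Qed.

Definition stored (V : Type) (cd : pred 'I_p) (off : 'I_p -> nat)
    (val : 'I_p -> V) (f f' : nat -> V) :=
  (forall i, cd i -> f' (off i) = val i) /\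
  (forall a, a < Z -> (forall i, cd i -> off i <> a) -> f' a = f a).

Definition addressing S c o (cd : pred 'I_p) off :=
  [/\ forall i, regn S i r_region = Z, forall i, (0 < evaln S i c) = cd i,
      forall i, cd i -> evaln S i o = off i, forall i, cd i -> off i < Z
    & {in cd &, injective off}].

Lemma put_stored (V : Type) S c q o (v : 'I_p -> V) cd off :
  addressing S c o cd off ->
  put_ok Z S c q o v /\ forall f,
    stored cd off v (fun a => f (q * Z + a))
      (fun a => commit (write S c q o v) f (q * Z + a)).
Proof.
move=> [region_S cd_S off_S lt_off off_inj].
have writeE i : write S c q o v i =
    if cd i then Some (q * Z + off i, v i) else None.
  rewrite /write cd_S; case: ifP => // cd_i.
  by rewrite -off_S // /evaln /= region_S.
have ex_w : exclusive (write S c q o v).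
  move=> i j a x y; rewrite !writeE; case: ifP => // cd_i [<- _].
  by case: ifP => // cd_j [eq_a _]; apply: off_inj => //; lia.
split; first by split=> // i; rewrite cd_S => cd_i; rewrite off_S ?lt_off.
move=> f; split=> [i cd_i|a lt_a miss_a].
  by apply: (commit_hit _ ex_w (i := i)); rewrite writeE cd_i.
apply: commit_miss => i x; rewrite writeE; case: ifP => // cd_i [eq_a _].
by apply: miss_a cd_i _; lia.
Qed.

Lemma wp_putn c q o v S cd off : addressing S c o cd off ->
  wp (PutN c q o v) (fun S' =>
    stored cd off (fun i => evaln S i (clamp v))
      (ncell Z S q) (ncell Z S' q)) S.
Proof.
case/(put_stored q (fun i => evaln S i (clamp v))) => ok store_v.
by split=> //; apply: store_v.
Qed.

Definition put_key c q o v r := Seq (PutN c q o v) (PutW c q o r).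

Definition kcell S q a : key R := (wcell Z S q a, ncell Z S q a).

Definition store_free (e : nexp) :=
  forall (N : nat -> nat) (W : nat -> \bar R) m m',
  neval N W m e = neval N W m' e.

Lemma wp_put_key c q o v r S cd off : addressing S c o cd off ->
  store_free c -> store_free o ->
  wp (put_key c q o v r) (fun S' =>
    stored cd off (fun i => (regw S i r, evaln S i (clamp v)) : key R)
      (kcell S q) (kcell S' q)) S.
Proof.
move=> addr free_c free_o; apply: wp_seq (wp_putn q v addr) _.
move=> S1 [hit1 miss1] [eqn eqw _ eqwc].
have eval_S1 e : store_free e -> forall i, evaln S1 i e = evaln S i e.
  move=> free_e i; rewrite /evaln (free_e _ _ _ (ram S)).
  rewrite (functional_extensionality _ _ (fun r => eqn i r isT)).
  by rewrite (functional_extensionality _ _ (fun r => eqw i r isT)).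
have addr1 : addressing S1 c o cd off.
  have [region_S cd_S off_S lt_off off_inj] := addr.
  by split=> // i; rewrite ?eqn ?eval_S1 //; apply: off_S.
have [ok store_r] := put_stored q (fun i => regw S1 i r) addr1; split=> //.
have [hit2 miss2] := store_r (wmem (ram S1)); have [_ _ _ lt_off _] := addr.
have eq_n a : ncell Z (putw S1 c q o r) q a = ncell Z S1 q a.
  by rewrite /ncell /= commit_none.
split=> [i cd_i|a lt_a miss_a]; rewrite /kcell eq_n.
  by rewrite hit1 // [wcell _ _ _ _]hit2 // eqw.
by rewrite miss1 // [wcell _ _ _ _]miss2 // -[wmem _ _]/(wcell Z S1 q a) eqwc.
Qed.

Lemma wp_loop halve r e s S T (val : nat -> nat)
    (I : nat -> state R p -> Prop) :
  T <= L -> ~~ modifies s (NRegister r) -> (forall i, evaln S i e = val 0) ->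
  (forall j, j < T -> 0 < val j /\
     val j.+1 = if halve then val j %/ 2 else val j - 1) -> val T = 0 ->
  (forall j S f, I j S -> I j (setn S r f)) -> I 0 S ->
  (forall j S, j < T -> (forall i, regn S i r = val j) -> I j S ->
     wp s (I j.+1) S) ->
  wp (Loop halve r e s) (I T) S.
Proof.
move=> le_TL keeps_r init next final I_setn I0 body; exists T => //.
have init_S i : regn (setn S r (fun i => evaln S i e)) i r = val 0.
  by rewrite /= upd_eq init.
suff loop t j S1 : j + t = T -> (forall i, regn S1 i r = val j) -> I j S1 ->
    wp_iterate (wp s) halve r (I T) t S1.
  by apply: (loop _ 0) => //; apply: I_setn.
elim: t j S1 {init_S I0} => [|t IHt] j S1 eq_T val_S1 Ij.
  rewrite addn0 in eq_T; split; last by rewrite -eq_T.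
  by move=> i; rewrite val_S1 eq_T final.
have lt_jT : j < T by rewrite -eq_T -addSnnS leq_addr.
have [val_gt0 val_next] := next j lt_jT.
split=> [i|]; first by rewrite val_S1.
apply: wp_frame (body _ _ lt_jT val_S1 Ij) _ => S2 Ij2 [eqn _ _ _].
apply: (IHt j.+1) => [|i|]; [by rewrite addSnnS | | exact: I_setn].
by rewrite /= upd_eq val_next /evaln; case: (halve); rewrite /= eqn // val_S1.
Qed.

Lemma lg_gt v : v < 2 ^ lg v.
Proof. exact: trunc_log_ltn. Qed.

Lemma lg_le v j : 0 < v -> j < lg v -> 2 ^ j <= v.
Proof.
move=> v_gt0 lt_j; apply: (@leq_trans (2 ^ trunc_log 2 v)).
  by rewrite leq_exp2l.
exact: trunc_logP.
Qed.

Lemma wp_halving r e s S v (I : nat -> state R p -> Prop) :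
  0 < v -> lg v <= L -> ~~ modifies s (NRegister r) ->
  (forall i, evaln S i e = v) ->
  (forall j S f, I j S -> I j (setn S r f)) -> I 0 S ->
  (forall j S, j < lg v -> (forall i, regn S i r = v %/ 2 ^ j) -> I j S ->
     wp s (I j.+1) S) ->
  wp (Loop true r e s) (I (lg v)) S.
Proof.
move=> v_gt0 le_lg keeps_r init; apply: wp_loop => //.
- by rewrite divn1.
- move=> j /(lg_le v_gt0) le_jv; rewrite divn_gt0 ?expn_gt0 //.
  by rewrite -divnMA -expnSr.
by rewrite divn_small ?lg_gt.
Qed.

Lemma wp_countdown r e s S v (I : nat -> state R p -> Prop) :
  v <= L -> ~~ modifies s (NRegister r) -> (forall i, evaln S i e = v) ->
  (forall j S f, I j S -> I j (setn S r f)) -> I 0 S ->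
  (forall j S, j < v -> (forall i, regn S i r = v - j) -> I j S ->
     wp s (I j.+1) S) ->
  wp (Loop false r e s) (I v) S.
Proof.
move=> le_v keeps_r init; apply: wp_loop => //; first by rewrite subn0.
  by move=> j lt_j; rewrite subn_gt0 lt_j subnS subn1.
exact: subnn.
Qed.

End Rules.

(** * The programs *)

Notation "'begin' s1 ; .. ; s2 'end'" := (Seq s1 .. (Seq s2 Skip) ..)
  (format "'begin'  '[' s1 ; .. ; s2 ']'  'end'").

Notation r_pid := 0 (only parsing).
Notation r_k := 2 (only parsing).
Notation r_src := 3 (only parsing).
Notation r_dst := 4 (only parsing).
Notation r_row := 5 (only parsing).
Notation r_col := 6 (only parsing).
Notation r_slot := 8 (only parsing).
Notation r_slots := 9 (only parsing).
Notation r_pow := 10 (only parsing).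
Notation r_round := 11 (only parsing).
Notation r_phase := 12 (only parsing).
Notation r_probe := 13 (only parsing).
Notation r_vertex := 14 (only parsing).
Notation r_hops := 15 (only parsing).
Notation r_len := 16 (only parsing).
Notation r_block := 17 (only parsing).
Notation r_card := 18 (only parsing).
Notation r_better := 19 (only parsing).
Notation r_hops' := 20 (only parsing).
Notation r_middle' := 21 (only parsing).
Notation r_steps := 22 (only parsing).
Notation r_valid := 23 (only parsing).
Notation r_logk := 24 (only parsing).
Notation r_start := 30 (only parsing).
Notation r_count := 31 (only parsing).
Notation r_name := 32 (only parsing).
Notation r_name' := 33 (only parsing).
Notation r_offset := 34 (only parsing).
Notation r_rank := 40 (only parsing).

Notation w_dist := 0 (only parsing).
Notation w_dist' := 1 (only parsing).
Notation w_zero := 2 (only parsing).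

Notation q_io := 0 (only parsing).
Notation q_key := 1 (only parsing).
Notation q_cand := 2 (only parsing).
Notation q_middle := 3 (only parsing).
Notation q_rank := 4 (only parsing).
Notation q_sorted := 5 (only parsing).
Notation q_pred := 6 (only parsing).
Notation q_path := 7 (only parsing).
Notation q_logk := 8 (only parsing).

Definition load q e := ELoad (address q e).
Definition cell e : nexp := ($r_row * $r_n + e)%nexp.
Definition parity e : nexp := (e - e / #2 * #2)%nexp.
Definition eq_nexp a b : nexp := (#1 - (a < b) - (b < a))%nexp.
Definition region_size : nexp := (($r_n + #2) * ($r_n + #2) * ($r_n + #2))%nexp.
Definition slot0 : nexp := ($r_slot < #1)%nexp.
Definition halving r s := Loop true r ($r_pow / #2)%nexp s.

(* Compares (w_dist', a) with (w_dist, b) lexicographically. *)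
Definition key_less a b : nexp :=
  EIf (EWLe w_dist' w_dist) (EIf (EWLe w_dist w_dist') (a < b) #1) #0.

(* The processors are indexed by triples of a row, a column and a slot. *)
Definition setup :=
  begin
    SetN r_region region_size;
    SetN r_slots ($r_k + #1);
    SetN r_row ($r_pid / $r_slots / $r_n);
    SetN r_col ($r_pid / $r_slots - $r_row * $r_n);
    SetN r_slot ($r_pid - $r_pid / $r_slots * $r_slots);
    SetN r_pow #1;
    Loop true r_round $r_n
      (begin SetN r_pow (emin ($r_pow + $r_pow) ($r_n + $r_n)) end)
  end.

Definition init_keys :=
  begin
    SetW w_dist (XLoad (address q_io (cell $r_col)));
    SetW w_dist' XInf;
    SetW w_zero XZero;
    SetN r_hops (EIf (eq_nexp $r_row $r_col) #0
                     (EIf (EWLe w_dist' w_dist) $r_n #1));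
    SetW w_dist (XIf (eq_nexp $r_row $r_col) w_zero w_dist);
    put_key slot0 q_key (cell $r_col) $r_hops w_dist
  end.

(* Binary search for the number of elements of the sibling block that precede
   the vertex r_col. *)
Definition search_step :=
  begin
    SetN r_vertex
      (load q_sorted (cell ($r_start + ($r_count + $r_probe - #1))));
    SetW w_dist' (XLoad (address q_key (cell $r_vertex)));
    SetN r_name' (load q_key (cell $r_vertex) * $r_n + $r_vertex);
    SetN r_count
      (EIf (EIf ($r_card < $r_count + $r_probe) #0 (key_less $r_name' $r_name))
           (emin ($r_count + $r_probe) $r_n) $r_count)
  end.

Definition merge_setup :=
  begin
    SetN r_len ($r_pow / $r_phase / #2);
    SetN r_block ($r_col / $r_len);
    SetN r_start (EIf (parity $r_block) (($r_block - #1) * $r_len)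
                                        (($r_block + #1) * $r_len));
    SetN r_card (emin $r_len ($r_n - $r_start));
    SetN r_count #0;
    SetW w_dist (XLoad (address q_key (cell $r_col)));
    SetN r_name (load q_key (cell $r_col) * $r_n + $r_col)
  end.

Definition merge_store :=
  begin
    SetN r_rank (load q_rank (cell $r_col) + $r_count);
    PutN slot0 q_rank (cell $r_col) $r_rank;
    PutN slot0 q_sorted (cell ($r_block / #2 * (#2 * $r_len) + $r_rank)) $r_col
  end.

Definition merge :=
  begin merge_setup; halving r_probe search_step; merge_store end.

Definition sort_rows :=
  begin
    PutN slot0 q_rank (cell $r_col) #0;
    PutN slot0 q_sorted (cell $r_col) $r_col;
    halving r_phase merge
  end.

Definition fetch_candidates q hops :=
  begin
    SetN r_vertex (load q_sorted (cell (emin $r_slot ($r_n - #1))));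
    SetW w_dist (XLoad (address q_key (cell $r_vertex)));
    SetW w_dist' (XLoad (address q ($r_vertex * $r_n + $r_col)));
    SetW w_dist (XAdd w_dist w_dist');
    SetN r_hops (emin (load q_key (cell $r_vertex) + hops) $r_n);
    put_key #1 q_cand $r_pid $r_hops w_dist;
    PutN #1 q_middle $r_pid $r_vertex
  end.

Definition keep_better :=
  begin
    SetW w_dist (XLoad (address q_cand $r_pid));
    SetW w_dist' (XLoad (address q_cand ($r_pid + $r_phase)));
    SetN r_hops (load q_cand $r_pid);
    SetN r_hops' (load q_cand ($r_pid + $r_phase));
    SetN r_middle' (load q_middle ($r_pid + $r_phase));
    SetN r_better
      (EIf ($r_slot + $r_phase < $r_slots) (key_less $r_hops' $r_hops) #0);
    put_key $r_better q_cand $r_pid $r_hops' w_dist';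
    PutN $r_better q_middle $r_pid $r_middle'
  end.

Definition minimize q hops :=
  begin fetch_candidates q hops; halving r_phase keep_better end.

Definition square :=
  begin
    sort_rows;
    minimize q_key (load q_key ($r_vertex * $r_n + $r_col));
    SetW w_dist (XLoad (address q_cand $r_pid));
    put_key slot0 q_key (cell $r_col) (load q_cand $r_pid) w_dist
  end.

Definition find_predecessors :=
  begin
    minimize q_io #1;
    PutN slot0 q_pred (cell $r_col) (load q_middle $r_pid)
  end.

(* Pointer doubling: after t iterations, the pointers in q_pred skip 2 ^ t
   vertices, and r_steps is the number of steps left divided by 2 ^ t. *)
Definition jump :=
  begin
    SetN r_vertex
      (EIf (parity $r_steps) (load q_pred (cell $r_vertex)) $r_vertex);
    SetN r_steps ($r_steps / #2);
    PutN slot0 q_pred (cell $r_col)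
      (load q_pred (cell (load q_pred (cell $r_col))))
  end.

Definition trace_paths :=
  begin
    SetN r_vertex $r_col;
    SetN r_steps (load q_key (cell $r_col) - $r_slot);
    halving r_phase jump;
    PutN #1 q_path $r_pid $r_vertex
  end.

Definition store_logk :=
  begin
    SetN r_logk #0;
    Loop true r_phase $r_k
      (begin SetN r_logk (emin ($r_logk + #1) $r_n) end);
    PutN ($r_pid < #1) q_logk #0 $r_logk
  end.

Definition output :=
  begin
    SetN r_vertex (load q_sorted (cell $r_slot));
    SetW w_dist (XLoad (address q_key (cell $r_vertex)));
    SetN r_valid (($r_col < #1) * ((#0 < $r_slot) * ($r_slot < $r_n)));
    SetN r_offset ($r_n * $r_n + $r_row * $r_k + ($r_slot - #1));
    put_key $r_valid q_io $r_offset $r_vertex w_dist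
  end.

Definition compute_keys :=
  begin setup; init_keys; halving r_round square; sort_rows end.

Definition preprocess :=
  begin
    compute_keys;
    find_predecessors;
    trace_paths;
    store_logk;
    output
  end.

(* The processor r_pid copies the cells r_pid * r_logk, ... of the path. *)
Definition report_step :=
  begin
    SetN r_offset ($r_pid * $r_logk + ($r_phase - #1));
    PutN ($r_offset < $r_hops + #1) q_io ($r_offset + #1)
      (load q_path (($r_src * $r_n + $r_dst) * ($r_k + #1) + $r_offset))
  end.

Definition report :=
  begin
    SetN r_region region_size;
    SetN r_hops (load q_key ($r_src * $r_n + $r_dst));
    SetN r_logk (load q_logk #0);
    PutN ($r_pid < #1) q_io #0 $r_hops;
    Loop false r_phase (emin ($r_hops + #1) $r_logk) report_step
  end.

Lemma cmd_ok_preprocess : cmd_ok preprocess.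
Proof. by vm_compute. Qed.

Lemma cmd_ok_report : cmd_ok report.
Proof. by vm_compute. Qed.

Lemma loop_depth_preprocess : loop_depth preprocess = 3.
Proof. by vm_compute. Qed.

Lemma loop_depth_report : loop_depth report = 1.
Proof. by vm_compute. Qed.

(** * Sorting by merging sibling blocks *)

Lemma sum_interval m a b : a <= b ->
  \sum_(y < m) (a <= y < b) = minn b m - minn a m.
Proof.
move=> le_ab; elim: m => [|m IHm]; first by rewrite big_ord0; lia.
by rewrite big_ord_recr /= IHm; lia.
Qed.

Definition sibling b := if odd b then b.-1 else b.+1.

Lemma eq_half_sibling a b : (a %/ 2 == b %/ 2) = (a == b) || (a == sibling b).
Proof. by rewrite /sibling; case: ifP => odd_b; lia. Qed.

Lemma sibling_neq b : sibling b != b.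
Proof. by rewrite /sibling; case: ifP => odd_b; lia. Qed.

Section Blocks.
Variables (R : realDomainType) (n : nat) (f : 'I_n -> key R).
Implicit Types (y w : 'I_n).

Definition block j b := [set y : 'I_n | y %/ 2 ^ j == b].

Definition block_rank j w := rank (named_key f) (block j (w %/ 2 ^ j)) w.

Definition sibling_rank j w :=
  rank (named_key f) (block j (sibling (w %/ 2 ^ j))) w.

(* The position of w when every block of size 2 ^ j is sorted. *)
Definition position j w := w %/ 2 ^ j * 2 ^ j + block_rank j w.

Lemma card_block j b : #|block j b| = minn (2 ^ j) (n - b * 2 ^ j).
Proof.
have pow_gt0 : 0 < 2 ^ j by rewrite expn_gt0.
transitivity (\sum_(y < n) (b * 2 ^ j <= y < b * 2 ^ j + 2 ^ j)); last first.
  by rewrite sum_interval; lia.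
rewrite -sum1dep_card big_mkcond /=; apply: eq_bigr => y _.
rewrite eqn_leq -ltnS ltn_divLR // leq_divRL // mulSn addnC andbC.
by case: andP.
Qed.

Lemma mem_block j w : w \in block j (w %/ 2 ^ j).
Proof. by rewrite inE. Qed.

Lemma blockS j w : block j.+1 (w %/ 2 ^ j.+1) =
  block j (w %/ 2 ^ j) :|: block j (sibling (w %/ 2 ^ j)).
Proof.
by apply/setP => y; rewrite !inE expnSr !divnMA eq_half_sibling.
Qed.

Lemma disjoint_sibling_block j b : [disjoint block j b & block j (sibling b)].
Proof.
apply/pred0P => y /=; rewrite !inE; apply/negbTE/negP => /andP[/eqP-> ].
by rewrite eq_sym (negPf (sibling_neq b)).
Qed.

Lemma block_rank0 w : block_rank 0 w = 0.
Proof.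
apply/eqP; rewrite -leqn0 -ltnS; apply: leq_trans (rank_lt_card _ _) _.
  exact: mem_block.
by rewrite card_block geq_minl.
Qed.

Lemma block_rankS j w : block_rank j.+1 w = block_rank j w + sibling_rank j w.
Proof. by rewrite /block_rank blockS rankU // disjoint_sibling_block. Qed.

Lemma block_rank_lt j w : block_rank j w < 2 ^ j.
Proof.
apply: leq_trans (rank_lt_card _ (mem_block j w)) _.
by rewrite card_block geq_minl.
Qed.

Lemma position_lt j w : position j w < n.
Proof.
have := rank_lt_card (named_key f) (mem_block j w).
by rewrite card_block -/(block_rank j w) /position; lia.
Qed.

Lemma position_div j w : position j w %/ 2 ^ j = w %/ 2 ^ j.
Proof.
rewrite /position divnMDl ?expn_gt0 //.
by rewrite (divn_small (block_rank_lt j w)) addn0.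
Qed.

Lemma position_inj j : injective (position j).
Proof.
move=> y w eq_yw; have eq_block : y %/ 2 ^ j = w %/ 2 ^ j.
  by rewrite -(position_div j y) eq_yw position_div.
move: eq_yw; rewrite /position eq_block => /addnI.
rewrite /block_rank eq_block; apply: rank_inj; first exact: named_key_inj.
  by rewrite -eq_block mem_block.
exact: mem_block.
Qed.

Lemma position0 w : position 0 w = w.
Proof. by rewrite /position block_rank0 addn0 expn0 divn1 muln1. Qed.

Lemma position_vrank j w : n <= 2 ^ j -> position j w = vrank f w.
Proof.
move=> le_n; have div0 (y : 'I_n) : y %/ 2 ^ j = 0.
  by rewrite divn_small // (leq_trans (ltn_ord y)).
rewrite /position /block_rank div0; congr (rank _ _ _).
by apply/setP => y; rewrite !inE div0.
Qed.

Lemma leq_sibling_rank j w a y :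
  0 < a -> a <= #|block j (sibling (w %/ 2 ^ j))| ->
  position j y = sibling (w %/ 2 ^ j) * 2 ^ j + a.-1 ->
  (a <= sibling_rank j w) = (named_key f y < named_key f w)%O.
Proof.
rewrite card_block; case: a => // a _ lt_a eq_y.
have eq_block : y %/ 2 ^ j = sibling (w %/ 2 ^ j).
  have small := divn_small (leq_trans lt_a (geq_minl _ _)).
  by rewrite -(position_div j y) eq_y divnMDl ?expn_gt0 // small addn0.
rewrite /= /position eq_block in eq_y; have {}eq_y := addnI eq_y.
rewrite -eq_y /block_rank eq_block rank_ltE //.
by rewrite -eq_block mem_block.
Qed.

Lemma position_surj j r : r < n -> exists w, position j w = r.
Proof.
move=> lt_r; pose pos w := Ordinal (position_lt j w).
have pos_inj : injective pos by move=> y w [] /position_inj.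
by have /codomP[w [->]] := injF_onto pos_inj (Ordinal lt_r); exists w.
Qed.

End Blocks.

(** * Processors and tables *)

Lemma evaln_clamp (R : realDomainType) p n (S : state R p) i e :
  regn S i r_n = n -> evaln S i (clamp e) = minn (evaln S i e) n.
Proof. by rewrite /evaln /= => ->; lia. Qed.

Lemma modn_exp2S r t :
  r %% 2 ^ t.+1 = odd (r %/ 2 ^ t) * 2 ^ t + r %% 2 ^ t.
Proof.
rewrite {1}(divn_eq r (2 ^ t)) {1}(divn_eq (r %/ 2 ^ t) 2) mulnDl -addnA.
rewrite -mulnA -expnS modnMDl modn2 modn_small // expnS mul2n -addnn.
have := ltn_pmod r (expn_gt0 2 t : 0 < 2 ^ t).
by have := leq_b1 (odd (r %/ 2 ^ t)); nia.
Qed.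

Lemma iter_modn_exp2S (T : Type) (f : T -> T) r t (z : T) :
  iter (r %% 2 ^ t.+1) f z =
  if odd (r %/ 2 ^ t) then iter (2 ^ t) f (iter (r %% 2 ^ t) f z)
  else iter (r %% 2 ^ t) f z.
Proof.
by rewrite modn_exp2S; case: odd; rewrite ?mul1n ?mul0n // iterD.
Qed.

Lemma mul_add_lt (a c x z : nat) : x < a -> z < c -> x * c + z < a * c.
Proof. nia. Qed.

Lemma mul_add_inj d a b x y :
  x < d -> y < d -> a * d + x = b * d + y -> a = b /\ x = y.
Proof.
move=> lt_x lt_y eq_xy; have d_gt0 := leq_trans (ltn0Sn x) lt_x.
split.
  have := congr1 (divn^~ d) eq_xy.
  by rewrite /= !divnMDl // (divn_small lt_x) (divn_small lt_y) !addn0.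
by have := congr1 (modn^~ d) eq_xy; rewrite /= !modnMDl !modn_small.
Qed.

Lemma sub_divn m d : m - m %/ d * d = m %% d.
Proof. by rewrite {1}(divn_eq m d) addKn. Qed.

Lemma eq_nexpE (x y : nat) : (0 < 1 - (x < y) - (y < x)) = (x == y).
Proof. by case: (ltngtP x y). Qed.

Lemma key_lessE (R : realDomainType) (x y : \bar R) (a b : nat) :
  (if (x <= y)%E then if (y <= x)%E then (a < b : nat) else 1 else 0) =
  (((x, a) : key R) < (y, b))%O.
Proof.
rewrite ltEprodlexi /= ltEnat.
by case: (x <= y)%E => //=; case: (y <= x)%E.
Qed.

(* E gives the values of the registers that are set by setup. *)
Ltac evaluate E :=
  rewrite /evaln /evalw /load /cell /address /parity /= /upd /=
    ?E ?sub_divn ?eq_nexpE ?lt0b ?key_lessE ?lt0b.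

Section Preprocessing.
Variables (R : realDomainType) (n k : nat) (G : wdigraph R n).
Hypotheses (k_gt0 : 0 < k) (k_le_n : k <= n).
Local Notation p := (n * n * k.+1).
Local Notation Z := ((n + 2) * (n + 2) * (n + 2)).
Local Notation wp := (@wp R p Z (lg n)).
Local Notation ncell := (ncell Z).
Local Notation wcell := (wcell Z).
Local Notation kcell := (kcell Z).
Local Notation frame := (frame Z).
Implicit Types (S : state R p) (u v w y : 'I_n) (i : 'I_p).
Implicit Types (E M : 'I_n -> 'I_n -> key R).

Lemma n_gt0 : 0 < n. Proof. exact: leq_trans k_gt0 k_le_n. Qed.

Lemma prow_lt i : i %/ k.+1 %/ n < n.
Proof. by rewrite !ltn_divLR ?n_gt0. Qed.

Lemma pcol_lt i : i %/ k.+1 %% n < n.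
Proof. by rewrite ltn_mod n_gt0. Qed.

Lemma pslot_lt i : i %% k.+1 < k.+1.
Proof. by rewrite ltn_mod. Qed.

Definition prow i : 'I_n := Ordinal (prow_lt i).
Definition pcol i : 'I_n := Ordinal (pcol_lt i).
Definition pslot i : 'I_k.+1 := Ordinal (pslot_lt i).

Definition proc u w (x : 'I_k.+1) : 'I_p :=
  Ordinal (mul_add_lt (mul_add_lt (ltn_ord u) (ltn_ord w)) (ltn_ord x)).

Lemma prow_proc u w x : prow (proc u w x) = u.
Proof.
apply: val_inj; rewrite /= divnMDl // (divn_small (ltn_ord x)) addn0.
by rewrite divnMDl ?n_gt0 // (divn_small (ltn_ord w)) addn0.
Qed.

Lemma pcol_proc u w x : pcol (proc u w x) = w.
Proof.
apply: val_inj; rewrite /= divnMDl // (divn_small (ltn_ord x)) addn0.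
by rewrite modnMDl modn_small.
Qed.

Lemma pslot_proc u w x : pslot (proc u w x) = x.
Proof. by apply: val_inj; rewrite /= modnMDl modn_small. Qed.

Definition procE := (prow_proc, pcol_proc, pslot_proc).

Lemma procK i : proc (prow i) (pcol i) (pslot i) = i.
Proof. by apply: val_inj; rewrite /= -divn_eq -divn_eq. Qed.

Lemma proc_inj i i' :
  prow i = prow i' -> pcol i = pcol i' -> pslot i = pslot i' -> i = i'.
Proof. by move=> eq_u eq_w eq_x; rewrite -(procK i) eq_u eq_w eq_x procK. Qed.

Lemma cell_lt u x : x < n -> u * n + x < Z.
Proof.
by move=> lt_x; apply: (@ltn_trans (n * n)); [apply: mul_add_lt | nia].
Qed.

Lemma procs_lt : p < Z.
Proof. nia. Qed.

Lemma pid_lt i : i < Z.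
Proof. exact: ltn_trans (ltn_ord i) procs_lt. Qed.

Definition env_regs :=
  [:: r_pid; r_n; r_k; r_row; r_col; r_region; r_slot; r_slots; r_pow].

Definition env_reg i r :=
  nth 0 [:: val i; n; k; 0; 0; val (prow i); val (pcol i); Z; val (pslot i);
            k.+1; 2 ^ lg n] r.

Definition env S := forall i r, r \in env_regs -> regn S i r = env_reg i r.

Lemma envE S : env S ->
  (((forall i, regn S i r_pid = i) * (forall i, regn S i r_n = n) *
    (forall i, regn S i r_k = k) * (forall i, regn S i r_row = prow i) *
    (forall i, regn S i r_col = pcol i) * (forall i, regn S i r_region = Z) *
    (forall i, regn S i r_slot = pslot i) *
    (forall i, regn S i r_slots = k.+1) *
    (forall i, regn S i r_pow = (2 ^ lg n)%N)))%type.
Proof. by move=> env_S; do !split; move=> i; rewrite env_S. Qed.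

Lemma env_clamp S i e :
  env S -> evaln S i (clamp e) = minn (evaln S i e) n.
Proof. by move=> env_S; rewrite (@evaln_clamp _ _ n) // (envE env_S). Qed.

Lemma env_frame A S S' : env S -> frame A S S' ->
  all (fun r => ~~ A (NRegister r)) env_regs -> env S'.
Proof.
move=> env_S [eqn _ _ _] /allP not_A i r r_env.
by rewrite eqn ?env_S // not_A.
Qed.

Lemma env_setn S r f : r \notin env_regs -> env S -> env (setn S r f).
Proof.
move=> r_env env_S i x x_env; rewrite /= upd_neq ?env_S //.
by apply: contraNneq r_env => <-.
Qed.

Lemma env_setw S r f : env S -> env (setw S r f).
Proof. by []. Qed.

Lemma half_pow : 2 ^ lg n %/ 2 = 2 ^ (lg n).-1.
Proof. by rewrite expnS mulKn. Qed.

Lemma halving_ok r s S (I : nat -> state R p -> Prop) :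
  env S -> ~~ modifies s (NRegister r) ->
  (forall j S f, I j S -> I j (setn S r f)) -> I 0 S ->
  (forall j S, j < lg n -> (forall i, regn S i r = 2 ^ ((lg n).-1 - j)) ->
     I j S -> wp s (I j.+1) S) ->
  wp (halving r s) (I (lg n)) S.
Proof.
move=> env_S keeps_r I_setn I0 body.
have lg_pow : lg (2 ^ (lg n).-1) = lg n by rewrite /lg trunc_expnK.
have := @wp_halving _ _ _ (lg n) r ($r_pow / #2)%nexp s S (2 ^ (lg n).-1) I.
rewrite lg_pow; apply=> //; first by rewrite expn_gt0.
  by move=> i; rewrite /evaln /= (envE env_S) half_pow.
move=> j S' lt_j val_r; apply: body => // i; rewrite val_r.
rewrite -{1}(subnK (_ : j <= (lg n).-1)); last by rewrite -ltnS.
by rewrite expnD mulnK ?expn_gt0.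
Qed.

Lemma prowE i : prow i = i %/ k.+1 %/ n :> nat. Proof. by []. Qed.
Lemma pcolE i : pcol i = i %/ k.+1 %% n :> nat. Proof. by []. Qed.
Lemma pslotE i : pslot i = i %% k.+1 :> nat. Proof. by []. Qed.
Opaque prow pcol pslot.

Lemma setup_ok m : wp setup env (initial_state p [:: n; k] m).
Proof.
apply: (wp_setn (v := fun=> Z)) => //.
apply: (wp_setn (v := fun=> k.+1)) => [i|]; first by evaluate addn1.
apply: (wp_setn (v := fun i => prow i)) => [i|]; first by rewrite prowE.
apply: (wp_setn (v := fun i => pcol i)) => [i|].
  by evaluate prowE; rewrite pcolE.
apply: (wp_setn (v := fun i => pslot i)) => [i|].
  by evaluate pslotE.
apply: (wp_setn (v := fun=> 1)) => //.
pose I j S := forall i r, r \in env_regs ->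
  regn S i r = if r == r_pow then 2 ^ j else env_reg i r.
apply: (wp_seq (Q1 := I (lg n))) => [|S I_S _].
  apply: wp_halving => //; first exact: n_gt0.
  - move=> j S f I_S i r r_env; rewrite /= upd_neq ?I_S //.
    by apply: contraTneq r_env => ->.
  - move=> i r; rewrite !inE; do 8![case/orP => [/eqP-> //|]].
    by move=> /eqP->.
  - move=> j S lt_j _ I_S i r r_env; rewrite /= /upd; case: eqP => [_|].
      rewrite /evaln /= !(I_S i) //= expnS; have := lg_le n_gt0 lt_j.
      by rewrite /env_reg /=; lia.
    by move=> /eqP/negPf neq_r; rewrite I_S ?neq_r.
by move=> i r r_env; rewrite I_S //; case: eqP => // ->.
Qed.

Definition input_table S :=
  forall v w, wcell S q_io (v * n + w) = (edge_key G v w).1.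

Definition key_table E S := forall u w, kcell S q_key (u * n + w) = E u w.

Definition sorted_table E S :=
  forall u w, ncell S q_sorted (u * n + vrank (E u) w) = w.

Lemma input_table_frame A S S' :
  input_table S -> frame A S S' -> ~~ A (WRegion q_io) -> input_table S'.
Proof.
by move=> input_S [_ _ _ eqwc] keep v w; rewrite eqwc // cell_lt.
Qed.

Lemma key_table_frame A E S S' : key_table E S -> frame A S S' ->
  ~~ A (NRegion q_key) && ~~ A (WRegion q_key) -> key_table E S'.
Proof.
move=> keys_S [_ _ eqnc eqwc] /andP[keep_n keep_w] u w.
by rewrite -keys_S /kcell eqnc ?eqwc ?cell_lt.
Qed.

Lemma sorted_table_frame A E S S' : sorted_table E S -> frame A S S' ->
  ~~ A (NRegion q_sorted) -> sorted_table E S'.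
Proof.
move=> sorted_S [_ _ eqnc _] keep u w.
by rewrite eqnc // cell_lt ?vrank_lt.
Qed.

Lemma key_table_dist E S u w :
  key_table E S -> wcell S q_key (u * n + w) = (E u w).1.
Proof. by move=> <-. Qed.

Lemma key_table_hops E S u w :
  key_table E S -> ncell S q_key (u * n + w) = (E u w).2.
Proof. by move=> <-. Qed.

Definition at_slot0 i := pslot i < 1.

Lemma proc_slot0 i : at_slot0 i -> proc (prow i) (pcol i) ord0 = i.
Proof.
move=> slot0_i; apply: proc_inj; rewrite ?procE //.
by apply: val_inj => /=; move: slot0_i; rewrite /at_slot0 ltnS leqn0 => /eqP->.
Qed.

Lemma at_slot0_proc u w : at_slot0 (proc u w ord0).
Proof. by rewrite /at_slot0 pslot_proc. Qed.

Lemma addressing_cell S e (g : 'I_n -> 'I_n -> nat) : env S ->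
  (forall i, at_slot0 i -> evaln S i e = g (prow i) (pcol i)) ->
  (forall u w, g u w < n) -> (forall u, injective (g u)) ->
  addressing Z S slot0 (cell e) at_slot0
    (fun i => prow i * n + g (prow i) (pcol i)).
Proof.
move=> /envE E eval_e lt_g g_inj.
split=> [i|i|i slot0_i|i _|i i' slot0_i slot0_i'].
- by rewrite E.
- by evaluate E.
- by evaluate E; rewrite -eval_e.
- exact: cell_lt.
move=> /(mul_add_inj (lt_g _ _) (lt_g _ _))[/val_inj eq_u].
rewrite eq_u => /g_inj eq_w.
by rewrite -(proc_slot0 slot0_i) -(proc_slot0 slot0_i') eq_u eq_w.
Qed.

Lemma eval_col S i : env S -> at_slot0 i -> evaln S i $r_col = pcol i.
Proof. by move=> /envE E _; evaluate E. Qed.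

Lemma addressing_col S : env S ->
  addressing Z S slot0 (cell $r_col) at_slot0 (fun i => prow i * n + pcol i).
Proof.
move=> env_S; apply: (addressing_cell (g := fun=> @nat_of_ord n)) => //.
  by move=> i; apply: eval_col.
by move=> _; apply: val_inj.
Qed.

Lemma wp_putn_cell q e S (f : 'I_n -> 'I_n -> nat) : env S ->
  (forall i, at_slot0 i -> evaln S i e = f (prow i) (pcol i)) ->
  (forall u w, f u w <= n) ->
  wp (PutN slot0 q (cell $r_col) e)
    (fun S' => forall u w, ncell S' q (u * n + w) = f u w) S.
Proof.
move=> env_S eval_e le_f.
apply: (wp_mono _ (wp_putn _ q e (addressing_col env_S))) => S' [hit _] u w.
have := hit _ (at_slot0_proc u w); rewrite !procE => ->.
rewrite (env_clamp _ _ env_S) eval_e ?at_slot0_proc // !procE.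
exact/minn_idPl.
Qed.

Lemma wp_put_key_cell q e r S (f : 'I_n -> 'I_n -> key R) : env S ->
  (forall i, at_slot0 i -> evaln S i e = (f (prow i) (pcol i)).2) ->
  (forall i, at_slot0 i -> regw S i r = (f (prow i) (pcol i)).1) ->
  (forall u w, (f u w).2 <= n) ->
  wp (put_key slot0 q (cell $r_col) e r)
    (fun S' => forall u w, kcell S' q (u * n + w) = f u w) S.
Proof.
move=> env_S eval_e eval_r le_f.
apply: (wp_mono _ (wp_put_key _ q e r (addressing_col env_S) _ _)) => //.
move=> S' [hit _] u w; have := hit _ (at_slot0_proc u w); rewrite !procE => ->.
rewrite (env_clamp _ _ env_S) eval_e ?eval_r ?at_slot0_proc // !procE.
by rewrite (minn_idPl (le_f u w)); case: (f u w).
Qed.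

Lemma addressing_pid S c cd : env S -> (forall i, (0 < evaln S i c) = cd i) ->
  addressing Z S c $r_pid cd (@nat_of_ord p).
Proof.
move=> /envE E cd_S; split=> // [i|i _|i _|i i' _ _ /val_inj //].
- by rewrite E.
- by evaluate E.
exact: pid_lt.
Qed.

Lemma stored_pid V cd (val : 'I_p -> V) f f' i :
  stored Z cd (@nat_of_ord p) val f f' -> f' i = if cd i then val i else f i.
Proof.
move=> [hit miss]; case: ifP => [|not_cd]; first exact: hit.
apply: miss => [|i' cd_i' /val_inj eq_i]; first exact: pid_lt.
by rewrite eq_i not_cd in cd_i'.
Qed.

Lemma wp_putn_pid c q e S cd val : env S ->
  (forall i, (0 < evaln S i c) = cd i) ->
  (forall i, cd i -> evaln S i e = val i) -> (forall i, cd i -> val i <= n) ->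
  wp (PutN c q $r_pid e)
    (fun S' => forall i, ncell S' q i = if cd i then val i else ncell S q i) S.
Proof.
move=> env_S cd_S eval_e le_val.
apply: (wp_mono _ (wp_putn _ q e (addressing_pid env_S cd_S))).
move=> S' stored_S' i; rewrite (stored_pid i stored_S'); case: ifP => // cd_i.
by rewrite (env_clamp _ _ env_S) eval_e // (minn_idPl (le_val i cd_i)).
Qed.

Lemma wp_put_key_pid c q e r S cd (val : 'I_p -> key R) : env S ->
  (forall i, (0 < evaln S i c) = cd i) -> store_free R c ->
  (forall i, cd i -> evaln S i e = (val i).2) ->
  (forall i, cd i -> regw S i r = (val i).1) ->
  (forall i, cd i -> (val i).2 <= n) ->
  wp (put_key c q $r_pid e r)
    (fun S' => forall i, kcell S' q i = if cd i then val i else kcell S q i) S.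
Proof.
move=> env_S cd_S free_c eval_e eval_r le_val.
have addr := addressing_pid env_S cd_S.
apply: (wp_mono _ (wp_put_key _ q e r addr free_c _)) => //.
move=> S' stored_S' i; rewrite (stored_pid i stored_S'); case: ifP => // cd_i.
rewrite (env_clamp _ _ env_S) eval_e ?eval_r //.
by rewrite (minn_idPl (le_val i cd_i)); case: (val i).
Qed.

Lemma init_keys_ok S : env S -> input_table S ->
  wp init_keys (key_table (init_key G)) S.
Proof.
move=> env_S input_S; have E := envE env_S.
apply: (wp_setw (v := fun i => (edge_key G (prow i) (pcol i)).1)) => [i|].
  by rewrite -input_S; evaluate E.
apply: (wp_setw (v := fun=> +oo%E)) => //.
apply: (wp_setw (v := fun=> 0%E)) => //.
apply: (wp_setn (v := fun i => (init_key G (prow i) (pcol i)).2)) => [i|].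
  evaluate E; rewrite /init_key /edge_key (inj_eq val_inj) /=.
  by case: eqP => // _; case: (edge _ _ _) => //=; rewrite lexx.
apply: (wp_setw (v := fun i => (init_key G (prow i) (pcol i)).1)) => [i|].
  evaluate E; rewrite /init_key /edge_key (inj_eq val_inj) /=.
  by case: eqP => // _; case: (edge _ _ _).
set S1 := setw _ _ _; have env_S1 : env S1 by apply/env_setw/env_setn.
apply: (wp_frame (wp_put_key_cell (f := init_key G) _ env_S1 _ _ _)) => //.
by case: (approximates_init G k).
Qed.

Definition sorting E j S :=
  [/\ env S, key_table E S,
      forall u w, ncell S q_rank (u * n + w) = block_rank (E u) j w
    & forall u w, ncell S q_sorted (u * n + position (E u) j w) = w].

Definition sibling_start j i := sibling (pcol i %/ 2 ^ j) * 2 ^ j.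

Definition sibling_block j i := block n j (sibling (pcol i %/ 2 ^ j)).

Definition sibling_count E j i := sibling_rank (E (prow i)) j (pcol i).

Definition merge_regs E j S := forall i,
  [/\ regn S i r_len = 2 ^ j, regn S i r_block = pcol i %/ 2 ^ j,
      regn S i r_start = sibling_start j i,
      regn S i r_card = #|sibling_block j i|
    & (regw S i w_dist, regn S i r_name) =
      named_key (E (prow i)) (pcol i)].

Lemma sorting_setn E j S r f :
  r \notin env_regs -> sorting E j S -> sorting E j (setn S r f).
Proof. by move=> r_env [env_S ? ? ?]; split=> //; apply: env_setn. Qed.

Lemma sorting_setw E j S r f : sorting E j S -> sorting E j (setw S r f).
Proof. by case. Qed.

Lemma sorting_frame A E j S S' : sorting E j S -> frame A S S' ->
  all (fun r => ~~ A (NRegister r)) env_regs ->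
  [&& ~~ A (NRegion q_key), ~~ A (WRegion q_key), ~~ A (NRegion q_rank)
    & ~~ A (NRegion q_sorted)] -> sorting E j S'.
Proof.
move=> [env_S keys_S rank_S sorted_S] frame_S keep_env.
case/and4P=> keep_n keep_w keep_rank keep_sorted.
have [_ _ eqnc _] := frame_S; split.
- exact: env_frame frame_S keep_env.
- by apply: key_table_frame frame_S _; rewrite ?keep_n.
- by move=> u w; rewrite eqnc ?cell_lt.
by move=> u w; rewrite eqnc // cell_lt ?position_lt.
Qed.

Lemma merge_regs_frame A E j S S' : merge_regs E j S -> frame A S S' ->
  all (fun r => ~~ A (NRegister r))
    [:: r_len; r_block; r_start; r_card; r_name] ->
  ~~ A (WRegister w_dist) -> merge_regs E j S'.
Proof.
move=> merge_S [eqn eqw _ _] /and5P[? ? ? ? /andP[? _]] ? i.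
by rewrite !eqn ?eqw.
Qed.

Lemma merge_setup_ok E j S : j < lg n -> sorting E j S ->
  (forall i, regn S i r_phase = 2 ^ ((lg n).-1 - j)) ->
  wp merge_setup (fun S' => [/\ sorting E j S', merge_regs E j S'
                             & forall i, regn S' i r_count = 0]) S.
Proof.
move=> lt_j sorting_S phase_S; have [env_S keys_S _ _] := sorting_S.
have E_S := envE env_S; have pow_gt0 m : 0 < 2 ^ m by rewrite expn_gt0.
apply: (wp_setn (v := fun=> 2 ^ j)) => [i|].
  evaluate E_S; rewrite phase_S.
  have -> : 2 ^ lg n = 2 ^ j.+1 * 2 ^ ((lg n).-1 - j).
    by rewrite -expnD; congr (2 ^ _); lia.
  by rewrite mulnK // expnSr mulnK.
apply: (wp_setn (v := fun i => pcol i %/ 2 ^ j)) => [i|]; first by evaluate E_S.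
apply: (wp_setn (v := sibling_start j)) => [i|].
  evaluate E_S; rewrite modn2 lt0b /sibling_start /sibling.
  by case: ifP; rewrite ?addn1 ?subn1.
apply: (wp_setn (v := fun i => #|sibling_block j i|)) => [i|].
  by evaluate E_S; rewrite card_block /sibling_start; lia.
apply: (wp_setn (v := fun=> 0)) => //.
apply: (wp_setw (v := fun i => (E (prow i) (pcol i)).1)) => [i|].
  by evaluate E_S; apply: key_table_dist.
apply: (wp_setn (v := fun i => (named_key (E (prow i)) (pcol i)).2)) => [i|].
  by rewrite /= -(key_table_hops _ _ keys_S); evaluate E_S.
split=> //.
apply: sorting_setn => //; apply: sorting_setw.
by do 5!apply: sorting_setn => //.
Qed.

Lemma probe_test E j S i a : sorting E j S -> 0 < a ->
  let y := ncell S q_sorted (prow i * n + (sibling_start j i + (a - 1))) in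
  (a <= sibling_count E j i) = (a <= #|sibling_block j i|) &&
    (((wcell S q_key (prow i * n + y), ncell S q_key (prow i * n + y) * n + y)
       : key R) < named_key (E (prow i)) (pcol i))%O.
Proof.
move=> [_ keys_S _ sorted_S] a_gt0 /=.
have [le_a|lt_a] /= := leqP a #|sibling_block j i|; last first.
  apply/negbTE; rewrite -ltnNge.
  exact: leq_ltn_trans (rank_le_card _ _ _) lt_a.
have lt_n : sibling_start j i + (a - 1) < n.
  by move: le_a; rewrite card_block /sibling_start; lia.
have [y pos_y] := position_surj (E (prow i)) j lt_n.
rewrite -{1}pos_y sorted_S -pos_y sorted_S.
rewrite (key_table_dist _ _ keys_S) (key_table_hops _ _ keys_S).
rewrite -/(named_key (E (prow i)) y) -(leq_sibling_rank a_gt0 le_a) //.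
by rewrite pos_y subn1.
Qed.

Definition searching E j t S :=
  [/\ sorting E j S, merge_regs E j S & forall i (a := regn S i r_count),
        a <= sibling_count E j i < a + 2 ^ (lg n - t)].

Lemma sibling_count_le E j i : sibling_count E j i <= n.
Proof.
apply: leq_trans (rank_le_card _ _ _) _.
by rewrite -[n in _ <= n]card_ord max_card.
Qed.

Lemma search_step_ok E j t S : t < lg n ->
  (forall i, regn S i r_probe = 2 ^ ((lg n).-1 - t)) -> searching E j t S ->
  wp search_step (searching E j t.+1) S.
Proof.
move=> lt_t probe_S [sorting_S merge_S count_S].
have [env_S _ _ _] := sorting_S; have E_S := envE env_S.
pose a i := regn S i r_count + 2 ^ ((lg n).-1 - t).
pose y i := ncell S q_sorted (prow i * n + (sibling_start j i + (a i - 1))).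
have a_gt0 i : 0 < a i by rewrite /a addn_gt0 expn_gt0 orbT.
apply: (wp_setn (v := y)) => [i|].
  by evaluate E_S; have [_ _ -> _ _] := merge_S i; rewrite probe_S.
apply: (wp_setw (v := fun i => wcell S q_key (prow i * n + y i))) => [i|].
  by evaluate E_S.
pose probed i := ncell S q_key (prow i * n + y i) * n + y i.
apply: (wp_setn (v := probed)) => [i|]; first by evaluate E_S.
pose count i := if a i <= sibling_count E j i then a i else regn S i r_count.
apply: (wp_setn (v := count)) => [i|].
  have [_ _ _ card_S name_S] := merge_S i.
  have := probe_test i sorting_S (a_gt0 i).
  rewrite /count /= -/(y i) => ->; rewrite -name_S -card_S; evaluate E_S.
  rewrite probe_S -/(a i); case: (ltnP (regn S i r_card)) => //= le_a.
  rewrite lt0b; case: ifP => // _.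
  by move: le_a; rewrite card_S card_block; lia.
split.
- by apply: sorting_setn => //; apply: sorting_setn => //;
    apply: sorting_setw; apply: sorting_setn.
- by [].
move=> i; rewrite /= upd_eq /count; have := count_S i.
have -> : lg n - t = ((lg n).-1 - t).+1 by lia.
have -> : lg n - t.+1 = (lg n).-1 - t by lia.
by rewrite expnS; case: (leqP (a i)); rewrite /a; lia.
Qed.

Lemma search_ok E j S : sorting E j S -> merge_regs E j S ->
  (forall i, regn S i r_count = 0) ->
  wp (halving r_probe search_step)
    (fun S' => forall i, regn S' i r_count = sibling_count E j i) S.
Proof.
move=> sorting_S merge_S count_S; have [env_S _ _ _] := sorting_S.
apply: (wp_mono (Q := searching E j (lg n))).
  move=> S' [_ _ count_S'] i; have := count_S' i.
  by rewrite subnn; lia.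
apply: halving_ok => //.
- by move=> t S' f [? ? ?]; split=> //; apply: sorting_setn.
- split=> // i; rewrite count_S subn0.
  exact: leq_ltn_trans (sibling_count_le E j i) (lg_gt n).
by move=> t S' lt_t probe_S' searching_S'; apply: search_step_ok.
Qed.

Lemma merge_store_ok E j S : sorting E j S -> merge_regs E j S ->
  (forall i, regn S i r_count = sibling_count E j i) ->
  wp merge_store (sorting E j.+1) S.
Proof.
move=> sorting_S merge_S count_S; have [env_S keys_S rank_S _] := sorting_S.
have E_S := envE env_S.
apply: (wp_setn (v := fun i => block_rank (E (prow i)) j.+1 (pcol i))) => [i|].
  by evaluate E_S; rewrite -[nmem _ _]/(ncell _ _ _) rank_S count_S block_rankS.
set S1 := setn _ _ _; have env_S1 : env S1 by apply: env_setn.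
pose rank_u u w := block_rank (E u) j.+1 w.
have rank_le u w : rank_u u w <= n.
  apply: leq_trans (ltnW (position_lt (E u) j.+1 w)); exact: leq_addl.
apply: (wp_seq (wp_putn_cell q_rank (f := rank_u) env_S1 _ _)) => //.
move=> S2 rank_S2 frame2; have env_S2 := env_frame env_S1 frame2 isT.
have [regn_S2 _ _ _] := frame2; have E2 := envE env_S2.
pose e := ($r_block / #2 * (#2 * $r_len) + $r_rank)%nexp.
have eval_e i : at_slot0 i ->
    evaln S2 i e = position (E (prow i)) j.+1 (pcol i).
  move=> _; evaluate E2; rewrite !regn_S2 // /S1 /= /upd /=.
  have [-> -> _ _ _] := merge_S i.
  by rewrite /position -divnMA -expnSr -expnS.
have addr := addressing_cell env_S2 eval_e
  (fun u => position_lt (E u) j.+1) (fun u => @position_inj _ _ (E u) j.+1).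
apply: (wp_seq (wp_putn _ q_sorted $r_col addr)) => S3 [hit _] frame3.
have [_ _ eqnc _] := frame3; split.
- exact: env_frame frame3 isT.
- apply: key_table_frame frame3 isT; exact: key_table_frame frame2 isT.
- by move=> u w; rewrite eqnc ?cell_lt.
move=> u w; have := hit _ (at_slot0_proc u w); rewrite !procE => ->.
rewrite env_clamp // (eval_col _ (at_slot0_proc u w)) // procE.
exact/minn_idPl/ltnW.
Qed.

Lemma merge_ok E j S : j < lg n -> sorting E j S ->
  (forall i, regn S i r_phase = 2 ^ ((lg n).-1 - j)) ->
  wp merge (sorting E j.+1) S.
Proof.
move=> lt_j sorting_S phase_S.
apply: (wp_seq (merge_setup_ok lt_j sorting_S phase_S)).
move=> S1 [sorting_S1 merge_S1 count_S1] _.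
apply: (wp_seq (search_ok sorting_S1 merge_S1 count_S1)) => S2 count_S2 frame2.
apply: (wp_seq (Q1 := sorting E j.+1)) => //.
apply: merge_store_ok count_S2.
  exact: sorting_frame frame2 isT isT.
exact: merge_regs_frame frame2 isT isT.
Qed.

Lemma sort_rows_ok E S : env S -> key_table E S ->
  wp sort_rows (fun S' => sorted_table E S') S.
Proof.
move=> env_S keys_S.
apply: (wp_seq (wp_putn_cell q_rank (f := fun=> fun=> 0) env_S _ _)) => //.
move=> S1 rank_S1 frame1; have env_S1 := env_frame env_S frame1 isT.
have keys_S1 := key_table_frame keys_S frame1 isT.
apply: (wp_seq (wp_putn_cell q_sorted (f := fun=> @nat_of_ord n) env_S1 _ _)).
- by move=> i; apply: eval_col.
- by move=> u w; apply: ltnW.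
move=> S2 sorted_S2 frame2; have env_S2 := env_frame env_S1 frame2 isT.
have keys_S2 := key_table_frame keys_S1 frame2 isT.
apply: (wp_seq (Q1 := sorting E (lg n))) => [|S' [_ _ _ sorted_S'] _].
  apply: halving_ok => //.
  - by move=> j S' f; apply: sorting_setn.
  - split=> // u w; last by rewrite position0 sorted_S2.
    have [_ _ eqnc _] := frame2.
    by rewrite block_rank0 eqnc ?rank_S1 ?cell_lt.
  by move=> j S' lt_j phase_S' sorting_S'; apply: merge_ok.
move=> u w; rewrite -(position_vrank _ _ (ltnW (lg_gt n))).
exact: sorted_S'.
Qed.

Definition candidate S (a : nat) : key R * nat :=
  (kcell S q_cand a, ncell S q_middle a).

Definition better m S i : bool :=
  (pslot i + m < k.+1) && ((candidate S (i + m)).1 < (candidate S i).1)%O.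

Definition same_cell i i' := prow i' = prow i /\ pcol i' = pcol i.

Lemma same_cell_shift i m : pslot i + m < k.+1 ->
  exists i', [/\ same_cell i i', pslot i' = pslot i + m :> nat
               & i + m = i' :> nat].
Proof.
move=> lt_m; exists (proc (prow i) (pcol i) (Ordinal lt_m)).
by rewrite /same_cell !procE; split=> //=; rewrite -{1}(procK i) /= addnA.
Qed.

Lemma keep_better_ok m S : env S -> (forall i, regn S i r_phase = m) ->
  (forall i, (kcell S q_cand i).2 <= n /\ ncell S q_middle i <= n) ->
  wp keep_better (fun S' => env S' /\ forall i : 'I_p,
    candidate S' i = candidate S (if better m S i then i + m else i)) S.
Proof.
move=> env_S phase_S bounded_S; have E := envE env_S.
pose there i := candidate S (i + m).
apply: (wp_setw (v := fun i => (candidate S i).1.1)) => [i|].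
  by evaluate E.
apply: (wp_setw (v := fun i => (there i).1.1)) => [i|].
  by evaluate E; rewrite phase_S.
apply: (wp_setn (v := fun i => (candidate S i).1.2)) => [i|].
  by evaluate E.
apply: (wp_setn (v := fun i => (there i).1.2)) => [i|].
  by evaluate E; rewrite phase_S.
apply: (wp_setn (v := fun i => (there i).2)) => [i|].
  by evaluate E; rewrite phase_S.
apply: (wp_setn (v := better m S)) => [i|].
  by evaluate E; rewrite phase_S /better; case: (_ < k.+1).
set S1 := setn _ _ _.
have env_S1 : env S1 by do 4!apply: env_setn => //.
have better_le i : better m S i -> (there i).1.2 <= n /\ (there i).2 <= n.
  case/andP=> /same_cell_shift[i' [_ _ eq_i']] _; rewrite /there eq_i'.
  exact: bounded_S.
have eval_better S' i : regn S' i r_better = better m S i ->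
    (0 < evaln S' i $r_better) = better m S i.
  by rewrite /evaln /= => ->; rewrite lt0b.
apply: (wp_seq (wp_put_key_pid (cd := better m S) (val := fun i => (there i).1)
                  _ env_S1 _ _ _ _ _)) => //.
- by move=> i; apply: eval_better.
- by move=> i /better_le[].
move=> S2 key_S2 frame2; have env_S2 := env_frame env_S1 frame2 isT.
have [regn2 _ ncell2 _] := frame2.
apply: (wp_seq (wp_putn_pid (cd := better m S) (val := fun i => (there i).2)
                  _ env_S2 _ _ _)).
- by move=> i; apply: eval_better; rewrite regn2.
- by move=> i _; rewrite /evaln /= regn2.
- by move=> i /better_le[].
move=> S3 middle_S3 frame3; split; first exact: env_frame frame3 isT.
have [_ _ ncell3 wcell3] := frame3; move=> i.
rewrite /candidate /kcell ncell3 ?wcell3 ?pid_lt // -/(kcell S2 q_cand i).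
by rewrite key_S2 middle_S3 ncell2 ?pid_lt //; case: ifP.
Qed.

Section Minimize.
Variable c : 'I_p -> key R * 'I_n.
Hypothesis c_hops : forall i, (c i).1.2 <= n.

(* After t rounds, the candidates of a cell that are still in use are those of
   the slots below 2 ^ (lg n - t). *)
Definition reducing t S := [/\ env S,
  forall i, exists2 i', same_cell i i' &
    candidate S i = ((c i').1, val (c i').2)
  & forall i, exists i', [/\ same_cell i i', pslot i' < 2 ^ (lg n - t)
                            & ((candidate S i').1 <= (c i).1)%O]].

Lemma reducing_step t S S' (m := 2 ^ ((lg n).-1 - t)) :
  t < lg n -> reducing t S -> env S' ->
  (forall i : 'I_p,
     candidate S' i = candidate S (if better m S i then i + m else i)) ->
  reducing t.+1 S'.
Proof.
move=> lt_t [env_S from_c below_c] env_S' cand_S'; split=> // i.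
  rewrite cand_S'; case: ifP => //.
  move=> /andP[/same_cell_shift[i1 [[eq_u eq_w] _ ->]] _].
  have [i2 [eq_u2 eq_w2] ->] := from_c i1.
  by exists i2; rewrite // /same_cell eq_u2 eq_w2 eq_u eq_w.
have cand_le (i1 : 'I_p) : ((candidate S' i1).1 <= (candidate S i1).1)%O.
  by rewrite cand_S'; case: ifP => // /andP[_ /ltW].
have [i1 [[eq_u eq_w] lt_i1 le_i1]] := below_c i.
have -> : lg n - t.+1 = (lg n).-1 - t by lia.
have eq_m : 2 ^ (lg n - t) = m + m.
  have -> : lg n - t = ((lg n).-1 - t).+1 by lia.
  by rewrite expnS mul2n addnn.
rewrite eq_m -/m in lt_i1 *; have [lt_m|le_m] := ltnP (pslot i1) m.
  by exists i1; split=> //; apply: le_trans le_i1.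
have lt_slot : pslot i1 - m < k.+1 by have := ltn_ord (pslot i1); lia.
pose i2 := proc (prow i1) (pcol i1) (Ordinal lt_slot).
have slot_i2 : pslot i2 + m = pslot i1 by rewrite procE /= subnK.
have eq_i1 : i2 + m = i1.
  have [|i3 [[eq_u3 eq_w3] eq_x3 ->]] := @same_cell_shift i2 m.
    by rewrite slot_i2.
  congr val; apply: proc_inj; rewrite ?eq_u3 ?eq_w3 ?procE //.
  by apply: val_inj; rewrite /= eq_x3.
exists i2; split; [by rewrite /same_cell !procE | by lia |].
apply: le_trans le_i1; rewrite cand_S' /better slot_i2 ltn_ord eq_i1 /=.
by case: (ltP (candidate S i1).1).
Qed.

Lemma minimize_slots_ok S : env S ->
  (forall i, candidate S i = ((c i).1, val (c i).2)) ->
  wp (halving r_phase keep_better) (reducing (lg n)) S.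
Proof.
move=> env_S cand_S; apply: halving_ok => //.
- by move=> t S' f [? ? ?]; split=> //; apply: env_setn.
- split=> // i; exists i; rewrite ?cand_S // subn0; split=> //.
  apply: leq_trans (ltn_ord _) _; exact: leq_ltn_trans k_le_n (lg_gt n).
move=> t S' lt_t phase_S' red_S'; have [env_S' from_c _] := red_S'.
have bounded i : (kcell S' q_cand i).2 <= n /\ ncell S' q_middle i <= n.
  by have [i' _ [-> ->]] := from_c i; split; [apply: c_hops | apply: ltnW].
apply: (wp_mono _ (keep_better_ok env_S' phase_S' bounded)).
by move=> S2 [env_S2 cand_S2]; apply: reducing_step cand_S2.
Qed.

Lemma reducing_end S u w : reducing (lg n) S -> exists i : 'I_p,
  [/\ prow i = u /\ pcol i = w,
      candidate S (proc u w ord0) = ((c i).1, val (c i).2)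
    & forall x, ((c i).1 <= (c (proc u w x)).1)%O].
Proof.
move=> [_ from_c below_c].
have [i [eq_u eq_w] cand_S] := from_c (proc u w ord0).
rewrite !procE in eq_u eq_w; exists i; split=> // x.
have [i' [[eq_u' eq_w'] slot_i' le_i']] := below_c (proc u w x).
rewrite !procE in eq_u' eq_w'; rewrite subnn in slot_i'.
by move: le_i'; rewrite -(proc_slot0 slot_i') eq_u' eq_w' cand_S.
Qed.

End Minimize.

Definition middle E i :=
  at_rank (E (prow i)) (prow i) (minn (pslot i) n.-1).

Lemma vrank_middle E i : vrank (E (prow i)) (middle E i) = minn (pslot i) n.-1.
Proof. by rewrite at_rankK //; have := n_gt0; lia. Qed.

Lemma middle_proc E u w v (lt_v : vrank (E u) v < k.+1) :
  middle E (proc u w (Ordinal lt_v)) = v.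
Proof.
apply: (@vrank_inj _ _ (E u)); rewrite -{1}(prow_proc u w (Ordinal lt_v)).
by rewrite vrank_middle procE /=; have := vrank_lt (E u) v; lia.
Qed.

Definition candidate_through E M i : key R * 'I_n :=
  (join n (E (prow i) (middle E i)) (M (middle E i) (pcol i)), middle E i).

Lemma fetch_candidates_ok q hops E M S :
  env S -> key_table E S -> sorted_table E S ->
  (forall v w, wcell S q (v * n + w) = (M v w).1) ->
  (forall S' i v, env S' -> ram S' = ram S -> regn S' i r_vertex = v ->
     evaln S' i hops = (M v (pcol i)).2) ->
  wp (fetch_candidates q hops) (fun S' => env S' /\ forall i,
    candidate S' i = ((candidate_through E M i).1, val (middle E i))) S.
Proof.
move=> env_S keys_S sorted_S dist_S hops_S; have Ev := envE env_S.
pose E_left i := E (prow i) (middle E i).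
apply: (wp_setn (v := fun i => middle E i)) => [i|].
  evaluate Ev; rewrite -[RHS](sorted_S (prow i)) vrank_middle.
  by congr (nmem _ (_ + (_ + _))); lia.
apply: (wp_setw (v := fun i => (E_left i).1)) => [i|].
  by rewrite -(key_table_dist _ _ keys_S); evaluate Ev.
apply: (wp_setw (v := fun i => (M (middle E i) (pcol i)).1)) => [i|].
  by rewrite -dist_S; evaluate Ev.
apply: (wp_setw (v := fun i => (candidate_through E M i).1.1)) => [i|].
  by evaluate Ev.
set S1 := setw _ _ _.
have env_S1 : env S1 by do !apply: env_setw; apply: env_setn.
apply: (wp_setn (v := fun i => (candidate_through E M i).1.2)) => [i|].
  have := hops_S S1 i (middle E i) env_S1 erefl erefl.
  have := key_table_hops (prow i) (middle E i) keys_S.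
  evaluate Ev; rewrite /ncell => -> ->; lia.
set S2 := setn _ _ _; have env_S2 : env S2 by apply: env_setn.
apply: (wp_seq (wp_put_key_pid (cd := xpredT)
  (val := fun i => (candidate_through E M i).1) _ env_S2 _ _ _ _ _)) => //.
  by move=> i _; apply: join_hops_le.
move=> S3 key_S3 frame3; have env_S3 := env_frame env_S2 frame3 isT.
have [regn3 _ _ _] := frame3.
apply: (wp_seq (wp_putn_pid (cd := xpredT)
  (val := fun i => nat_of_ord (middle E i)) _ env_S3 _ _ _)) => //.
- by move=> i _; rewrite /evaln /= regn3.
- by move=> i _; apply: ltnW.
move=> S4 middle_S4 frame4; split; first exact: env_frame frame4 isT.
have [_ _ ncell4 wcell4] := frame4; move=> i.
by rewrite /candidate /kcell ncell4 ?wcell4 ?pid_lt // middle_S4 -key_S3.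
Qed.

Definition minimized E M S := forall u w, exists2 v,
  best_middle k (E u) (M^~ w) v &
  candidate S (proc u w ord0) = (join n (E u v) (M v w), val v).

Lemma minimize_ok q hops E M S :
  env S -> key_table E S -> sorted_table E S ->
  (forall v w, wcell S q (v * n + w) = (M v w).1) ->
  (forall S' i v, env S' -> ram S' = ram S -> regn S' i r_vertex = v ->
     evaln S' i hops = (M v (pcol i)).2) ->
  wp (minimize q hops) (minimized E M) S.
Proof.
move=> env_S keys_S sorted_S dist_S hops_S.
apply: (wp_seq (fetch_candidates_ok env_S keys_S sorted_S dist_S hops_S)).
move=> S1 [env_S1 cand_S1] _; pose c := candidate_through E M.
have c_hops i : (c i).1.2 <= n by apply: join_hops_le.
apply: (wp_seq (minimize_slots_ok (c := c) c_hops env_S1 cand_S1)).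
move=> S2 red_S2 _ u w.
have [i [[eq_u eq_w] cand_S2 min_i]] := reducing_end u w red_S2.
rewrite -eq_u -eq_w in cand_S2 min_i *.
exists (middle E i) => // y le_y.
have lt_y : vrank (E (prow i)) y < k.+1 by [].
have := min_i (Ordinal lt_y).
by rewrite /c /candidate_through !procE middle_proc.
Qed.

Lemma square_ok h E S : env S -> key_table E S -> approximates G k h E ->
  wp square (fun S' =>
    exists2 E', key_table E' S' & approximates G k (h + h) E') S.
Proof.
move=> env_S keys_S approx_E.
apply: (wp_seq (sort_rows_ok env_S keys_S)) => S1 sorted_S1 frame1.
have env_S1 := env_frame env_S frame1 isT.
have keys_S1 := key_table_frame keys_S frame1 isT.
apply: (wp_seq (minimize_ok (q := q_key) (M := E)
  env_S1 keys_S1 sorted_S1 _ _)).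
- by move=> v w; apply: key_table_dist.
- move=> S' i v env_S' eq_ram vertex_S'; have Ev := envE env_S'.
  rewrite -(key_table_hops _ _ keys_S1).
  by evaluate Ev; rewrite vertex_S' eq_ram.
move=> S2 min_S2 frame2; have env_S2 := env_frame env_S1 frame2 isT.
have Ev := envE env_S2; pose E' u w := kcell S2 q_cand (proc u w ord0).
have E'P u w : exists2 v, best_middle k (E u) (E^~ w) v &
    E' u w = join n (E u v) (E v w).
  by have [v best_v [dist_v hops_v _]] := min_S2 u w; exists v;
    rewrite // /E' /kcell dist_v hops_v.
apply: (wp_setw (v := fun i => (kcell S2 q_cand i).1)) => [i|].
  by evaluate Ev.
apply: (wp_seq (wp_put_key_cell (f := E') _ _ _ _ _)) => //.
- move=> i /proc_slot0 slot0_i; rewrite /E' slot0_i.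
  by evaluate Ev.
- by move=> i /proc_slot0 slot0_i; rewrite /E' slot0_i.
- by move=> u w; have [v _ ->] := E'P u w; apply: join_hops_le.
move=> S3 key_S3 _; exists E' => //.
exact: approximates_double approx_E E'P.
Qed.

Lemma find_predecessors_ok E S :
  env S -> key_table E S -> sorted_table E S -> input_table S ->
  (forall u, agree_up_to k (min_key G u) (E u)) ->
  wp find_predecessors (fun S' => exists2 pred : 'I_n -> 'I_n -> 'I_n,
    forall u, predecessor_table G k u (pred u) &
    forall u w, ncell S' q_pred (u * n + w) = pred u w) S.
Proof.
move=> env_S keys_S sorted_S input_S agree_E.
apply: (wp_seq (minimize_ok (q := q_io) (M := edge_key G) env_S keys_S sorted_S
                  input_S _)) => //.
move=> S1 min_S1 frame1; have env_S1 := env_frame env_S frame1 isT.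
have Ev := envE env_S1.
pose is_best x v := best_middle k (E x.1) (edge_key G ^~ x.2) v /\
  ncell S1 q_middle (proc x.1 x.2 ord0) = v.
have [pred predP] :
    exists pred : 'I_n * 'I_n -> 'I_n, forall x, is_best x (pred x).
  apply: fin_all_exists => -[u w]; have [v best_v [_ _ middle_v]] := min_S1 u w.
  by exists v.
apply: (wp_seq (wp_putn_cell q_pred (f := fun u w => pred (u, w)) env_S1 _ _)).
- move=> i slot0_i; have [_ <-] := predP (prow i, pcol i).
  by rewrite [proc _ _ _]proc_slot0 //; evaluate Ev.
- by move=> u w; apply: ltnW.
move=> S2 pred_S2 _; exists (fun u w => pred (u, w)) => // u w le_w uw neq_uw.
have [best_v _] := predP (u, w).
exact: best_middle_predecessor (agree_E u) best_v le_w uw neq_uw.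
Qed.

Section Tracing.
Variables (pred : 'I_n -> 'I_n -> 'I_n) (steps : 'I_p -> nat).

Definition tracing t S := [/\ env S,
  forall u w, ncell S q_pred (u * n + w) = iter (2 ^ t) (pred u) w,
  forall i, regn S i r_vertex =
    iter (steps i %% 2 ^ t) (pred (prow i)) (pcol i)
  & forall i, regn S i r_steps = steps i %/ 2 ^ t].

Lemma jump_ok t S : tracing t S -> wp jump (tracing t.+1) S.
Proof.
move=> [env_S pred_S vertex_S steps_S]; have E := envE env_S.
pose vertex i := iter (steps i %% 2 ^ t.+1) (pred (prow i)) (pcol i).
apply: (wp_setn (v := vertex)) => [i|].
  evaluate E; rewrite steps_S vertex_S modn2 lt0b /vertex iter_modn_exp2S.
  by case: ifP => // _; apply: pred_S.
apply: (wp_setn (v := fun i => steps i %/ 2 ^ t.+1)) => [i|].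
  by evaluate E; rewrite steps_S -divnMA -expnSr.
set S1 := setn _ _ _; have env_S1 : env S1 by do 2!apply: env_setn => //.
apply: (wp_seq (wp_putn_cell q_pred (f := fun u w => iter (2 ^ t.+1) (pred u) w)
                  env_S1 _ _)).
- move=> i _; have jump_once u w := pred_S u w; rewrite /ncell in jump_once.
  by evaluate E; rewrite !jump_once -iterD addnn -mul2n -expnS.
- by move=> u w; apply: ltnW.
move=> S2 pred_S2 frame2; have [regn2 _ _ _] := frame2.
split=> // [|i|i]; [exact: env_frame frame2 isT | |]; by rewrite regn2.
Qed.

Lemma tracing_loop_ok S : tracing 0 S ->
  wp (halving r_phase jump) (tracing (lg n)) S.
Proof.
move=> tracing_S; have [env_S _ _ _] := tracing_S; apply: halving_ok => //.
  by move=> t S' f [? ? ? ?]; split=> //; apply: env_setn.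
by move=> t S' _ _; apply: jump_ok.
Qed.

End Tracing.

Lemma trace_paths_ok (pred : 'I_n -> 'I_n -> 'I_n) E S :
  env S -> key_table E S -> (forall u w, (E u w).2 <= n) ->
  (forall u w, ncell S q_pred (u * n + w) = pred u w) ->
  wp trace_paths (fun S' => forall i, ncell S' q_path i =
    iter ((E (prow i) (pcol i)).2 - pslot i) (pred (prow i)) (pcol i)) S.
Proof.
move=> env_S keys_S le_hops pred_S; have Ev := envE env_S.
pose steps i := (E (prow i) (pcol i)).2 - pslot i.
apply: (wp_setn (v := fun i => pcol i)) => [i|]; first by evaluate Ev.
apply: (wp_setn (v := steps)) => [i|].
  by rewrite /steps -(key_table_hops _ _ keys_S); evaluate Ev.
set S1 := setn _ _ _; have env_S1 : env S1 by do 2!apply: env_setn => //.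
have tracing_S1 : tracing pred steps 0 S1.
  by split=> // i; rewrite expn0 ?modn1 ?divn1.
apply: (wp_seq (tracing_loop_ok tracing_S1)) => S2 [env_S2 _ vertex_S2 _] _.
pose vertex i := nat_of_ord (iter (steps i) (pred (prow i)) (pcol i)).
apply: (wp_seq
  (wp_putn_pid (cd := xpredT) (val := vertex) _ env_S2 _ _ _)) => //.
- move=> i _; rewrite /evaln /= vertex_S2 modn_small //.
  apply: leq_ltn_trans (lg_gt n).
  by rewrite leq_subLR (leq_trans (le_hops _ _)) ?leq_addl.
- by move=> i _; apply/ltnW/ltn_ord.
Qed.

Lemma lg_leq : lg k <= lg n.
Proof. by rewrite ltnS leq_trunc_log. Qed.

Lemma lg_k_le_n : lg k <= n.
Proof.
apply: leq_trans k_le_n; apply: leq_trans (lg_le k_gt0 (ltnSn _)).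
exact: ltn_expl.
Qed.

Lemma store_logk_ok S :
  env S -> wp store_logk (fun S' => ncell S' q_logk 0 = lg k) S.
Proof.
move=> env_S; have E := envE env_S; apply: (wp_setn (v := fun=> 0)) => //.
pose I j S' := env S' /\ forall i, regn S' i r_logk = j.
apply: (wp_seq (Q1 := I (lg k))) => [|S1 [env_S1 logk_S1] _].
  apply: wp_halving => // [|i|j S' f [? ?]||j S' lt_j _ [env_S' logk_S']].
  - exact: lg_leq.
  - by evaluate E.
  - by split=> //; apply: env_setn.
  - by split=> //; apply: env_setn.
  apply: (wp_setn (v := fun=> j.+1)) => [i|]; last first.
    by split=> [|i]; [apply: env_setn | rewrite /= upd_eq].
  by evaluate (envE env_S'); rewrite logk_S'; have := lg_k_le_n; lia.
have {}E := envE env_S1.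
have addr : addressing Z S1 ($r_pid < #1)%nexp (#0)%nexp
    (fun i : 'I_p => i < 1) (fun=> 0).
  split=> // [i|i|i _|i i' lt_i lt_i' _]; last by
    apply: val_inj; case: i i' lt_i lt_i' => -[|?] ? [[|?] ?].
  - by rewrite E.
  - by evaluate E.
  exact: leq_ltn_trans (leq0n p) procs_lt.
apply: (wp_seq (wp_putn _ q_logk $r_logk addr)) => S2 [hit _] _.
have p_gt0 : 0 < p by rewrite !muln_gt0 n_gt0.
have := hit (Ordinal p_gt0) isT; rewrite env_clamp // /evaln /= logk_S1 => ->.
exact/minn_idPl/lg_k_le_n.
Qed.

Definition output_offset i := n * n + prow i * k + (pslot i - 1).

Definition has_output i := [&& pcol i < 1, 0 < pslot i & pslot i < n].

Lemma output_offset_inj : {in has_output &, injective output_offset}.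
Proof.
move=> i i' /and3P[lt_w x_gt0 lt_x] /and3P[lt_w' x_gt0' lt_x'].
have lt_k : pslot i - 1 < k by have := ltn_ord (pslot i); lia.
have lt_k' : pslot i' - 1 < k by have := ltn_ord (pslot i'); lia.
rewrite /output_offset -!addnA => /addnI/(mul_add_inj lt_k lt_k')[eq_u eq_x].
by apply: proc_inj; apply: val_inj => /=; lia.
Qed.

Lemma output_ok E S : env S -> key_table E S -> sorted_table E S ->
  wp output (fun S' => forall u x (v := at_rank (E u) u x.+1),
    x < minn k n.-1 ->
    kcell S' q_io (n * n + u * k + x) = ((E u v).1, nat_of_ord v)) S.
Proof.
move=> env_S keys_S sorted_S; have Ev := envE env_S.
pose vertex i := ncell S q_sorted (prow i * n + pslot i).
pose dist i := wcell S q_key (prow i * n + vertex i).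
apply: (wp_setn (v := vertex)) => [i|]; first by evaluate Ev.
apply: (wp_setw (v := dist)) => [i|]; first by evaluate Ev.
apply: (wp_setn (v := has_output)) => [i|].
  by evaluate Ev; rewrite !mulnb.
apply: (wp_setn (v := output_offset)) => [i|]; first by evaluate Ev.
set S1 := setn _ _ _.
have env_S1 : env S1.
  by do 2!apply: env_setn => //; apply: env_setw; apply: env_setn.
have addr :
    addressing Z S1 ($r_valid)%nexp ($r_offset)%nexp has_output output_offset.
  split=> // [i|i|i /and3P[_ _ lt_x]|]; last exact: output_offset_inj.
  - by rewrite (envE env_S1).
  - by evaluate Ev.
  by rewrite /output_offset; have := ltn_ord (prow i); move: k_le_n; nia.
apply: (wp_seq (wp_put_key _ q_io $r_vertex w_dist addr _ _)) => //.
move=> S2 [hit _] _ u x v lt_x.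
have lt_slot : x.+1 < k.+1 by lia.
pose i := proc u (Ordinal n_gt0) (Ordinal lt_slot).
have lt_n : x.+1 < n by lia.
have -> : n * n + u * k + x = output_offset i.
  by rewrite /output_offset !procE /= subn1.
rewrite hit; last by rewrite /has_output !procE.
have vertex_i : vertex i = v.
  by rewrite /vertex !procE /= -{1}(at_rankK (E u) u lt_n) sorted_S.
rewrite env_clamp // /evaln /= /upd /= /dist vertex_i procE.
rewrite (key_table_dist _ _ keys_S); congr (_, _).
exact/minn_idPl/ltnW.
Qed.

Local Notation K := (min_key G).

Definition exact_keys E :=
  (forall u w, (E u w).2 <= n) /\ forall u, agree_up_to k (K u) (E u).

Lemma initial_input_table : input_table (initial_state p [:: n; k] (input G)).
Proof.
move=> v w; rewrite /wcell /= mul0n add0n divnMDl ?n_gt0 // modnMDl.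
by rewrite divn_small // addn0 modn_small // !valK /edge_key; case: ifP.
Qed.

Lemma compute_keys_ok : wp compute_keys (fun S => [/\ env S, input_table S
    & exists2 E, exact_keys E & key_table E S /\ sorted_table E S])
  (initial_state p [:: n; k] (input G)).
Proof.
apply: (wp_seq (setup_ok (input G))) => S1 env_S1 frame1.
have input_S1 := input_table_frame initial_input_table frame1 isT.
apply: (wp_seq (init_keys_ok env_S1 input_S1)) => S2 keys_S2 frame2.
have env_S2 := env_frame env_S1 frame2 isT.
have input_S2 := input_table_frame input_S1 frame2 isT.
pose I j S := [/\ env S, input_table S
  & exists2 E, key_table E S & approximates G k (2 ^ j) E].
apply: (wp_seq (Q1 := I (lg n))).
  apply: halving_ok => //.
  - by move=> j S f [? ? ?]; split=> //; apply: env_setn.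
  - by split=> //; exists (init_key G) => //; apply: approximates_init.
  move=> j S _ _ [env_S input_S [E keys_S approx_E]].
  apply: (wp_frame (square_ok env_S keys_S approx_E)).
  move=> S' [E' keys_S' approx_E'] frame_S; split.
  - exact: env_frame frame_S isT.
  - exact: input_table_frame frame_S isT.
  by exists E' => //; rewrite expnS mul2n -addnn.
move=> S3 [env_S3 input_S3 [E keys_S3 approx_E]] _.
apply: (wp_seq (sort_rows_ok env_S3 keys_S3)) => S4 sorted_S4 frame4; split.
- exact: env_frame frame4 isT.
- exact: input_table_frame frame4 isT.
exists E; last by split=> //; apply: key_table_frame frame4 isT.
split; first by case: approx_E.
by move=> u; apply: approximates_agree (ltnW (lg_gt n)) approx_E.
Qed.

Definition preprocessed (pred : 'I_n -> 'I_n -> 'I_n) (m : memory R) :=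
  [/\ forall u w, vrank (K u) w <= k ->
        nmem m (q_key * Z + (u * n + w)) = (K u w).2,
      forall u w x, vrank (K u) w <= k -> x <= k ->
        nmem m (q_path * Z + ((u * n + w) * k.+1 + x)) =
        iter ((K u w).2 - x) (pred u) w,
      nmem m (q_logk * Z) = lg k
    & stores_nearest k G (neighbours G k) m].

Lemma output_stores_nearest E S : exact_keys E ->
  (forall u x (v := at_rank (E u) u x.+1), x < minn k n.-1 ->
     kcell S q_io (n * n + u * k + x) = ((E u v).1, nat_of_ord v)) ->
  stores_nearest k G (neighbours G k) (ram S).
Proof.
move=> [_ agree_E] output_S u x; rewrite size_neighbours => lt_x v.
rewrite /v nth_neighbours // -mulnn; have := output_S u x lt_x.
rewrite (at_rank_agree _ (agree_E u)); [|lia..].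
rewrite (agree_E u).2 ?min_key_dist => [[dist_v vertex_v]|]; first by split.
by rewrite at_rankK; lia.
Qed.

Lemma preprocess_ok : wp preprocess
  (fun S => exists2 pred, forall u, predecessor_table G k u (pred u) &
                          preprocessed pred (ram S))
  (initial_state p [:: n; k] (input G)).
Proof.
apply: (wp_seq compute_keys_ok).
move=> S1 [env_S1 input_S1 [E [le_hops agree_E] [keys_S1 sorted_S1]]] _.
apply: (wp_seq
  (find_predecessors_ok env_S1 keys_S1 sorted_S1 input_S1 agree_E)).
move=> S2 [pred predP pred_S2] frame2.
have env_S2 := env_frame env_S1 frame2 isT.
have keys_S2 := key_table_frame keys_S1 frame2 isT.
have sorted_S2 := sorted_table_frame sorted_S1 frame2 isT.
apply: (wp_seq (trace_paths_ok env_S2 keys_S2 le_hops pred_S2)).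
move=> S3 path_S3 frame3; have env_S3 := env_frame env_S2 frame3 isT.
have keys_S3 := key_table_frame keys_S2 frame3 isT.
have sorted_S3 := sorted_table_frame sorted_S2 frame3 isT.
apply: (wp_seq (store_logk_ok env_S3)) => S4 logk_S4 frame4.
have env_S4 := env_frame env_S3 frame4 isT.
have keys_S4 := key_table_frame keys_S3 frame4 isT.
have sorted_S4 := sorted_table_frame sorted_S3 frame4 isT.
apply: (wp_seq (output_ok env_S4 keys_S4 sorted_S4)) => S5 output_S5 frame5.
have keys_S5 := key_table_frame keys_S4 frame5 isT.
have [_ _ ncell4 _] := frame4; have [_ _ ncell5 _] := frame5.
exists pred => //; split.
- move=> u w /(agree_E u).2 <-; exact: key_table_hops keys_S5.
- move=> u w x le_w le_x; rewrite -(agree_E u).2 //.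
  have := path_S3 (proc u w (Ordinal (le_x : x < k.+1))).
  rewrite !procE /= => <-; rewrite -[nmem _ _]/(ncell S5 _ _).
  by rewrite ncell5 ?ncell4 // (pid_lt (proc u w (Ordinal (le_x : x < k.+1)))).
- have := logk_S4; rewrite -(ncell5 q_logk) ?/(ncell _ _ _) ?addn0 //.
  exact: leq_ltn_trans (leq0n p) procs_lt.
exact: output_stores_nearest output_S5.
Qed.

End Preprocessing.

Section Reporting.
Variables (R : realDomainType) (n k : nat) (G : wdigraph R n).
Hypothesis k_le_n : k <= n.
Variables (pred : 'I_n -> 'I_n -> 'I_n) (m : memory R) (u w : 'I_n).
Hypothesis predP : predecessor_table G k u (pred u).
Hypothesis memory_m : preprocessed k G pred m.
Hypotheses (le_w : vrank (min_key G u) w <= k) (uw : reachable G u w).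
Local Notation s := (min_key G u w).2.
Local Notation p := (s %/ lg k).+1.
Local Notation Z := ((n + 2) * (n + 2) * (n + 2)).
Local Notation T := (minn s.+1 (lg k)).
Local Notation wp := (@wp R p Z T).
Local Notation ncell := (@ncell R p Z).
Local Notation path_vertex x := (iter (s - x) (pred u) w).
Implicit Types (S : state R p) (i : 'I_p).

Definition report_env S :=
  (((forall i, regn S i r_pid = i) * (forall i, regn S i r_n = n) *
    (forall i, regn S i r_k = k) * (forall i, regn S i r_src = u) *
    (forall i, regn S i r_dst = w) * (forall i, regn S i r_region = Z) *
    (forall i, regn S i r_hops = s) * (forall i, regn S i r_logk = lg k)))%type.

Definition path_cell x := (u * n + w) * k.+1 + x.

(* After j iterations, the last j cells of each block have been copied. *)
Definition reporting j S := [/\ report_env S,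
  forall x, x <= s -> ncell S q_path (path_cell x) = path_vertex x,
  ncell S q_io 0 = s
  & forall i y, T - j <= y < T -> i * lg k + y <= s ->
      ncell S q_io (i * lg k + y).+1 = path_vertex (i * lg k + y)].

Lemma hops_le_k : s <= k.
Proof. exact: leq_trans (hops_le_vrank uw) le_w. Qed.

Lemma path_cell_lt x : x <= s -> path_cell x < Z.
Proof.
move=> le_x; have lt_x := leq_ltn_trans (leq_trans le_x hops_le_k) (ltnSn k).
apply: leq_trans (mul_add_lt (mul_add_lt (ltn_ord u) (ltn_ord w)) lt_x) _.
by move: k_le_n; nia.
Qed.

Lemma report_step_ok j S : j < T -> (forall i, regn S i r_phase = T - j) ->
  reporting j S -> wp report_step (reporting j.+1) S.
Proof.
move=> lt_j phase_S [env_S path_S hops_S done_S].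
pose off i := i * lg k + (T - j.+1).
have off_lt i : T - j.+1 < lg k by have := geq_minr s.+1 (lg k); lia.
apply: (wp_setn (v := off)) => [i|].
  by evaluate env_S; rewrite phase_S /off; lia.
set S1 := setn _ _ _; have le_sn := leq_trans hops_le_k k_le_n.
have addr :
    addressing Z S1 ($r_offset < $r_hops + #1)%nexp ($r_offset + #1)%nexp
      (fun i => off i <= s) (fun i => (off i).+1).
  split=> [i|i|i _|i le_i|i i' _ _ []]; rewrite ?addn1.
  - by rewrite /= /upd /= env_S.
  - by evaluate env_S; rewrite addn1.
  - by evaluate env_S; rewrite addn1.
  - by nia.
  by case/(mul_add_inj (off_lt i) (off_lt i')) => /val_inj.
apply: (wp_seq (wp_putn _ q_io _ addr)) => S2 [hit miss] frame2.
have [regn2 _ ncell2 _] := frame2.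
have copied i : off i <= s -> ncell S2 q_io (off i).+1 = path_vertex (off i).
  move=> le_i; rewrite hit // (@evaln_clamp _ _ n) /= ?upd_neq ?env_S //.
  evaluate env_S; rewrite addn1.
  rewrite -[nmem _ _]/(ncell S q_path (path_cell (off i))) path_S //.
  exact/minn_idPl/ltnW.
have pos_Z : 0 < Z by nia.
split.
- by do !split; move=> i; rewrite regn2 // /S1 /= upd_neq // env_S.
- by move=> x le_x; rewrite ncell2 ?path_cell_lt //; apply: path_S.
- by rewrite miss.
move=> i y range_y le_y; have [eq_y|neq_y] := eqVneq y (T - j.+1).
  by rewrite eq_y in le_y *; apply: copied.
have lt_y : y < lg k by have := geq_minr s.+1 (lg k); lia.
rewrite miss; [by apply: done_S; lia | by nia |].
move=> i' _ [] /(mul_add_inj (off_lt i') lt_y)[_ eq_y].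
by rewrite eq_y eqxx in neq_y.
Qed.

Lemma report_ok : wp report (fun S =>
  stores_path u (traceback G u (pred u) w) (ram S))
  (initial_state p [:: n; k; val u; val w] m).
Proof.
have [hops_m path_m logk_m _] := memory_m.
apply: (wp_setn (v := fun=> Z)) => //.
apply: (wp_setn (v := fun=> s)) => [i|]; first by evaluate hops_m.
apply: (wp_setn (v := fun=> lg k)) => [i|].
  by evaluate logk_m; rewrite addn0.
set S1 := setn _ _ _; have env_S1 : report_env S1 by do !split.
have addr : addressing Z S1 ($r_pid < #1)%nexp (#0)%nexp
    (fun i : 'I_p => i < 1) (fun=> 0).
  split=> // [i|i _|i i' lt_i lt_i' _]; last by
    apply: val_inj; case: i i' lt_i lt_i' => -[|?] ? [[|?] ?].
    by evaluate env_S1.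
  by nia.
apply: (wp_seq (wp_putn _ q_io $r_hops addr)) => S2 [hit _] frame2.
have [regn2 _ ncell2 _] := frame2.
have env_S2 : report_env S2 by do !split; move=> i; rewrite regn2 // env_S1.
have hops_S2 : ncell S2 q_io 0 = s.
  have := hit ord0 isT; rewrite (@evaln_clamp _ _ n) // => ->.
  by rewrite /evaln /=; apply/minn_idPl/(leq_trans hops_le_k).
apply: (wp_seq (Q1 := reporting T)).
  apply: wp_countdown => //; last exact: report_step_ok.
  - by move=> i; evaluate env_S2; rewrite addn1 -minnE minnC.
  - split=> // [x le_x|i y]; last by rewrite subn0; lia.
    rewrite ncell2 ?path_cell_lt // -path_m //.
    exact: leq_trans le_x hops_le_k.
move=> S3 [_ _ hops_S3 done_S3] _; split.
  by rewrite size_traceback.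
rewrite size_traceback => x le_x.
rewrite (nth_traceback predP) //.
have lt_p : x %/ lg k < p by rewrite ltnS leq_div2r.
have := done_S3 (Ordinal lt_p) (x %% lg k); rewrite /= -divn_eq; apply=> //.
rewrite subnn leq_min ltn_pmod // andbT ltnS.
exact: leq_trans (leq_mod _ _) le_x.
Qed.

End Reporting.

(** * Time and work *)

Lemma preprocess_exec (R : realDomainType) (n k B : nat) (G : wdigraph R n) :
  0 < k -> k <= n -> (n + 2) ^ max_degree <= B ->
  exists T m (pred : 'I_n -> 'I_n -> 'I_n),
    [/\ T <= cmd_time preprocess * lg n ^ 3,
        exec B (n * n * k.+1) T (compile preprocess) [:: n; k] (input G) m,
        typed_mem n m, forall u, predecessor_table G k u (pred u)
      & preprocessed k G pred m].
Proof.
move=> k_gt0 k_le_n le_B; rewrite -loop_depth_preprocess.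
have le_p : n * n * k.+1 <= (n + 2) ^ 3.
  by rewrite !expnS expn0 muln1; nia.
have le_args : all (leq^~ (n + 2)) [:: n; k] by rewrite /= andbT; lia.
have mem_m : typed_mem n (input G) by [].
have [T [S [le_T exec_T mem_S [pred predP mem_pred]]]] :=
  wp_exec le_B (ltn0Sn _) cmd_ok_preprocess le_args isT le_p mem_m
    (preprocess_ok G k_gt0 k_le_n).
by exists T, (ram S), pred.
Qed.

Lemma report_exec (R : realDomainType) (n k B : nat) (G : wdigraph R n)
    (pred : 'I_n -> 'I_n -> 'I_n) (m : memory R) (u w : 'I_n)
    (s := (min_key G u w).2) :
  k <= n -> (n + 2) ^ max_degree <= B ->
  predecessor_table G k u (pred u) ->
  typed_mem n m -> preprocessed k G pred m ->
  vrank (min_key G u) w <= k -> reachable G u w ->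
  exists T m',
    [/\ T <= cmd_time report * minn s.+1 (lg k),
        exec B (s %/ lg k).+1 T (compile report)
          [:: n; k; nat_of_ord u; nat_of_ord w] m m'
      & stores_path u (traceback G u (pred u) w) m'].
Proof.
move=> k_le_n le_B predP mem_m mem_pred le_w uw.
have s_lt_n : s < n := reachable_hops_lt uw.
have le_p : (s %/ lg k).+1 <= (n + 2) ^ 3.
  rewrite -(leq_add2r 1); have := leq_div s (lg k).
  by rewrite !expnS expn0; nia.
have le_args : all (leq^~ (n + 2)) [:: n; k; nat_of_ord u; nat_of_ord w].
  by rewrite /= andbT; have := ltn_ord u; have := ltn_ord w; lia.
have T_gt0 : 0 < minn s.+1 (lg k) by rewrite leq_min.
have [T [S [le_T exec_T _ path_S]]] :=
  wp_exec le_B T_gt0 cmd_ok_report le_args isT le_p mem_m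
    (report_ok k_le_n predP mem_pred le_w uw).
by exists T, (ram S); rewrite loop_depth_report expn1 in le_T.
Qed.

Lemma preprocess_work (n k L T a c : nat) :
  0 < k -> 0 < L -> 3 <= c -> 2 * a <= c -> T <= a * L ^ 3 ->
  T <= c * L ^ c /\ n * n * k.+1 * T <= c * (k * n ^ 2) * L ^ c.
Proof.
move=> k_gt0 L_gt0 le_3c le_ac le_T.
have {}le_T : T <= a * L ^ c.
  by apply: leq_trans le_T _; rewrite leq_mul2l leq_pexp2l ?orbT.
split; first by apply: leq_trans le_T _; rewrite leq_mul2r; lia.
apply: (@leq_trans (n * n * (2 * k) * (a * L ^ c))).
  by rewrite leq_mul // leq_mul2l; lia.
rewrite mulnA leq_mul2r -mulnn; apply/orP; right.
have := leq_mul le_ac (leqnn (k * (n * n))); nia.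
Qed.

Lemma report_work (s l T a c : nat) :
  0 < s -> 0 < l -> 3 * a <= c -> T <= a * minn s.+1 l ->
  T <= c * l /\ (s %/ l).+1 * T <= c * s.
Proof.
move=> s_gt0 l_gt0 le_ac le_T; split.
  apply: leq_trans le_T _; apply: leq_mul; first by lia.
  exact: geq_minr.
have le_s : s %/ l * minn s.+1 l <= s.
  by apply: leq_trans (leq_divM s l); rewrite leq_mul2l geq_minr orbT.
apply: leq_trans (_ : a * (3 * s) <= _); last first.
  by rewrite mulnCA mulnA leq_mul2r le_ac orbT.
apply: leq_trans (leq_mul (leqnn _) le_T) _.
rewrite mulnCA leq_mul2l mulSn; apply/orP; right.
by have := geq_minl s.+1 l; lia.
Qed.

Theorem theorem13 :
  exists (pre rep : program) (P : nat -> nat -> nat)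
         (Q : nat -> nat -> nat -> nat) (c : nat),
  forall (R : realDomainType) (n k : nat) (G : wdigraph R n),
  1 <= k <= n ->
  exists (T : nat) (m : memory R) (N : 'I_n -> seq 'I_n),
    [/\ T <= c * lg n ^ c,
        P n k * T <= c * (k * n ^ 2) * lg n ^ c,
        exec ((n + 2) ^ c) (P n k) T pre [:: n; k] (input G) m,
        (forall u : 'I_n, nearest G k u (N u)) /\ stores_nearest k G N m
      & forall i j : 'I_n, j \in N i -> (dist G i j < +oo)%E ->
        exists (q : seq 'I_n) (T' : nat) (m' : memory R),
          [/\ shortest_path G i j q,
              T' <= c * lg k,
              Q n k (size q) * T' <= c * size q,
              exec ((n + 2) ^ c) (Q n k (size q)) T' rep
                   [:: n; k; nat_of_ord i; nat_of_ord j] m m'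
            & stores_path i q m']].
Proof.
have [c [le_deg le_pre le_rep]] : exists c, [/\ max_degree <= c,
    2 * cmd_time preprocess <= c & 3 * cmd_time report <= c].
  move: max_degree (cmd_time preprocess) (cmd_time report) => d a b.
  by exists (d + 2 * a + 3 * b); split; lia.
exists (compile preprocess), (compile report), (fun n k => n * n * k.+1),
  (fun n k s => (s %/ lg k).+1), c => R n k G /andP[k_gt0 k_le_n].
have le_B : (n + 2) ^ max_degree <= (n + 2) ^ c by rewrite leq_pexp2l ?addn2.
have [T [m [pred [le_T exec_T mem_m predP mem_pred]]]] :=
  preprocess_exec G k_gt0 k_le_n le_B.
have [time_T work_T] := preprocess_work n k_gt0 (ltn0Sn _)
  (leq_trans (isT : 3 <= max_degree) le_deg) le_pre le_T.
exists T, m, (neighbours G k); split=> //.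
  by split; [move=> u; apply: nearest_neighbours | case: mem_pred].
move=> u w /mem_neighboursP/andP[rank_gt0 le_w] dist_lty.
have uw : reachable G u w by rewrite reachable_lty min_key_dist.
have neq_uw : u != w by apply: contraTneq rank_gt0 => ->; rewrite vrank_self.
have [T' [m' [le_T' exec_T' path_m']]] :=
  report_exec k_le_n le_B (predP u) mem_m mem_pred le_w uw.
have [time_T' work_T'] :=
  report_work (hops_gt0 uw neq_uw) (ltn0Sn _) le_rep le_T'.
exists (traceback G u (pred u) w), T', m'; rewrite size_traceback; split=> //.
exact: (shortest_traceback (predP u)).
Qed.
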